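(* Consider types BD1, C1, C2, D3 in finite dimension (see context): $V$ of dimension $n$ with $\omega,\phi,\delta$, $V=V_+\oplus V_-$, groups $K,G^0\subset G=G(V,\omega)$, and the variety $X_\omega$ of isotropic complete flags. Let $(p,q)=(\dim V_+,\dim V_-)$ (so $p=q=\frac n2$ in types C1 and D3). Set $(\eta,\epsilon)=(1,1)$ in type BD1, $(1,-1)$ in type C2, $(-1,-1)$ in type C1, $(-1,1)$ in type D3. (a) For $(w,\varepsilon)\in\mathfrak{I}_n^{\eta,\epsilon}(p,q)$ consider the following condition on bases $\underline v=(v_1,\ldots,v_n)$ of $V$: $$(\ast)\quad\omega(v_k,v_\ell)=\begin{cases}0&\text{if }\ell\ne n-k+1\\1&\text{if }\ell=n-k+1\text{ and }w_k,w_\ell\in[k,\ell]\ (k\le\ell)\\ \epsilon&\text{if }\ell=n-k+1\text{ and }w_k,w_\ell\in[\ell,k]\ (\ell\le k)\\ \eta&\text{if }\ell=n-k+1\text{ and }k,\ell\in\,]w_k,w_\ell[\\ \eta\epsilon&\text{if }\ell=n-k+1\text{ and }k,\ell\in\,]w_\ell,w_k[.\end{cases}$$ Then for every $(w,\varepsilon)\in\mathfrak{I}_n^{\eta,\epsilon}(p,q)$: $$\mathcal{O}^{\eta,\epsilon}_{(w,\varepsilon)}:=\mathcal{O}_{(w,\varepsilon)}\cap X_\omega=\{\mathcal{F}(\underline v):\underline v\text{ is }(w,\varepsilon)\text{-conjugate and satisfies }(\ast)\}\ne\emptyset,$$ $$\mathfrak{O}^{\eta,\epsilon}_{(w,\varepsilon)}:=\mathfrak{O}_{(w,\varepsilon)}\cap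 X_\omega=\{\mathcal{F}(\underline v):\underline v\text{ is }(w,\varepsilon)\text{-dual and satisfies }(\ast)\}\ne\emptyset,$$ $$\mathcal{O}^{\eta,\epsilon}_{(w,\varepsilon)}\cap\mathfrak{O}^{\eta,\epsilon}_{(w,\varepsilon)}=\{\mathcal{F}(\underline v):\underline v\text{ is }(w,\varepsilon)\text{-conjugate and }(w,\varepsilon)\text{-dual and satisfies }(\ast)\}\ne\emptyset.$$ (b) The subsets $\mathcal{O}^{\eta,\epsilon}_{(w,\varepsilon)}$ ($(w,\varepsilon)\in\mathfrak{I}_n^{\eta,\epsilon}(p,q)$) are exactly the $K$-orbits of $X_\omega$. The subsets $\mathfrak{O}^{\eta,\epsilon}_{(w,\varepsilon)}$ ($(w,\varepsilon)\in\mathfrak{I}_n^{\eta,\epsilon}(p,q)$) are exactly the $G^0$-orbits of $X_\omega$. (c) The map $\mathcal{O}^{\eta,\epsilon}_{(w,\varepsilon)}\mapsto\mathfrak{O}^{\eta,\epsilon}_{(w,\varepsilon)}$ is Matsuki duality.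
   Context: Let $V=\langle e_1,\ldots,e_n\rangle_{\mathbb{C}}$ with vectors identified with coordinate columns and $\overline{x}$ the coordinatewise conjugate. Let $\Omega$ be an $n\times n$ block-diagonal matrix whose diagonal blocks are each $\begin{pmatrix}0&1\\1&0\end{pmatrix}$ or $(1)$ in types BD1 and D3 (symmetric case), and all equal to $\begin{pmatrix}0&1\\-1&0\end{pmatrix}$ in types C1 and C2 (symplectic case); $\omega(x,y)={}^tx\,\Omega\,y$. For each $\ell$ let $\ell^*$ be the unique index with $\omega(e_\ell,e_{\ell^*})\ne0$. Fix a partition $\{1,\ldots,n\}=N_+\sqcup N_-$ such that: in types BD1 and C2, $\ell\in N_+\Leftrightarrow\ell^*\in N_+$; in types C1 and D3, $\ell\in N_+\Leftrightarrow\ell^*\in N_-$ (so in type D3 all blocks have size 2). Let $\Phi$ be the diagonal matrix with entries $\pm1$ at positions $\ell\in N_\pm$, $\phi(x,y)={}^t\overline{x}\,\Phi\,y$, $\delta(x)=\Phi x$, $V_\pm=\langle e_\ell:\ell\in N_\pm\rangle_{\mathbb C}$. Thus $V_+^\perp=V_-$ in types BD1, C2, while $V_\pm^\perp=V_\pm$ in types C1, D3 ($\perp$ with respect to $\omega$). Let $G=G(V,\omega)=\{g\in\mathrm{GL}(V):g\text{ preserves }\omega\}$, $K=\{g\in G:g\delta=\delta g\}$, $G^0=\{g\in G:g\text{ preserves }\phi\}$. $X$ is the variety of complete flags $(F_0\subset\cdots\subset F_n=V)$, $\dim F_k=k$, and $X_\omega=\{(F_k)\in X:F_k^\perp=F_{n-k}\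 \forall k\}$. $\mathcal{F}(v_1,\ldots,v_n)$ is the flag with $F_k=\langle v_1,\ldots,v_k\rangle_{\mathbb{C}}$. A signed involution is a pair $(w,\varepsilon)$ with $w\in\mathfrak{S}_n$, $w^2=\mathrm{id}$ (write $w_k=w(k)$), and $\varepsilon:\{k:w_k=k\}\to\{+1,-1\}$, $k\mapsto\varepsilon_k$. $\mathfrak{I}_n(p,q)$ ($n=p+q$) is the set of signed involutions with $p=|\{k:w_k=k,\varepsilon_k=+1\}|+|\{k:w_k<k\}|$ and $q=|\{k:w_k=k,\varepsilon_k=-1\}|+|\{k:w_k<k\}|$. With $w_0(k)=n-k+1$, for $(\eta,\epsilon)\in\{1,-1\}^2$ let $\mathfrak{I}^{\eta,\epsilon}_n(p,q)$ be the set of $(w,\varepsilon)\in\mathfrak{I}_n(p,q)$ such that (i) $ww_0=w_0w$; (ii) $\varepsilon_{w_0(k)}=\eta\varepsilon_k$ for all $k$ with $w_k=k$; and, if $\eta\ne\epsilon$, (iii) $w_k\ne w_0(k)$ for all $k$. A basis $(v_1,\ldots,v_n)$ of $V$ is $(w,\varepsilon)$-conjugate if for all $k$: $\delta(v_k)=\varepsilon_kv_k$ when $w_k=k$ and $\delta(v_k)=v_{w_k}$ when $w_k\ne k$. It is $(w,\varepsilon)$-dual if for all $k,\ell$: $\phi(v_k,v_\ell)=\varepsilon_k$ if $w_k=\ell=k$, $=1$ if $w_k=\ell\ne k$, $=0$ if $w_k\ne\ell$. $\mathcal{O}_{(w,\varepsilon)}\subset X$ (resp. $\mathfrak{O}_{(w,\varepsilon)}\subset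 X$) is the set of flags $\mathcal{F}(\underline v)$ with $\underline v$ $(w,\varepsilon)$-conjugate (resp. $(w,\varepsilon)$-dual). $[a,b]$ and $]a,b[$ denote closed and open intervals. Matsuki duality is the unique bijection $\Xi$ from the set of $K$-orbits of $X_\omega$ to the set of $G^0$-orbits of $X_\omega$ such that $\mathcal{O}\cap\Xi(\mathcal{O})$ is a single $K\cap G^0$-orbit for every $K$-orbit $\mathcal{O}$. *)

(* Defs.v *)
From HB Require Import structures.
From mathcomp Require Import all_boot all_order all_fingroup all_algebra.
From mathcomp Require Import complex.
From mathcomp Require Import boolp classical_sets functions reals.

Set Implicit Arguments.
Unset Strict Implicit.
Unset Printing Implicit Defensive.

Import Order.TTheory GRing.Theory Num.Theory.

Local Open Scope classical_set_scope.
Local Open Scope ring_scope.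

Variant form_type := BD1 | C1 | C2 | D3.

Definition eta (t : form_type) : int :=
  match t with BD1 | C2 => 1 | C1 | D3 => -1 end.

Definition epsilon (t : form_type) : int :=
  match t with BD1 | D3 => 1 | C1 | C2 => -1 end.

(** * Signed involutions

    Positions are 0-based, so that [n - k + 1] becomes [rev_ord k]. The sign
    function is extended by 0 outside the fixed points of the involution, so a
    signed involution is represented by exactly one pair. *)

Definition signed_perm n := ('S_n * {ffun 'I_n -> int})%type.

Definition is_signed_involution n (we : signed_perm n) : Prop :=
  (forall k, we.1 (we.1 k) = k) /\
  (forall k, if we.1 k == k then we.2 k = 1 \/ we.2 k = -1 else we.2 k = 0).

Definition signed_involutions n (p q : nat) : set (signed_perm n) :=
  [set we | [/\ is_signed_involution we,
    p = (#|[set k | (we.1 k == k) && (we.2 k == 1)%R]%SET|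
         + #|[set k | (we.1 k < k)%N]%SET|)%N &
    q = (#|[set k | (we.1 k == k) && (we.2 k == -1)%R]%SET|
         + #|[set k | (we.1 k < k)%N]%SET|)%N]].

Definition w0 n : 'S_n := perm (@rev_ord_inj n).

Definition signed_involutions_sym (t : form_type) n (p q : nat) :
    set (signed_perm n) :=
  [set we | [/\ signed_involutions p q we,
    (we.1 * w0 n = w0 n * we.1)%g,
    forall k, we.1 k = k -> we.2 (w0 n k) = eta t * we.2 k &
    eta t <> epsilon t -> forall k, we.1 k <> w0 n k]].

Section Space.
Variables (C : numClosedFieldType) (n : nat).
Local Notation V := 'cV[C]_n.

Definition basis_vec (l : 'I_n) : V := delta_mx l 0.

(** * The bilinear form [omega], the hermitian form [phi] and [delta] *)

Definition omega (Om : 'M[C]_n) (x y : V) : C := (x^T *m Om *m y) 0 0.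

(** A block is encoded by a boolean: [true] for the 2 x 2 block with rows
    [(0, 1)] and [(epsilon t, 0)], [false] for the block [(1)]. *)
Definition block_size (b : bool) : nat := if b then 2 else 1.

Definition form_block (t : form_type) (b : bool) : 'M[C]_(block_size b) :=
  \matrix_(i, j)
    if b then
      if (i < j)%N then 1 else if (j < i)%N then (epsilon t)%:~R else 0
    else 1.

Definition is_form_matrix (t : form_type) (Om : 'M[C]_n) : Prop :=
  exists (m : nat) (b : 'I_m -> bool)
         (en : (\sum_(i < m) block_size (b i))%N = n),
    (epsilon t = -1 -> forall i, b i) /\
    Om = castmx (en, en) (\mxdiag_(i < m) form_block t (b i)).

(** The default value is never used when [Om] satisfies [is_form_matrix]. *)
Definition dual_index (Om : 'M[C]_n) (l : 'I_n) : 'I_n :=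
  odflt l [pick l' | omega Om (basis_vec l) (basis_vec l') != 0].

(** [Np] is N_+, and N_- is its complement. *)
Definition is_compatible (t : form_type) (Om : 'M[C]_n) (Np : {set 'I_n}) :
    Prop :=
  match t with
  | BD1 | C2 => forall l, l \in Np <-> dual_index Om l \in Np
  | C1 | D3 => forall l, l \in Np <-> dual_index Om l \in (~: Np)%SET
  end.

Definition Phi (Np : {set 'I_n}) : 'M[C]_n :=
  diag_mx (\row_l if l \in Np then 1 else -1).

Definition phi (Np : {set 'I_n}) (x y : V) : C :=
  ((map_mx Num.conj x)^T *m Phi Np *m y) 0 0.

Definition delta (Np : {set 'I_n}) (x : V) : V := Phi Np *m x.

Definition coord_space (N : {set 'I_n}) : {vspace V} :=
  <<[seq basis_vec l | l in N]>>%VS.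

(** * Groups *)

Definition isom_group (Om : 'M[C]_n) : set 'M[C]_n :=
  [set g | g \in unitmx /\
           forall x y, omega Om (g *m x) (g *m y) = omega Om x y].

Definition K_group (Om : 'M[C]_n) (Np : {set 'I_n}) : set 'M[C]_n :=
  [set g | isom_group Om g /\
           forall x, g *m delta Np x = delta Np (g *m x)].

Definition G0_group (Om : 'M[C]_n) (Np : {set 'I_n}) : set 'M[C]_n :=
  [set g | isom_group Om g /\
           forall x y, phi Np (g *m x) (g *m y) = phi Np x y].

(** * Flags *)

Definition flag := {ffun 'I_n.+1 -> {vspace V}}.

Definition flags : set flag :=
  [set F | (forall k : 'I_n.+1, \dim (F k) = k) /\
           (forall k l : 'I_n.+1, (k <= l)%N -> (F k <= F l)%VS)].

Definition perp (Om : 'M[C]_n) (U : {vspace V}) : set V :=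
  [set x | forall y, y \in U -> omega Om x y = 0].

(** For [k : 'I_n.+1], [rev_ord k] is [n - k]. *)
Definition isotropic_flags (Om : 'M[C]_n) : set flag :=
  [set F | flags F /\
           forall k, perp Om (F k) = [set x | x \in F (rev_ord k)]].

Definition flag_of (v : n.-tuple V) : flag := [ffun k : 'I_n.+1 => <<take k v>>%VS].

Definition act_flag (g : 'M[C]_n) (F : flag) : flag :=
  [ffun k => (linfun (mulmx g : V -> V) @: F k)%VS].

Definition orbit_flag (H : set 'M[C]_n) (F : flag) : set flag :=
  [set act_flag g F | g in H].

Definition orbits (H : set 'M[C]_n) (X : set flag) : set (set flag) :=
  [set orbit_flag H F | F in X].

(** * Conjugate and dual bases *)

Definition is_basis (v : n.-tuple V) : Prop := basis_of fullv v.

Definition conjugate_basis (Np : {set 'I_n}) (we : signed_perm n)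
    (v : n.-tuple V) : Prop :=
  forall k, delta Np (tnth v k) =
    if we.1 k == k then (we.2 k)%:~R *: tnth v k else tnth v (we.1 k).

Definition dual_basis (Np : {set 'I_n}) (we : signed_perm n)
    (v : n.-tuple V) : Prop :=
  forall k l, phi Np (tnth v k) (tnth v l) =
    if we.1 k == l then (if l == k then (we.2 k)%:~R else 1) else 0.

Definition omega_adapted (t : form_type) (Om : 'M[C]_n) (we : signed_perm n)
    (v : n.-tuple V) : Prop :=
  let w := we.1 in
  forall k l : 'I_n,
    [/\ l <> rev_ord k -> omega Om (tnth v k) (tnth v l) = 0,
        l = rev_ord k -> (k <= w k <= l)%N -> (k <= w l <= l)%N ->
          omega Om (tnth v k) (tnth v l) = 1,
        l = rev_ord k -> (l <= w k <= k)%N -> (l <= w l <= k)%N ->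
          omega Om (tnth v k) (tnth v l) = (epsilon t)%:~R,
        l = rev_ord k -> (w k < k < w l)%N -> (w k < l < w l)%N ->
          omega Om (tnth v k) (tnth v l) = (eta t)%:~R &
        l = rev_ord k -> (w l < k < w k)%N -> (w l < l < w k)%N ->
          omega Om (tnth v k) (tnth v l) = (eta t * epsilon t)%:~R].

Definition conj_flags (Np : {set 'I_n}) (we : signed_perm n) : set flag :=
  [set flag_of v | v in [set v | is_basis v /\ conjugate_basis Np we v]].

Definition dual_flags (Np : {set 'I_n}) (we : signed_perm n) : set flag :=
  [set flag_of v | v in [set v | is_basis v /\ dual_basis Np we v]].

Definition conj_flags_iso (Om : 'M[C]_n) (Np : {set 'I_n})
    (we : signed_perm n) : set flag :=
  conj_flags Np we `&` isotropic_flags Om.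

Definition dual_flags_iso (Om : 'M[C]_n) (Np : {set 'I_n})
    (we : signed_perm n) : set flag :=
  dual_flags Np we `&` isotropic_flags Om.

(** * Matsuki duality *)

Definition matsuki_property (Om : 'M[C]_n) (Np : {set 'I_n})
    (Xi : set flag -> set flag) : Prop :=
  let X := isotropic_flags Om in
  let K := K_group Om Np in
  let G0 := G0_group Om Np in
  set_bij (orbits K X) (orbits G0 X) Xi /\
  forall O, orbits K X O -> orbits (K `&` G0) X (O `&` Xi O).

(** [Xi] is a total function on sets of flags, of which only the values on
    K-orbits matter. *)
Definition is_matsuki_duality (Om : 'M[C]_n) (Np : {set 'I_n})
    (Xi : set flag -> set flag) : Prop :=
  matsuki_property Om Np Xi /\
  forall Xi', matsuki_property Om Np Xi' ->
    forall O, orbits (K_group Om Np) (isotropic_flags Om) O -> Xi' O = Xi O.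

End Space.

(* Main.v *)
Require Import Defs.
From mathcomp Require Import all_boot all_order all_fingroup all_algebra.
From mathcomp Require Import complex zify ring.
From mathcomp Require Import boolp classical_sets functions reals.

Set Implicit Arguments.
Unset Strict Implicit.
Unset Printing Implicit Defensive.

Import Order.TTheory GRing.Theory Num.Theory.
Local Open Scope classical_set_scope.
Local Open Scope ring_scope.

(** The columns of an invertible matrix [B] form a basis, and two bases span the
    same flag when they differ by an upper triangular factor on the right. In this
    language a basis is [(w, eps)]-conjugate when [Phi B = B P] and dual when
    [B^* Phi B = P], where [P] is the signed permutation matrix of [(w, eps)]; the
    condition on [omega] prescribes the Gram matrix [B^T Om B] to be an explicit
    signed antidiagonal matrix [M].

    Without [omega], every flag has a conjugate basis and a dual basis
    ([involution_normal_form], [hermitian_normal_form]), by an elimination that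
    treats the basis vectors in order and only uses upper triangular moves.

    The form [omega] is then normalised without destroying these bases
    ([form_pair_normalise]). If [S] is the Gram matrix of [B], then [S = M Y] with
    [Y] self-adjoint for [M], so a square root [X] of [Y] that is a polynomial in
    [Y] gives [S = X^T M X], and [B X^-1] has Gram matrix [M]. Being a polynomial
    in [Y], the factor [X] commutes with whatever commutes with [Y], which
    preserves conjugate bases; it is upper triangular when the flag is isotropic.
    Preserving dual bases requires moreover that the square root be the principal
    one on the spectrum of [Y] ([sqrt_mx]). The same lemma, applied to an
    explicit unitary basis that is both conjugate and dual ([unitary_model]),
    shows that all the sets of flags in the statement are nonempty. They are
    single orbits because the conditions determine all the forms on the basis.

    The remaining input is positivity. If a flag has a basis conjugate for [we]
    and a basis dual for [we'], then the integers that count how [we] links the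
    first [i] positions with the first [j] ones, and the positive ones among the
    first [i], are at most those of [we'] ([conj_dual_dominated]), because the
    standard hermitian product is [phi(x, delta y)]. These integers determine the
    signed involution. Hence the signed involution of an orbit is unique; since
    duality with respect to [omega] fixes an isotropic flag, it is symmetric under
    reversal ([conj_symmetric], [dual_symmetric]). And a bijection between the two
    sets of orbits whose graph only contains intersecting pairs can never decrease
    these integers, hence is the identity on labels ([matsuki_unique]).

    Finally, if a flag has conjugate and dual bases for the same signed
    involution, then its Gram-Schmidt basis is permuted by [delta] up to scalars,
    which produces a common conjugate and dual basis ([conj_dual_basis]). This
    identifies the intersection of two dual orbits with a single orbit of the
    common subgroup. *)

(** * Upper triangular matrices and conjugate transposes *)

Definition upper {R : nzRingType} {n} (T : 'M[R]_n) : Prop :=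
  forall i j : 'I_n, (j < i)%N -> T i j = 0.

Definition adj {C : numClosedFieldType} {m n} (A : 'M[C]_(m, n)) : 'M[C]_(n, m) :=
  (map_mx Num.conj A)^T.

Lemma upper1 (R : nzRingType) n : upper (1%:M : 'M[R]_n).
Proof. by move=> i j lt_ji; rewrite mxE -val_eqE gtn_eqF. Qed.

Lemma upperM (R : nzRingType) n (A B : 'M[R]_n) : upper A -> upper B -> upper (A *m B).
Proof.
move=> uA uB i j lt_ji; rewrite mxE big1 // => k _.
have [lt_ki|le_ik] := ltnP k i; first by rewrite uA ?mul0r.
by rewrite uB ?mulr0 // (leq_trans lt_ji).
Qed.

Lemma upper_diag_neq0 (F : fieldType) n (T : 'M[F]_n) :
  upper T -> T \in unitmx -> forall i, T i i != 0.
Proof.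
move=> uT; rewrite unitmxE -det_tr det_trig; last first.
  by apply/is_trig_mxP => i j lt_ij; rewrite mxE uT.
move=> + i; apply: contraTneq => Tii0; rewrite (bigD1 i) //= mxE Tii0 mul0r.
by rewrite unitr0.
Qed.

Lemma unit_upper (F : fieldType) n (T : 'M[F]_n) :
  upper T -> (forall i, T i i != 0) -> T \in unitmx.
Proof.
move=> uT nzT; rewrite unitmxE -det_tr det_trig; last first.
  by apply/is_trig_mxP => i j lt_ij; rewrite mxE uT.
by rewrite unitfE; apply/prodf_neq0 => i _; rewrite mxE.
Qed.

Lemma upper_inv (F : fieldType) n (T : 'M[F]_n) :
  upper T -> T \in unitmx -> upper (invmx T).
Proof.
move=> uT nT; have nzT := upper_diag_neq0 uT nT.
suff H d (i j : 'I_n) : (n - i <= d)%N -> (j < i)%N -> invmx T i j = 0.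
  by move=> i j; apply: (H (n - i)%N).
elim: d i j => [|d IHd] i j le_d lt_ji; first by have := ltn_ord i; lia.
have /matrixP/(_ i j) := mulmxV nT; rewrite !mxE (bigD1 i) //= big1 => [|k neq_ki].
  rewrite -[i == j]val_eqE /= gtn_eqF // mulr0n addr0 => /eqP.
  by rewrite mulf_eq0 (negbTE (nzT i)) => /eqP.
have [lt_ki|lt_ik|eq_ki] := ltngtP k i; first by rewrite uT ?mul0r.
  by rewrite IHd ?mulr0 //; [have := ltn_ord k; lia | lia].
by case/eqP: neq_ki; apply: val_inj.
Qed.

Section Adjoint.
Variable C : numClosedFieldType.

Lemma adjM m n p (A : 'M[C]_(m, n)) (B : 'M[C]_(n, p)) :
  adj (A *m B) = adj B *m adj A.
Proof. by rewrite /adj map_mxM trmx_mul. Qed.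

Lemma adjK m n (A : 'M[C]_(m, n)) : adj (adj A) = A.
Proof. by apply/matrixP => i j; rewrite !mxE conjCK. Qed.

Lemma adjE m n (A : 'M[C]_(m, n)) i j : adj A i j = (A j i)^*.
Proof. by rewrite !mxE. Qed.

Lemma adj_inv n (A : 'M[C]_n) : adj (invmx A) = invmx (adj A).
Proof. by rewrite /adj map_invmx trmx_inv. Qed.

Lemma adj_unit n (A : 'M[C]_n) : (adj A \in unitmx) = (A \in unitmx).
Proof. by rewrite /adj unitmx_tr map_unitmx. Qed.

Lemma sqnorm_gt0 n (x : 'cV[C]_n) : x != 0 -> 0 < (adj x *m x) 0 0.
Proof.
move=> nzx; rewrite mxE.
have [i nzxi] : exists i, x i 0 != 0.
  apply/existsP; apply: contraNT nzx; rewrite negb_exists => /forallP xi0.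
  by apply/eqP/colP => i; rewrite mxE; apply/eqP; have := xi0 i; rewrite negbK.
rewrite (bigD1 i) //= ltr_pwDl //; last first.
  by apply: sumr_ge0 => k _; rewrite !mxE mulrC mul_conjC_ge0.
by rewrite !mxE mulrC mul_conjC_gt0.
Qed.

End Adjoint.

(** * Square roots of invertible matrices *)

Section SquareRoot.
Variable C : numClosedFieldType.

(** The principal square root respects rays from the origin, and [z] and
    [1 / conj z] lie on the same ray. *)
Lemma sqrtC_inv_conj (z : C) :
  z != 0 -> sqrtC z * (sqrtC (z^-1)^*)^* = 1.
Proof.
move=> nz; have nz' : `|z| != 0 by rewrite normr_eq0.
have -> : (z^-1)^* = z * (`|z| ^- 2).
  by rewrite normCK fmorphV invfM mulrA mulfV // mul1r.
have -> : sqrtC (z * `|z| ^- 2) = sqrtC z / `|z|.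
  by rewrite rootCMr ?invr_ge0 ?exprn_ge0 // -exprVn sqrCK ?invr_ge0.
rewrite rmorphM /= [`|z|^-1^*]conj_Creal ?realV ?normr_real //.
by rewrite mulrA -normCK -normrX sqrtCK mulfV.
Qed.

(** Newton's iteration, one root at a time: a new root is handled by
    interpolation, a repeated one by correcting the next Taylor coefficient,
    which is possible because the root is not [0]. *)
Lemma poly_sqrt (rs : seq C) : 0 \notin rs ->
  exists q : {poly C}, {in rs, forall z, q.[z] = sqrtC z} /\
    \prod_(z <- rs) ('X - z%:P) %| q ^+ 2 - 'X.
Proof.
elim: rs => [|z rs IHrs]; first by exists 0; split=> //; rewrite big_nil dvd1p.
rewrite inE negb_or eq_sym => /andP[nz_z /IHrs[q [qE /dvdpP[m mE]]]].
rewrite big_cons; set pi := \prod_(_ <- rs) _ in mE *.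
have piE y : root pi y = (y \in rs) by rewrite root_prod_XsubC.
have sqrE a : (q + a%:P * pi) ^+ 2 - 'X
    = (m + (a%:P * q) *+ 2 + a%:P ^+ 2 * pi) * pi.
  have -> : (q + a%:P * pi) ^+ 2 - 'X
      = (q ^+ 2 - 'X) + ((a%:P * q) *+ 2 + a%:P ^+ 2 * pi) * pi by ring.
  by rewrite mE; ring.
have [rs_z|rsNz] := boolP (z \in rs).
  exists (q + (- m.[z] / (2 * sqrtC z))%:P * pi); split=> [y|].
    have pi0 u : u \in rs -> pi.[u] = 0 by rewrite -piE => /rootP.
    rewrite inE => /predU1P[->|rs_y]; rewrite hornerD hornerM hornerC pi0 //;
      by rewrite mulr0 addr0 qE.
  set a := - _ / _.
  rewrite sqrE dvdp_mul // dvdp_XsubCl; apply/rootP.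
  have /rootP pi0 : root pi z by rewrite piE.
  rewrite !(hornerD, hornerMn, hornerM, hornerC, pi0) mulr0 addr0 qE // /a.
  by field; rewrite sqrtC_eq0 nz_z.
have nz_pi : pi.[z] != 0 by rewrite -[_ == 0]/(root pi z) piE.
exists (q + ((sqrtC z - q.[z]) / pi.[z])%:P * pi); split=> [y|].
  rewrite inE => /predU1P[->|rs_y]; rewrite hornerD hornerM hornerC.
    by rewrite divfK // addrC subrK.
  by have /rootP-> : root pi y; rewrite ?piE // mulr0 addr0 qE.
set a := _ / _; set q' := q + _.
rewrite Gauss_dvdp; last by rewrite coprimep_sym coprimep_XsubC piE.
rewrite dvdp_XsubCl; apply/andP; split.
  apply/rootP; rewrite !hornerE /a divfK //.
  by rewrite addrCA subrr addr0 sqrtCK subrr.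
by rewrite sqrE dvdp_mull.
Qed.

Lemma horner_mx_intertwine n (Y Z N : 'M[C]_n.+1) (p : {poly C}) :
  N *m Y = Z *m N -> N *m horner_mx Y p = horner_mx Z p *m N.
Proof.
move=> NY; elim/poly_ind: p => [|p c IHp]; first by rewrite !rmorph0 mulmx0 mul0mx.
rewrite !(rmorphD, rmorphM) /= !horner_mx_X !horner_mx_C -!mulmxE.
rewrite mulmxDr mulmxDl mulmxA IHp -!mulmxA NY; congr (_ + _).
by rewrite scalar_mxC.
Qed.

Lemma horner_mx_comp n (Y : 'M[C]_n.+1) (p s : {poly C}) :
  horner_mx Y (p \Po s) = horner_mx (horner_mx Y s) p.
Proof.
elim/poly_ind: p => [|p c IHp]; first by rewrite comp_poly0 !rmorph0.
rewrite comp_polyD comp_polyM comp_polyX comp_polyC !(rmorphD, rmorphM) /=.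
by rewrite IHp horner_mx_X !horner_mx_C.
Qed.

Lemma horner_mx_upper n (Y : 'M[C]_n.+1) (p : {poly C}) :
  upper Y -> upper (horner_mx Y p).
Proof.
move=> uY; elim/poly_ind: p => [|p c IHp]; first by rewrite rmorph0 => i j _; rewrite mxE.
rewrite !(rmorphD, rmorphM) /= !horner_mx_X !horner_mx_C -!mulmxE => i j lt_ji.
by rewrite mxE (upperM IHp uY) // add0r mxE -val_eqE gtn_eqF.
Qed.

Lemma horner_mx_tr n (Y : 'M[C]_n.+1) (p : {poly C}) :
  (horner_mx Y p)^T = horner_mx Y^T p.
Proof.
elim/poly_ind: p => [|p c IHp]; first by rewrite !rmorph0 trmx0.
rewrite !(rmorphD, rmorphM) /= !horner_mx_X !horner_mx_C -!mulmxE.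
rewrite linearD /= trmx_mul IHp tr_scalar_mx; congr (_ + _).
exact: (comm_mx_horner p (erefl _ : comm_mx Y^T Y^T)).
Qed.

(** By Cayley-Hamilton, a Bezout relation between [h] and the characteristic
    polynomial evaluates to an inverse of [h(Y)]. *)
Lemma horner_mx_unit n (Y : 'M[C]_n.+1) (h : {poly C}) :
  (forall z, root (char_poly Y) z -> h.[z] != 0) -> horner_mx Y h \in unitmx.
Proof.
move=> /Pdiv.ClosedField.root_coprimep/Bezout_eq1_coprimepP[[u v] /= uvE].
have := congr1 (horner_mx Y) uvE.
rewrite rmorphD !rmorphM rmorph1 /= Cayley_Hamilton mulr0 add0r.
by rewrite -mulmxE => /mulmx1_unit[].
Qed.

Lemma root_char_neq0 n (Y : 'M[C]_n) z :
  Y \in unitmx -> root (char_poly Y) z -> z != 0.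
Proof.
move=> nY; rewrite -eigenvalue_root_char => /eigenvalueP[u uY nzu].
apply: contraNneq nzu => z0; move: uY; rewrite z0 scale0r => /(congr1 (mulmx^~ (invmx Y))).
by rewrite mulmxK // mul0mx => ->.
Qed.

Lemma poly_inv_mx n (Y : 'M[C]_n.+1) : Y \in unitmx ->
  exists s : {poly C}, horner_mx Y s = invmx Y /\
    forall z, root (char_poly Y) z -> s.[z] = z^-1.
Proof.
move=> nY; have cop : coprimep (char_poly Y) 'X.
  apply: Pdiv.ClosedField.root_coprimep => z /(root_char_neq0 nY).
  by rewrite hornerX.
have /Bezout_eq1_coprimepP[[u s] /= usE] := cop.
exists s; split=> [|z rz].
  have := congr1 (horner_mx Y) usE.
  rewrite rmorphD !rmorphM rmorph1 /= Cayley_Hamilton mulr0 add0r horner_mx_X.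
  rewrite -mulmxE -[1]/(1%:M) => sY.
  by rewrite -[RHS]mul1mx -sY mulmxK.
have := congr1 (horner^~ z) usE; rewrite !hornerE (rootP rz) mulr0 add0r => sz.
by rewrite -[RHS]mul1r -sz mulfK // (root_char_neq0 nY rz).
Qed.

(** Every property holds because [X = q(Y)] for a polynomial [q]. In the relation
    with [N], the matrix [N conj(X) N^-1] is the polynomial [q'] of [Y^-1], with
    [q'] conjugate to [q], so its product [Z] with [X] squares to [1]; the
    eigenvalues of [Z] are [sqrt z * conj (sqrt (1 / conj z)) = 1], which
    excludes [-1], so [Z = 1]. This is where the branch of the root matters. *)
Theorem sqrt_mx n (Y : 'M[C]_n) : Y \in unitmx ->
  exists X : 'M[C]_n, [/\ X *m X = Y,
    forall M, M *m Y = Y^T *m M -> M *m X = X^T *m M,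
    forall P, P *m Y = Y *m P -> P *m X = X *m P &
    (forall N, N \in unitmx -> Y *m N *m map_mx Num.conj Y = N ->
       X *m N *m map_mx Num.conj X = N) /\
    (upper Y -> upper X)].
Proof.
case: n Y => [|n] Y nY.
  have E (A B : 'M[C]_0) : A = B by rewrite [A]flatmx0 [B]flatmx0.
  by exists 1%:M; split=> [|M _|P _|]; try (exact: E); split=> [N _ _|_ []//]; exact: E.
have [rs rsE] := closed_field_poly_normal (char_poly Y).
move: rsE; rewrite (monicP (char_poly_monic Y)) scale1r => rsE.
have rootE z : root (char_poly Y) z = (z \in rs) by rewrite rsE root_prod_XsubC.
have rsN0 : 0 \notin rs.
  by rewrite -rootE; apply/negP => /(root_char_neq0 nY); rewrite eqxx.
have [q [qE]] := poly_sqrt rsN0; rewrite -rsE => /dvdpP[m mE].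
have X2 : horner_mx Y q *m horner_mx Y q = Y.
  have := congr1 (horner_mx Y) mE; rewrite rmorphM /= Cayley_Hamilton mulr0.
  by rewrite rmorphB rmorphXn /= horner_mx_X => /subr0_eq; rewrite expr2.
exists (horner_mx Y q); split=> // [M|P|].
- by rewrite horner_mx_tr; apply: horner_mx_intertwine.
- exact: horner_mx_intertwine.
split=> [N nN YNY|]; last exact: horner_mx_upper.
have [s [sY sE]] := poly_inv_mx nY.
pose q' := map_poly Num.conj q.
have YN : N *m map_mx Num.conj Y = invmx Y *m N.
  by rewrite -{2}YNY -!mulmxA mulKmx.
have q'N : N *m map_mx Num.conj (horner_mx Y q) = horner_mx Y (q' \Po s) *m N.
  rewrite map_horner_mx (horner_mx_intertwine _ YN) -sY.
  by rewrite horner_mx_comp.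
pose Z := horner_mx Y (q * (q' \Po s)).
have ZE : horner_mx Y q *m horner_mx Y (q' \Po s) = Z by rewrite mulmxE -rmorphM.
rewrite -mulmxA q'N mulmxA ZE.
suff -> : Z = 1%:M by rewrite mul1mx.
have Z2 : Z *m Z = 1%:M.
  have WW : horner_mx Y (q' \Po s) *m horner_mx Y (q' \Po s) = invmx Y.
    apply: (can_inj (mulmxK nN)); rewrite -mulmxA -q'N mulmxA -q'N -mulmxA -map_mxM.
    by rewrite X2 YN.
  have WX := comm_horner_mx2 Y (q' \Po s) q.
  rewrite -ZE -mulmxA (mulmxA _ (horner_mx Y q)) -[_ *m horner_mx Y q]/(_ * _) WX.
  by rewrite -[_ * _]/(_ *m _) -mulmxA WW mulmxA X2 mulmxV.
have nZ1 : Z + 1%:M \in unitmx.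
  rewrite -[1%:M](rmorph1 (horner_mx Y)) -rmorphD; apply: horner_mx_unit => z rz.
  have rz' : root (char_poly Y) (z^-1)^*.
    move: rz; rewrite -!eigenvalue_root_char => /eigenvalueP[u uY nzu].
    have nz : z != 0.
      by apply: (root_char_neq0 nY); rewrite -eigenvalue_root_char; apply/eigenvalueP; exists u.
    have uN : (u *m N) *m map_mx Num.conj Y = z^-1 *: (u *m N).
      rewrite -{2}YNY !mulmxA uY -!scalemxAl scalerA mulVf // scale1r.
      by rewrite -!mulmxA.
    have conjK (A : 'M[C]_n.+1) : map_mx Num.conj (map_mx Num.conj A) = A.
      by apply/matrixP => a b; rewrite !mxE conjCK.
    apply/eigenvalueP; exists (map_mx Num.conj (u *m N)).
      by have := congr1 (map_mx Num.conj) uN; rewrite map_mxZ (map_mxM _ (u *m N)) conjK.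
    rewrite map_mx_eq0; apply: contraNneq nzu => /(congr1 (mulmx^~ (invmx N))).
    by rewrite mulmxK // mul0mx => ->.
  rewrite hornerD hornerC hornerM horner_comp sE // qE -?rootE //.
  have -> : q'.[z^-1] = (q.[(z^-1)^*])^* by rewrite -horner_map /= conjCK.
  rewrite qE -?rootE // sqrtC_inv_conj; last exact: root_char_neq0 nY rz.
  by rewrite -(natrD _ 1 1) pnatr_eq0.
apply/subr0_eq; apply: (can_inj (mulmxK nZ1)).
by rewrite mul0mx mulmxDr !mulmxBl Z2 !mulmx1 !mul1mx addrC subrKA subrr.
Qed.

End SquareRoot.

(** * The matrices of the normal forms *)

Section NormalForms.
Variables (C : numClosedFieldType) (n : nat).
Implicit Types (we : signed_perm n) (k l : 'I_n).

Definition isign we k : int := if we.1 k == k then we.2 k else 1.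

Definition sign_mx we : 'M[C]_n :=
  \matrix_(k, l) if we.1 k == l then (isign we k)%:~R else 0.

Lemma mul_sign_mx we m (A : 'M[C]_(n, m)) i j :
  (sign_mx we *m A) i j = (isign we i)%:~R * A (we.1 i) j.
Proof.
rewrite mxE (bigD1 (we.1 i)) //= mxE eqxx big1 ?addr0 // => k ne.
by rewrite mxE eq_sym (negbTE ne) mul0r.
Qed.

Section Involution.
Variables (we : signed_perm n) (wI : is_signed_involution we).

Lemma invol_inv k : we.1 (we.1 k) = k. Proof. by case: wI. Qed.

Lemma invol_eq k l : (we.1 k == l) = (we.1 l == k).
Proof. by rewrite -[l in LHS]invol_inv (inj_eq perm_inj) eq_sym. Qed.

Lemma isign_invol k : isign we (we.1 k) = isign we k.
Proof. by rewrite /isign invol_inv eq_sym; case: eqP => // ->. Qed.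

Lemma isignP k : isign we k = 1 \/ isign we k = -1.
Proof. by rewrite /isign; case: wI => _ /(_ k); case: eqP; auto. Qed.

Lemma isign_sqr k : isign we k * isign we k = 1.
Proof. by case: (isignP k) => ->. Qed.

Lemma sign_mx_tr : (sign_mx we)^T = sign_mx we.
Proof.
apply/matrixP => k l; rewrite !mxE invol_eq; case: eqP => // <-.
by rewrite isign_invol.
Qed.

Lemma sign_mx_sqr : sign_mx we *m sign_mx we = 1%:M.
Proof.
apply/matrixP => k l; rewrite mul_sign_mx !mxE invol_inv isign_invol.
by case: eqP => _; rewrite ?mulr0 // -intrM isign_sqr.
Qed.

Lemma mul_mx_sign (A : 'M[C]_n) i j :
  (A *m sign_mx we) i j = A i (we.1 j) * (isign we j)%:~R.
Proof.
have -> : (A *m sign_mx we) i j = (A *m sign_mx we)^T j i by rewrite [RHS]mxE.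
by rewrite trmx_mul sign_mx_tr mul_sign_mx mxE mulrC.
Qed.

End Involution.

Lemma sign_mx_conj we : map_mx Num.conj (sign_mx we) = sign_mx we.
Proof. by apply/matrixP => k l; rewrite !mxE; case: eqP; rewrite ?rmorph_int ?rmorph0. Qed.

Lemma sign_mx_unit we : is_signed_involution we -> sign_mx we \in unitmx.
Proof. by move=> wI; have /mulmx1_unit[] := sign_mx_sqr wI. Qed.

(** The value prescribed to [omega] on the pair [k], [rev_ord k]. When [w]
    commutes with the reversal, the position of [w k] decides that of its mirror
    image, so it suffices to test [w k]. *)
Definition osign (t : form_type) we k : int :=
  let a := we.1 k in let l := rev_ord k in
  if (k <= a <= l)%N then 1 else if (l <= a <= k)%N then epsilon t
  else if (a < k)%N then eta t else eta t * epsilon t.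

Definition omega_mx (t : form_type) we : 'M[C]_n :=
  \matrix_(k, l) if l == rev_ord k then (osign t we k)%:~R else 0.

Definition is_symmetric (t : form_type) we : Prop :=
  [/\ is_signed_involution we, forall k, we.1 (rev_ord k) = rev_ord (we.1 k),
    forall k, we.1 k = k -> we.2 (rev_ord k) = eta t * we.2 k &
    eta t <> epsilon t -> forall k, we.1 k <> rev_ord k].

Lemma mul_omega_mx t we m (A : 'M[C]_(n, m)) i j :
  (omega_mx t we *m A) i j = (osign t we i)%:~R * A (rev_ord i) j.
Proof.
rewrite mxE (bigD1 (rev_ord i)) //= mxE eqxx big1 ?addr0 // => k ne.
by rewrite mxE (negbTE ne) mul0r.
Qed.

Section Symmetric.
Variables (t : form_type) (we : signed_perm n) (wS : is_symmetric t we).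
Hypothesis mid : forall k, rev_ord k = k -> epsilon t = 1.

Lemma rev_eq k l : (l == rev_ord k) = (l + k.+1 == n)%N.
Proof. by rewrite -val_eqE /=; have := ltn_ord k; have := ltn_ord l; lia. Qed.

Lemma osign_rev k : osign t we (rev_ord k) = epsilon t * osign t we k.
Proof.
have [_ wr _ _] := wS; rewrite /osign rev_ordK wr.
have := ltn_ord k; have := ltn_ord (we.1 k) => ltw ltk.
have [/mid e1|nek] := eqVneq (rev_ord k) k.
  by rewrite e1 !mulr1 !mul1r /=; repeat case: ifP; lia.
have {}nek : (n - k.+1 != k)%N by rewrite -val_eqE in nek.
rewrite /=; repeat case: ifP; try lia; by case: (t).
Qed.

Lemma osign_sqr k : osign t we k * osign t we k = 1.
Proof. by rewrite /osign; repeat case: ifP => _; case: (t). Qed.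

(** If [w k] lies inside the interval between [k] and its mirror image, then [k]
    lies outside the one of [w k]: this exchanges the two kinds of clauses and
    costs a factor [eta]. If [w k] is the mirror image of [k], the factor is
    [epsilon], and symmetry rules this case out unless [epsilon = eta]. *)
Lemma osign_invol k :
  isign we k * osign t we (we.1 k) * isign we (rev_ord (we.1 k)) = eta t * osign t we k.
Proof.
have [wI wr weta wN] := wS.
have -> : isign we (rev_ord (we.1 k)) = isign we (rev_ord k).
  by rewrite -wr isign_invol.
have [wk|wNk] := eqVneq (we.1 k) k.
  have wrk : we.1 (rev_ord k) = rev_ord k by rewrite wr wk.
  rewrite /isign wrk wk !eqxx weta // mulrC -mulrA; congr (_ * _).
  have := isign_sqr wI k; rewrite /isign wk eqxx mulrA => ->.
  by rewrite mul1r.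
have wNrk : we.1 (rev_ord k) == rev_ord k = false.
  by rewrite wr (inj_eq rev_ord_inj) (negbTE wNk).
rewrite /isign wNrk (negbTE wNk) mul1r mulr1.
have [wkr|nwkr] := eqVneq (we.1 k) (rev_ord k).
  rewrite wkr osign_rev.
  have -> // : eta t = epsilon t.
  by apply/eqP; apply/negPn/negP => /eqP /wN /(_ k).
have := ltn_ord k; have := ltn_ord (we.1 k).
move: wNk nwkr; rewrite -!val_eqE /osign invol_inv //=.
move: (nat_of_ord (we.1 k)) => a; move: (nat_of_ord k) => b.
repeat case: ifP; try lia; by case: (t).
Qed.

Lemma omega_mx_tr : (omega_mx t we)^T = (epsilon t)%:~R *: omega_mx t we.
Proof.
apply/matrixP => k l; rewrite !mxE.
have -> : (k == rev_ord l) = (l == rev_ord k) by rewrite !rev_eq; lia.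
by case: eqP => [->|_]; rewrite ?mulr0 // osign_rev intrM.
Qed.

Lemma omega_mx_sqr : omega_mx t we *m omega_mx t we = ((epsilon t)%:~R)%:M.
Proof.
apply/matrixP => k l; rewrite mul_omega_mx !mxE rev_ordK eq_sym.
by case: eqP => _; rewrite ?mulr0 // osign_rev -intrM mulrCA osign_sqr mulr1 mulr1n.
Qed.

Lemma omega_mx_sign :
  sign_mx we *m omega_mx t we *m sign_mx we = (eta t)%:~R *: omega_mx t we.
Proof.
have [wI wr _ _] := wS.
apply/matrixP => k l; rewrite mul_mx_sign // mul_sign_mx !mxE.
have -> : (we.1 l == rev_ord (we.1 k)) = (l == rev_ord k).
  by rewrite -wr (inj_eq perm_inj).
case: eqP => [->|_]; rewrite ?mulr0 ?mul0r //.
by rewrite -!intrM -osign_invol -wr isign_invol.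
Qed.

End Symmetric.

Lemma omega_mx_conj t we : map_mx Num.conj (omega_mx t we) = omega_mx t we.
Proof. by apply/matrixP => k l; rewrite !mxE; case: eqP; rewrite ?rmorph_int ?rmorph0. Qed.

End NormalForms.

(** * Normalising the bilinear form *)

Section Normalise.
Variables (C : numClosedFieldType) (n : nat) (e h : C).
Hypotheses (e2 : e * e = 1) (h2 : h * h = 1).

(** What the pairs [(Phi, Om)] and [(P, M)] have in common: a real orthogonal
    [e]-symmetric form, and a real involution that multiplies it by [h]. *)
Record form_pair (P M : 'M[C]_n) : Prop := FormPair {
  fp_tr : M^T = e *: M;
  fp_sqr : M *m M = e%:M;
  fp_conj : map_mx Num.conj M = M;
  fp_comm : P *m M *m P = h *: M;
  fp_Ptr : P^T = P;
  fp_Psqr : P *m P = 1%:M;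
  fp_Pconj : map_mx Num.conj P = P }.

Lemma fp_swap P M : form_pair P M -> P *m M = h *: (M *m P).
Proof.
case=> _ _ _ PMP _ P2 _.
by rewrite -[LHS]mulmx1 -P2 mulmxA PMP scalemxAl.
Qed.

Lemma fp_swap' P M : form_pair P M -> M *m P = h *: (P *m M).
Proof. by move/fp_swap => ->; rewrite scalerA h2 scale1r. Qed.

Lemma conj_gram (Ph Om P B : 'M[C]_n) (S := B^T *m Om *m B) :
  form_pair Ph Om -> P^T = P -> Ph *m B = B *m P -> P *m S *m P = h *: S.
Proof.
move=> fO PT cB.
have -> : P *m S *m P = (B *m P)^T *m Om *m (B *m P) by rewrite trmx_mul PT !mulmxA.
have -> : (B *m P)^T *m Om *m (B *m P) = B^T *m (Ph *m Om *m Ph) *m B.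
  by rewrite -cB trmx_mul (fp_Ptr fO) !mulmxA.
by rewrite (fp_comm fO) -scalemxAr -scalemxAl.
Qed.

(** Inverting [adj B Phi B = P] gives [B P adj B = Phi]; the relation is then the
    compatibility of [Om] and [Phi] read in the basis [B]. *)
Lemma dual_gram (Ph Om P B : 'M[C]_n) (S := B^T *m Om *m B) :
    form_pair Ph Om -> P *m P = 1%:M -> map_mx Num.conj P = P -> adj B *m Ph *m B = P ->
  S *m P *m map_mx Num.conj S = (e * h) *: P.
Proof.
move=> fO P2 Pconj dB.
have BPB : B *m P *m adj B = Ph.
  have BPB1 : B *m (P *m adj B *m Ph) = 1%:M.
    by apply: mulmx1C; rewrite -!mulmxA (mulmxA (adj B)) dB P2.
  by rewrite -[LHS]mulmx1 -(fp_Psqr fO) mulmxA -[RHS]mul1mx -BPB1 !mulmxA.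
have conjB : map_mx Num.conj (B^T) = adj B by rewrite /adj map_trmx.
have -> : map_mx Num.conj S = adj B *m Om *m map_mx Num.conj B.
  by rewrite !map_mxM (fp_conj fO) conjB.
have -> : S *m P *m (adj B *m Om *m map_mx Num.conj B) =
    B^T *m (Om *m (B *m P *m adj B) *m Om) *m map_mx Num.conj B.
  by rewrite /S !mulmxA.
rewrite BPB.
have -> : Om *m Ph *m Om = (e * h) *: Ph.
  by rewrite (fp_swap' fO) -scalemxAl -mulmxA (fp_sqr fO) mul_mx_scalar scalerA mulrC.
rewrite -scalemxAr -scalemxAl; congr (_ *: _).
rewrite -[RHS]Pconj -dB !map_mxM (fp_Pconj fO).
have -> // : map_mx Num.conj (adj B) = B^T.
by apply/matrixP => i j; rewrite !mxE conjCK.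
Qed.

(** The matrix [Y = e M S] compares the two forms and satisfies
    [M Y = Y^T M = S]. With [X] its square root, [S = M X X = X^T M X], and
    the factor sought is [X^-1]. *)
Lemma form_pair_normalise (Ph Om P M B : 'M[C]_n) :
  form_pair Ph Om -> form_pair P M -> B \in unitmx ->
  exists T : 'M[C]_n, [/\ T \in unitmx,
    (B *m T)^T *m Om *m (B *m T) = M,
    Ph *m B = B *m P -> Ph *m (B *m T) = B *m T *m P,
    adj B *m Ph *m B = P -> adj (B *m T) *m Ph *m (B *m T) = P &
    upper (M *m (B^T *m Om *m B)) -> upper T].
Proof.
move=> fO fM nB.
have MM1 : (e *: M) *m M = 1%:M by rewrite -scalemxAl (fp_sqr fM) scale_scalar_mx e2.
have [nM' nM] := mulmx1_unit MM1.
have nO : Om \in unitmx.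
  have : (e *: Om) *m Om = 1%:M by rewrite -scalemxAl (fp_sqr fO) scale_scalar_mx e2.
  by case/mulmx1_unit.
set S := B^T *m Om *m B.
have nS : S \in unitmx by rewrite !unitmx_mul unitmx_tr nB nO.
pose Y := e *: (M *m S).
have nY : Y \in unitmx by rewrite /Y scalemxAl unitmx_mul nM' nS.
have MY : M *m Y = S.
  by rewrite /Y -scalemxAr mulmxA scalemxAl scalemxAl MM1 mul1mx.
have YM : Y^T *m M = S.
  have ST : S^T = e *: S by rewrite /S !trmx_mul trmxK (fp_tr fO) mulmxA -scalemxAr -scalemxAl.
  rewrite /Y linearZ /= trmx_mul ST (fp_tr fM) -!scalemxAl scalerA e2 scale1r.
  by rewrite -mulmxA MM1 mulmx1.
have [X [X2 XM XP [XN Xu]]] := sqrt_mx nY.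
have {}XM : M *m X = X^T *m M by apply: XM; rewrite MY YM.
have nX : X \in unitmx by move: nY; rewrite -X2 unitmx_mul => /andP[].
have SE : S = X^T *m M *m X by rewrite -MY -X2 mulmxA XM.
exists (invmx X); split=> [|||dB|].
- by rewrite unitmx_inv.
- have -> : (B *m invmx X)^T *m Om *m (B *m invmx X) = (invmx X)^T *m S *m invmx X.
    by rewrite trmx_mul /S !mulmxA.
  by rewrite SE trmx_inv !mulmxA mulVmx ?unitmx_tr // mul1mx mulmxK.
- move=> cB; have PSP : P *m S *m P = h *: S by exact: conj_gram (fp_Ptr fM) cB.
  have PY : P *m Y = Y *m P.
    rewrite /Y -scalemxAl -scalemxAr; congr (_ *: _).
    rewrite mulmxA (fp_swap fM) -scalemxAl -[in LHS](mulmx1 S) -(fp_Psqr fM).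
    have -> : M *m P *m (S *m (P *m P)) = M *m (P *m S *m P) *m P by rewrite !mulmxA.
    by rewrite PSP -scalemxAr -scalemxAl scalerA h2 scale1r.
  have {}XP := XP _ PY.
  have XPi : P *m invmx X = invmx X *m P.
    by apply: (can_inj (mulKmx nX)); rewrite mulKVmx // mulmxA -XP mulmxK.
  by rewrite mulmxA cB -!mulmxA XPi.
- have SPS : S *m P *m map_mx Num.conj S = (e * h) *: P.
    exact: dual_gram (fp_Psqr fM) (fp_Pconj fM) dB.
  have PMn : P *m M \in unitmx.
    by rewrite unitmx_mul nM andbT; have /mulmx1_unit[] := fp_Psqr fM.
  have YN : Y *m (P *m M) *m map_mx Num.conj Y = P *m M.
    have conj_e : e^* = e.
      by move: e2 => /eqP; rewrite -expr2 sqrf_eq1 => /orP[]/eqP->; rewrite ?rmorphN rmorph1.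
    rewrite /Y map_mxZ map_mxM (fp_conj fM) /= conj_e.
    rewrite -!scalemxAl -scalemxAr scalerA e2 scale1r.
    have -> : M *m S *m (P *m M) *m (M *m map_mx Num.conj S)
        = M *m (S *m P *m (M *m M) *m map_mx Num.conj S) by rewrite !mulmxA.
    rewrite (fp_sqr fM) mul_mx_scalar -scalemxAl SPS scalerA mulrA e2 mul1r.
    by rewrite -scalemxAr -(fp_swap fM).
  have {}XN := XN _ PMn YN.
  have XaM : M *m map_mx Num.conj X = adj X *m M.
    by have := congr1 (map_mx Num.conj) XM; rewrite !map_mxM (fp_conj fM) -map_trmx.
  have {XaM}XP : X *m P *m adj X = P.
    by apply: (can_inj (mulmxK nM)); rewrite -[RHS]XN -!mulmxA XaM.
  have nXa : adj X \in unitmx by rewrite adj_unit.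
  have -> : adj (B *m invmx X) *m Ph *m (B *m invmx X) = invmx (adj X) *m P *m invmx X.
    by rewrite -[in RHS]dB adjM adj_inv !mulmxA.
  have nP : P \in unitmx by have /mulmx1_unit[] := fp_Psqr fM.
  apply: (can_inj (mulmxK nP)); rewrite (fp_Psqr fM) -{2}XP !mulmxA mulmxKV //.
  by rewrite -[_ *m P *m P]mulmxA (fp_Psqr fM) mulmx1 mulVmx.
- by move=> uMS; apply: upper_inv => //; apply: Xu => i j lt_ji; rewrite mxE uMS ?mulr0.
Qed.

End Normalise.

(** * Adapted bases for an involution *)

Section Reduction.
Variables (C : numClosedFieldType) (n : nat).
Implicit Types (S : {set 'I_n}) (A T : 'M[C]_n).

(** In the elimination, [S] holds the indices that remain to be treated. *)
Definition decoupled S A : Prop := forall a b, (a \in S) != (b \in S) -> A a b = 0.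

Definition signed_row A k : Prop := exists l (s : int),
  (s = 1 \/ s = -1 /\ l = k) /\ forall m, A k m = if l == m then s%:~R else 0.

Lemma signed_rows_sign_mx A :
    (forall k, signed_row A k) -> (forall k l, A k l != 0 -> A l k != 0) ->
  exists we, is_signed_involution we /\ A = sign_mx C we.
Proof.
move=> /choice[f /choice[s fs]] symA.
have s0 k : (s k)%:~R != 0 :> C by case: (fs k) => -[->|[-> _]] _; rewrite intr_eq0.
have fk k : A k (f k) != 0 by case: (fs k) => _ ->; rewrite eqxx.
have ff k : f (f k) = k.
  have := symA _ _ (fk k); case: (fs (f k)) => _ ->; case: (f (f k) =P k) => // _.
  by rewrite eqxx.
pose w := perm (can_inj ff).
pose we : signed_perm n := (w, [ffun k => if f k == k then s k else 0]).
exists we; split.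
  split=> k; first by rewrite /= !permE ff.
  rewrite /= permE ffunE; case: eqP => // _.
  by case: (fs k) => -[->|[-> _]] _; auto.
apply/matrixP => k l; case: (fs k) => sk ->; rewrite mxE /isign /= permE ffunE.
case: eqP => // _; case: eqP => // ne; case: sk => [->//|[_ eq]]; by case: ne.
Qed.

Lemma minimal_elt S : S != finset.set0 ->
  exists2 k, k \in S & forall m, m \in S -> (k <= m)%N.
Proof.
case/set0Pn => x Sx; have [k Sk kP] := arg_minnP (fun i : 'I_n => i : nat) Sx.
by exists k.
Qed.

Definition id_outside S T : Prop :=
  forall a b, (a \notin S) || (b \notin S) -> T a b = (a == b)%:R.

Lemma delta_row_mx A k m : (delta_mx 0 k *m A : 'rV_n) 0 m = A k m.
Proof. by rewrite -rowE mxE. Qed.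

Lemma mx_delta_col A k m : (A *m delta_mx k 0 : 'cV_n) m 0 = A m k.
Proof. by rewrite -colE mxE. Qed.

Lemma conj_outside S A A' T : T \in unitmx -> id_outside S T -> decoupled S A ->
  A *m T = T *m A' ->
  decoupled S A' /\ forall a b, a \notin S -> A' a b = A a b.
Proof.
move=> nT idT dA AT.
have row_eq a b : a \notin S -> A' a b = A a b.
  move=> Sa; have /matrixP/(_ a b) := AT; rewrite !mxE.
  rewrite [RHS](bigD1 a) //= idT ?Sa // eqxx mul1r [X in _ + X]big1 ?addr0; last first.
    by move=> c ne; rewrite idT ?Sa // eq_sym (negbTE ne) mul0r.
  move=> <-; rewrite (bigD1 b) //= big1 => [|c ne].
    have [Sb|Sb] := boolP (b \in S); last by rewrite idT ?Sb ?orbT // eqxx mulr1 addr0.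
    by rewrite dA ?mul0r ?addr0 // Sb (negbTE Sa).
  have [Sc|Sc] := boolP (c \in S); first by rewrite dA ?mul0r // Sc (negbTE Sa).
  by rewrite idT ?Sc // (negbTE ne) mulr0.
split=> // a b; have [Sa|Sa] := boolP (a \in S); last first.
  by move=> ?; rewrite row_eq // dA // (negbTE Sa).
move=> /= Sb'; have Sb : b \notin S by move: Sb'; case: (b \in S).
have Teb : T *m delta_mx b 0 = delta_mx b 0 :> 'cV_n.
  by apply/colP => m; rewrite mx_delta_col idT ?Sb ?orbT // mxE andbT.
have TAeb : T *m (A *m delta_mx b 0) = A *m delta_mx b 0 :> 'cV_n.
  apply/colP => m; rewrite mxE (bigD1 m) //= big1 ?addr0 => [|c ne]; last first.
    rewrite mx_delta_col; have [Sc|Sc] := boolP (c \in S).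
      by rewrite dA ?mulr0 // Sc (negbTE Sb).
    by rewrite idT ?Sc ?orbT // eq_sym (negbTE ne) mul0r.
  rewrite mx_delta_col; have [Sm|Sm] := boolP (m \in S).
    by rewrite dA ?mulr0 // Sm (negbTE Sb).
  by rewrite idT ?Sm // eqxx mul1r.
have : A' *m delta_mx b 0 = A *m delta_mx b 0 :> 'cV_n.
  by apply: (can_inj (mulKmx nT)); rewrite TAeb mulmxA -AT -mulmxA Teb.
move=> /colP/(_ a); rewrite !mx_delta_col => ->; apply: dA.
by rewrite Sa (negbTE Sb).
Qed.

(** A functional [f] with [f e_k = 1] becomes the [k]-th coordinate after
    replacing each [e_m] by [e_m - f e_m *: e_k]. *)
Lemma coordinate_change S k (f : 'rV[C]_n) : k \in S ->
  (forall m, m \in S -> (k <= m)%N) -> f 0 k = 1 -> (forall m, m \notin S -> f 0 m = 0) ->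
  exists T, [/\ upper T, T \in unitmx, id_outside S T, f *m T = delta_mx 0 k &
    (forall j, j != k -> delta_mx 0 j *m T = delta_mx 0 j :> 'rV_n) /\
    (forall j : 'I_n, (j == k) || (f 0 j == 0) -> T *m delta_mx j 0 = delta_mx j 0 :> 'cV_n)].
Proof.
move=> Sk kmin fk f0; pose T : 'M[C]_n := 1%:M + delta_mx k 0 *m (delta_mx 0 k - f).
have TE i j : T i j = (i == j)%:R + (i == k)%:R * ((j == k)%:R - f 0 j).
  by rewrite !mxE big_ord1 !mxE eqxx !andbT.
have uT : upper T.
  move=> i j lt_ji; rewrite TE -val_eqE gtn_eqF // add0r.
  have [ik|] := eqVneq i k; last by rewrite mul0r.
  have [jk|nejk] := eqVneq j k; first by rewrite jk fk subrr mulr0.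
  rewrite f0 ?subr0 ?mulr0 //; apply/negP => /kmin; rewrite -ik leqNgt.
  by rewrite lt_ji.
exists T; split=> //.
- apply: unit_upper => // i; rewrite TE eqxx.
  by have [->|_] := eqVneq i k; rewrite ?fk ?subrr ?mulr0 ?mul0r addr0 oner_eq0.
- move=> a b; rewrite TE; have [->|_] := eqVneq a k; last by rewrite mul0r addr0.
  rewrite Sk /= => Sb; have -> : (b == k) = false by apply: contraNF Sb => /eqP->.
  by rewrite f0 // subrr mulr0 addr0.
- rewrite mulmxDr mulmx1 mulmxA.
  have -> : f *m delta_mx k 0 = 1%:M :> 'M_1.
    by apply/rowP => i; rewrite ord1 -colE !mxE fk.
  by rewrite mul1mx addrCA subrr addr0.
split=> j; [move=> ne|].
  by apply/rowP => m; rewrite delta_row_mx TE (negbTE ne) mul0r addr0 mxE eqxx eq_sym.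
move=> fj; apply/colP => m; rewrite mx_delta_col TE mxE andbT.
move: fj; have [->|_] := eqVneq j k; first by rewrite fk subrr mulr0 addr0.
by move=> /eqP->; rewrite subr0 mulr0 addr0.
Qed.

Lemma involution_unit A : A *m A = 1%:M -> A \in unitmx.
Proof. by case/mulmx1_unit. Qed.

Lemma conj_involution A A' T : T \in unitmx -> A *m A = 1%:M ->
  A *m T = T *m A' -> A' *m A' = 1%:M.
Proof.
move=> nT A2 AT; apply: (can_inj (mulKmx nT)).
by rewrite mulmxA -AT -mulmxA -AT mulmxA A2 mul1mx mulmx1.
Qed.

Lemma decoupledD2 S A k l : decoupled S A ->
    (forall m, m != l -> A k m = 0) -> (forall m, m != k -> A l m = 0) ->
    (forall m, m != l -> A m k = 0) -> (forall m, m != k -> A m l = 0) ->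
  decoupled (S :\ k :\ l)%SET A.
Proof.
move=> dA rk rl ck cl a b; rewrite !inE => ab.
have [ak|ak] := eqVneq a k.
  by rewrite ak rk //; apply: contraNneq ab => ->; rewrite ak !eqxx andbF.
have [al|al] := eqVneq a l.
  by rewrite al rl //; apply: contraNneq ab => ->; rewrite al !eqxx !andbF.
have [bk|bk] := eqVneq b k; first by rewrite bk ck.
have [bl|bl] := eqVneq b l; first by rewrite bl cl.
by apply: dA; move: ab; rewrite ak al bk bl.
Qed.

Lemma exists_conjugate A T : T \in unitmx -> exists A', A *m T = T *m A'.
Proof. by move=> nT; exists (invmx T *m A *m T); rewrite !mulmxA mulmxV // mul1mx. Qed.

(** Let [k] be the first remaining index. If [e_k] is an eigenvector, then the
    functional [(e_k^* + s e_k^* A) / 2] is an eigenvector of the transpose with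
    value [1] at [e_k], and its kernel is an invariant complement. Otherwise let
    [l] be the last index in the support of [A e_k]: replacing [e_l] by [A e_k]
    is upper triangular, and the invariant complement of the new plane is cut out
    by [e_l^*] and [e_l^* A]. *)
Lemma involution_step S A : S != finset.set0 -> A *m A = 1%:M -> decoupled S A ->
  exists k l T A', [/\ k \in S, upper T, T \in unitmx, A *m T = T *m A' &
    [/\ forall a b, a \notin S -> A' a b = A a b,
      signed_row A' k /\ signed_row A' l &
      decoupled (S :\ k :\ l)%SET A']].
Proof.
move=> S0 A2 dA; have [k Sk kmin] := minimal_elt S0.
have outk m : m \notin S -> A m k = 0 by move=> Sm; rewrite dA // Sk (negbTE Sm).
have outkr m : m \notin S -> A k m = 0 by move=> Sm; rewrite dA // Sk (negbTE Sm).
have [fix_k|] := boolP [forall m, (m != k) ==> (A m k == 0)].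
  have {}fix_k m : m != k -> A m k = 0.
    by move=> ne; move/forallP/(_ m): fix_k; rewrite ne => /eqP.
  pose s := A k k.
  have Aek : A *m delta_mx k 0 = s *: delta_mx k 0 :> 'cV_n.
    apply/colP => m; rewrite mx_delta_col !mxE andbT.
    by have [->|/fix_k->] := eqVneq m k; rewrite ?mulr1 ?mulr0.
  have s2 : s * s = 1.
    have /matrixP/(_ k k) := A2; rewrite !mxE (bigD1 k) //= big1 ?addr0 ?eqxx // => m ne.
    by rewrite fix_k // mulr0.
  pose f : 'rV[C]_n := 2^-1 *: (delta_mx 0 k + s *: (delta_mx 0 k *m A)).
  have fE m : f 0 m = 2^-1 * ((m == k)%:R + s * A k m) by rewrite 4!mxE delta_row_mx eqxx.
  have nz2 : 2 != 0 :> C by rewrite pnatr_eq0.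
  have fA : f *m A = s *: f.
    rewrite -scalemxAl scalerA mulrC -scalerA; congr (_ *: _).
    rewrite mulmxDl -scalemxAl -mulmxA A2 mulmx1 scalerDr scalerA s2 scale1r.
    by rewrite addrC.
  have [||T [uT nT idT fT [_ Tk]]] := coordinate_change Sk kmin (_ : f 0 k = 1).
  - by rewrite fE eqxx s2 mulVf.
  - move=> m Sm; rewrite fE outkr // mulr0 addr0.
    by rewrite (_ : m == k = false) ?mulr0 //; apply: contraNF Sm => /eqP->.
  have {}Tk := Tk k; rewrite eqxx in Tk; have {}Tk := Tk isT.
  have [A' AT] := exists_conjugate A nT.
  have [dA' rA'] := conj_outside nT idT dA AT.
  have A'k : A' *m delta_mx k 0 = s *: delta_mx k 0 :> 'cV_n.
    by apply: (can_inj (mulKmx nT)); rewrite mulmxA -AT -mulmxA Tk Aek -scalemxAr Tk.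
  have kA' : delta_mx 0 k *m A' = s *: delta_mx 0 k :> 'rV_n.
    by rewrite -fT -mulmxA -AT mulmxA fA -scalemxAl.
  have colk m : m != k -> A' m k = 0.
    by move=> ne; rewrite -mx_delta_col A'k !mxE (negbTE ne) mulr0.
  have rowk m : A' k m = if k == m then s else 0.
    by rewrite -delta_row_mx kA' !mxE eqxx /= eq_sym; case: eqP; rewrite ?mulr1 ?mulr0.
  have rowk0 m : m != k -> A' k m = 0 by rewrite rowk eq_sym => /negbTE->.
  have srk : signed_row A' k.
    have /eqP := s2; rewrite -expr2 sqrf_eq1 => /orP[]/eqP sE; exists k.
      by exists 1; split; [left | move=> m; rewrite rowk sE].
    by exists (-1); split; [right | move=> m; rewrite rowk sE].
  exists k, k, T, A'; split=> //; split=> //; exact: decoupledD2.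
rewrite negb_forall => /existsP[l0]; rewrite negb_imply => /andP[l0k Al0k].
(* The last index makes [A e_k] a legitimate replacement of [e_l]. *)
have [l Alk lmax] := arg_maxnP (P := fun m => A m k != 0) (fun i : 'I_n => i : nat) Al0k.
have inS m : A m k != 0 -> m \in S by apply: contraNT => /outk->.
have Sl := inS _ Alk.
have lt_kl : (k < l)%N.
  apply: leq_trans (lmax _ Al0k); rewrite ltn_neqAle kmin ?inS // andbT.
  by rewrite eq_sym.
have nelk : l != k by rewrite -val_eqE /= gtn_eqF.
pose T1 : 'M[C]_n := \matrix_(i, j) if j == l then A i k else (i == j)%:R.
have uT1 : upper T1.
  move=> i j lt_ji; rewrite mxE; case: eqP => [jl|_]; last by rewrite -val_eqE gtn_eqF.
  by apply: contraTeq lt_ji => /lmax /=; rewrite jl -leqNgt.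
have nT1 : T1 \in unitmx.
  apply: unit_upper => // i; rewrite mxE; case: (i =P l) => [->//|_].
  by rewrite eqxx oner_eq0.
have idT1 : id_outside S T1.
  move=> a b ab; rewrite mxE; case: eqP ab => // ->; rewrite Sl orbF => Sa.
  by rewrite outk //; case: eqP Sa => // ->; rewrite Sl.
have T1l : T1 *m delta_mx l 0 = A *m delta_mx k 0 :> 'cV_n.
  by apply/colP => m; rewrite !mx_delta_col mxE eqxx.
have T1k : T1 *m delta_mx k 0 = delta_mx k 0 :> 'cV_n.
  by apply/colP => m; rewrite mx_delta_col !mxE eq_sym (negbTE nelk) andbT.
have [A1 AT1] := exists_conjugate A nT1.
have [dA1 rA1] := conj_outside nT1 idT1 dA AT1.
have A12 := conj_involution nT1 A2 AT1.
have A1k : A1 *m delta_mx k 0 = delta_mx l 0 :> 'cV_n.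
  by apply: (can_inj (mulKmx nT1)); rewrite mulmxA -AT1 -mulmxA T1k T1l.
have A1l : A1 *m delta_mx l 0 = delta_mx k 0 :> 'cV_n.
  by rewrite -A1k mulmxA A12 mul1mx.
pose f : 'rV[C]_n := delta_mx 0 l *m A1.
have fE m : f 0 m = A1 l m by rewrite delta_row_mx.
have [||T2 [uT2 nT2 idT2 fT2 [rT2 cT2]]] := coordinate_change Sk kmin (_ : f 0 k = 1).
- by rewrite fE -mx_delta_col A1k mxE !eqxx.
- by move=> m Sm; rewrite fE dA1 // Sl (negbTE Sm).
have T2k : T2 *m delta_mx k 0 = delta_mx k 0 :> 'cV_n by apply: cT2; rewrite eqxx.
have T2l : T2 *m delta_mx l 0 = delta_mx l 0 :> 'cV_n.
  by apply: cT2; rewrite fE -mx_delta_col A1l mxE (negbTE nelk) /= eqxx.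
have [A' AT2] := exists_conjugate A1 nT2.
have [dA' rA'] := conj_outside nT2 idT2 dA1 AT2.
have A'2 := conj_involution nT2 A12 AT2.
have A'k : A' *m delta_mx k 0 = delta_mx l 0 :> 'cV_n.
  by apply: (can_inj (mulKmx nT2)); rewrite mulmxA -AT2 -mulmxA T2k T2l.
have A'l : A' *m delta_mx l 0 = delta_mx k 0 :> 'cV_n.
  by rewrite -A'k mulmxA A'2 mul1mx.
have kA' : delta_mx 0 k *m A' = delta_mx 0 l :> 'rV_n.
  by rewrite -fT2 -mulmxA -AT2 mulmxA -[f *m A1]mulmxA A12 mulmx1 rT2.
have lA' : delta_mx 0 l *m A' = delta_mx 0 k :> 'rV_n.
  by rewrite -kA' -mulmxA A'2 mulmx1.
have rowk m : A' k m = (m == l)%:R by rewrite -delta_row_mx kA' mxE eqxx.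
have rowl m : A' l m = (m == k)%:R by rewrite -delta_row_mx lA' mxE eqxx.
have colk m : A' m k = (m == l)%:R by rewrite -mx_delta_col A'k mxE andbT.
have coll m : A' m l = (m == k)%:R by rewrite -mx_delta_col A'l mxE andbT.
exists k, l, (T1 *m T2), A'; split=> //; first exact: upperM.
- by rewrite unitmx_mul nT1.
- by rewrite mulmxA AT1 -!mulmxA AT2.
split.
- by move=> a b Sa; rewrite rA' // rA1.
- split; [exists l | exists k]; exists 1; (split; first by left) => m.
    by rewrite rowk eq_sym; case: eqP.
  by rewrite rowl eq_sym; case: eqP.
- by apply: decoupledD2 => // m /negbTE ne; rewrite ?(rowk, rowl, colk, coll) ne.
Qed.

Lemma involution_reduce S A : A *m A = 1%:M -> decoupled S A ->
    (forall k, k \notin S -> signed_row A k) ->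
  exists T A', [/\ upper T, T \in unitmx, A *m T = T *m A' & forall k, signed_row A' k].
Proof.
have [m leSm] := ubnP #|S|; elim: m S A leSm => // m IHm S A leSm A2 dA rA.
have [S0|S0] := eqVneq S finset.set0.
  exists 1%:M, A; split=> [||//|k]; [exact: upper1 | exact: unitmx1 | by rewrite mulmx1 mul1mx|].
  by apply: rA; rewrite S0 inE.
have [k [l [T1 [A1 [Sk uT1 nT1 AT1 [rA1 [sk sl] dA1]]]]]] := involution_step S0 A2 dA.
have [||a Sa|T [A' [uT nT AT rA']]] := IHm (S :\ k :\ l)%SET A1 _ _ dA1.
- rewrite -ltnS; apply: leq_trans leSm; rewrite ltnS [X in (_ < X)%N](cardsD1 k) Sk.
  by rewrite ltnS; apply: subset_leq_card (subD1set _ _).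
- exact: conj_involution AT1.
- have [->//|al] := eqVneq a l; have [->//|ak] := eqVneq a k.
  have Sa' : a \notin S by move: Sa; rewrite !inE al ak.
  case: (rA a Sa') => l' [s [sP sE]]; exists l', s; split=> // b.
  by rewrite rA1.
exists (T1 *m T), A'; split=> //; first exact: upperM.
- by rewrite unitmx_mul nT1.
- by rewrite mulmxA AT1 -!mulmxA AT.
Qed.

Theorem involution_normal_form A : A *m A = 1%:M ->
  exists T we, [/\ upper T, T \in unitmx, is_signed_involution we & A *m T = T *m sign_mx C we].
Proof.
move=> A2; have [a b|k|T [A' [uT nT AT rA']]] := involution_reduce (S := [set: 'I_n]%SET) A2.
- by rewrite !inE.
- by rewrite inE.
have A'2 := conj_involution nT A2 AT.
have [k l|we [wI A'E]] := signed_rows_sign_mx rA'; last by exists T, we; rewrite -A'E.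
case: (rA' k) => l' [s [_ sE]]; rewrite sE; case: (l' =P l) => [<- s0|_]; last by rewrite eqxx.
have /matrixP/(_ k k) := A'2; rewrite !mxE (bigD1 l') //= big1 => [|m ne].
  rewrite addr0 eqxx => /eqP; apply: contraTneq => ->; rewrite mulr0 eq_sym.
  by rewrite oner_eq0.
by rewrite sE eq_sym (negbTE ne) mul0r.
Qed.

End Reduction.

(** * Adapted bases for a hermitian form *)

Section Hermitian.
Variables (C : numClosedFieldType) (n : nat).
Implicit Types (S : {set 'I_n}) (H T : 'M[C]_n).

Lemma hermE H : adj H = H -> forall a b, H a b = (H b a)^*.
Proof. by move=> hH a b; rewrite -[in LHS]hH !mxE. Qed.

Lemma adj_congr H T : adj H = H -> adj (adj T *m H *m T) = adj T *m H *m T.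
Proof. by move=> hH; rewrite !adjM adjK hH !mulmxA. Qed.

Lemma congr_unit H T : H \in unitmx -> T \in unitmx -> adj T *m H *m T \in unitmx.
Proof. by move=> nH nT; rewrite !unitmx_mul adj_unit nT nH. Qed.

Definition monomial_row H k : Prop := exists l, forall m, m != l -> H k m = 0.

Lemma unit_row_neq0 H k : H \in unitmx -> exists l, H k l != 0.
Proof.
move=> nH; have [/existsP//|/existsPn Hk0] := boolP [exists l, H k l != 0].
have /matrixP/(_ k k) := mulmxV nH; rewrite mxE big1 => [|l _].
  by move=> /eqP; rewrite mxE eqxx eq_sym oner_eq0.
by have := Hk0 l; rewrite negbK => /eqP->; rewrite mul0r.
Qed.

(** A fixed index is rescaled by the inverse square root of a modulus, and only the
    larger index of a pair is rescaled, by the inverse of the entry linking the pair.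
    The last clause gives a unitary scaling when all entries have modulus [1]. *)
Lemma monomial_hermitian_scale H : adj H = H -> H \in unitmx ->
    (forall k, monomial_row H k) ->
  exists (d : 'rV[C]_n) we, [/\ forall i, d 0 i != 0, is_signed_involution we,
    adj (diag_mx d) *m H *m diag_mx d = sign_mx C we,
    (forall i, H i (we.1 i) != 0) &
    (forall i j, H i j != 0 -> `|H i j| = 1) -> forall i, `|d 0 i| = 1].
Proof.
move=> hH nH /choice[f f0].
have fk k : H k (f k) != 0.
  have [l] := unit_row_neq0 k nH; have [->//|/f0->] := eqVneq l (f k).
  by rewrite eqxx.
have Hsym := hermE hH.
have ff k : f (f k) = k.
  apply/eqP; rewrite eq_sym; apply: contraNT (fk k) => /f0 fk0.
  by rewrite Hsym fk0 rmorph0.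
pose c k := H k (f k).
have cf k : c (f k) = (c k)^* by rewrite /c ff Hsym.
pose s k : int := if 0 < c k then 1 else -1.
pose dd k := if f k == k then (sqrtC `|c k|)^-1 else if (k < f k)%N then 1 else (c (f k))^-1.
pose we : signed_perm n := (perm (can_inj ff), [ffun k => if f k == k then s k else 0]).
exists (\row_k dd k), we; split.
- move=> i; rewrite mxE /dd; case: (f i =P i) => _.
    by rewrite invr_eq0 sqrtC_eq0 normr_eq0 fk.
  by case: ifP => _; rewrite ?oner_eq0 // invr_eq0 cf conjC_eq0 fk.
- split=> k; first by rewrite /= !permE ff.
  by rewrite /= permE ffunE; case: eqP => // _; rewrite /s; case: ifP; auto.
- apply/matrixP => k l; rewrite mul_mx_diag !mxE (bigD1 k) //= !mxE eqxx mulr1n big1.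
    rewrite addr0 permE; case: (f k =P l) => [<-|/eqP ne]; last first.
      by rewrite f0 1?eq_sym // mulr0 mul0r.
    rewrite /isign /= permE ffunE /dd ff.
    case: (f k =P k) => [fkk|/eqP ne].
      have cR : c k \is Num.real.
        by rewrite CrealE -cf fkk.
      have ck : H k k = c k by rewrite /c fkk.
      rewrite fkk eqxx ck (_ : (sqrtC _)^-1^* = (sqrtC `|c k|)^-1); last first.
        by rewrite conj_Creal // realV ger0_real // sqrtC_ge0.
      rewrite mulrAC -invfM -expr2 sqrtCK /s.
      have nzc : c k != 0 by exact: fk.
      case: ifP => [/gtr0_norm->|/negbT]; first by rewrite mulVf.
      rewrite -real_leNgt ?real0 // le_eqVlt (negbTE nzc) /= => /ltr0_norm->.
      by rewrite invrN mulNr mulVf // rmorphN.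
    rewrite eq_sym (negbTE ne) -/(c k).
    case: (ltngtP k (f k)) => [lt|lt|/val_inj eqk]; last by rewrite -eqk eqxx in ne.
      by rewrite conjC1 mul1r mulfV // fk.
    by rewrite mulr1 cf fmorphV /= conjCK mulVf // fk.
  move=> m ne; rewrite !mxE (negbTE ne) mulr0n conjC0.
  by rewrite mul0r.
- by move=> i; rewrite /= permE.
- move=> H1 i; rewrite mxE /dd; have c1 k : `|c k| = 1 by exact: H1.
  rewrite c1 sqrtC1 invr1; case: ifP => _; rewrite ?normr1 //.
  by case: ifP => _; rewrite ?normr1 // normfV c1 invr1.
Qed.

(** The congruence by the move [e_m := e_m - r m e_k], for [m] beyond [k]. *)
Lemma hermitian_update S H k (r : 'I_n -> C) :
    decoupled S H -> k \in S -> (forall m, r m != 0 -> m \in S /\ (k < m)%N) ->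
  exists T, let H1 := adj T *m H *m T in [/\ upper T, T \in unitmx,
    forall a b, H1 a b = H a b - H a k * r b - (r a)^* * H k b + (r a)^* * H k k * r b,
    decoupled S H1 & forall a b, a \notin S -> H1 a b = H a b].
Proof.
move=> dH Sk rP.
have r0 m : m \notin S -> r m = 0 by move=> Sm; apply: contraNeq Sm => /rP[].
have rk : r k = 0 by apply/eqP/negPn/negP => /rP[]; rewrite ltnn.
pose T : 'M[C]_n := 1%:M - delta_mx k 0 *m \row_m r m.
have TE i j : T i j = (i == j)%:R - (i == k)%:R * r j.
  by rewrite !mxE big_ord1 !mxE eqxx !andbT.
have uT : upper T.
  move=> i j lt_ji; rewrite TE -val_eqE gtn_eqF // sub0r.
  have [ik|] := eqVneq i k; last by rewrite mul0r oppr0.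
  rewrite mul1r (_ : r j = 0) ?oppr0 //; apply/eqP/negPn/negP => /rP[_].
  by rewrite -ik ltnNge ltnW.
exists T; have H1E a b : (adj T *m H *m T) a b
    = H a b - H a k * r b - (r a)^* * H k b + (r a)^* * H k k * r b.
  have XT (X : 'M[C]_n) c d : (X *m T) c d = X c d - X c k * r d.
    rewrite mulmxBr mulmx1 mulmxA -colE 2!mxE [X in _ - X]mxE big_ord1 !mxE.
    by [].
  have -> : (adj T *m H *m T) a b = ((adj (H *m T) *m T) b a)^*.
    by rewrite -mulmxA -[adj T *m _]adjK adjM adjK !mxE.
  by rewrite XT !adjE !XT rmorphB rmorphM /= !conjCK; ring.
split=> //.
- apply: unit_upper => // i; rewrite TE eqxx.
  have [->|_] := eqVneq i k; rewrite ?rk ?mulr0 ?mul0r subr0 ?oner_eq0 //.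
- move=> a b ab; rewrite H1E dH //; have [Sa|Sa] := boolP (a \in S); last first.
    by rewrite (r0 a Sa) conjC0 !mul0r addr0 subr0 dH ?mul0r ?subr0 // Sk (negbTE Sa).
  have Sb : b \notin S by move: ab; rewrite Sa; case: (b \in S).
  by rewrite (r0 b Sb) !mulr0 addr0 subr0 (dH k b) ?mulr0 ?subr0 // Sk (negbTE Sb).
- move=> a b Sa; rewrite H1E (r0 a Sa) conjC0 !mul0r addr0 subr0.
  by rewrite (dH a k) ?mul0r ?subr0 // Sk (negbTE Sa).
Qed.

(** Let [k] be the first remaining index and [l] the first one with
    [H k l <> 0]. If [l = k], one move clears row [k]. Otherwise subtracting
    multiples of [e_l] clears row [k] beyond [l], and then subtracting multiples
    of [e_k] clears row [l]; half of the diagonal entry [H l l] is removed, since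
    the move acts on it twice. *)
Lemma hermitian_step S H : S != finset.set0 -> adj H = H -> H \in unitmx -> decoupled S H ->
  exists k l T, let H1 := adj T *m H *m T in [/\ k \in S, upper T, T \in unitmx,
    forall a b, a \notin S -> H1 a b = H a b &
    [/\ monomial_row H1 k, monomial_row H1 l & decoupled (S :\ k :\ l)%SET H1]].
Proof.
move=> S0 hH nH dH; have [k Sk kmin] := minimal_elt S0.
have [l0 Hkl0] := unit_row_neq0 k nH.
have [l Hkl lmin] := arg_minnP (P := fun m => H k m != 0) (fun i : 'I_n => i : nat) Hkl0.
have inS m : H k m != 0 -> m \in S.
  by apply: contraNT => Sm; rewrite dH // Sk (negbTE Sm).
have Sl := inS _ Hkl.
have Hout (H' : 'M[C]_n) a b : decoupled S H' -> a \in S -> b \notin S -> H' a b = 0.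
  by move=> dH' Sa Sb; rewrite dH' // Sa (negbTE Sb).
have [lk|nelk] := eqVneq l k.
  rewrite lk in Hkl; pose r b := if (b \in S) && (b != k) then H k b / H k k else 0.
  have [m|T [uT nT H1E dH1 H1out]] := hermitian_update (r := r) dH Sk.
    rewrite /r; case: ifP => [/andP[Sm ne] _|]; last by rewrite eqxx.
    by split=> //; rewrite ltn_neqAle kmin // andbT eq_sym.
  have hH1 := adj_congr T hH.
  exists k, k, T; split=> //; set H1 := adj T *m H *m T in hH1 *.
  have rowk m : m != k -> H1 k m = 0.
    move=> ne; have [Sm|Sm] := boolP (m \in S); last exact: Hout.
    rewrite H1E {2 3}/r eqxx andbF conjC0 !mul0r addr0 subr0 /r Sm ne /=.
    by rewrite mulrC divfK // subrr.
  have colk m : m != k -> H1 m k = 0 by move=> /rowk; rewrite (hermE hH1 m k) => ->; rewrite conjC0.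
  by split; [exists k | exists k | exact: decoupledD2].
have lt_kl : (k < l)%N by rewrite ltn_neqAle kmin // andbT eq_sym.
pose r b := if (b \in S) && (l < b)%N then H k b / H k l else 0.
have [m|T1 [uT1 nT1 H1E dH1 H1out]] := hermitian_update (r := r) dH Sl.
  by rewrite /r; case: ifP => [/andP[Sm lt] _|] //; rewrite eqxx.
have hH1 := adj_congr T1 hH; set H1 := adj T1 *m H *m T1 in hH1 H1E dH1 H1out *.
have rowk1 m : m != l -> H1 k m = 0.
  move=> ne; have [Sm|Sm] := boolP (m \in S); last exact: Hout.
  rewrite H1E {2 3}/r (ltnNge l k) (ltnW lt_kl) andbF conjC0 !mul0r addr0 subr0 /r Sm /=.
  case: ltngtP => [lt|lt|/val_inj eq_lm]; last by rewrite eq_lm eqxx in ne.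
    by rewrite mulrC divfK // subrr.
  rewrite mulr0 subr0; apply/eqP; apply: contraTT lt => /lmin.
  by rewrite -leqNgt.
have H1kl : H1 k l = H k l.
  rewrite H1E {2 3}/r (ltnNge l k) (ltnW lt_kl) andbF conjC0 !mul0r addr0 subr0 /r ltnn andbF.
  by rewrite mulr0 subr0.
have H1lk : H1 l k = (H k l)^* by rewrite (hermE hH1) H1kl.
have nz1 : H1 l k != 0 by rewrite H1lk conjC_eq0.
pose r2 b := if (b \in S) && (b != k) then
  (if b == l then H1 l l / 2 else H1 l b) / H1 l k else 0.
have [m|T2 [uT2 nT2 H2E dH2 H2out]] := hermitian_update (r := r2) dH1 Sk.
  rewrite /r2; case: ifP => [/andP[Sm ne] _|]; last by rewrite eqxx.
  by split=> //; rewrite ltn_neqAle kmin // andbT eq_sym.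
have hH2 := adj_congr T2 hH1; set H2 := adj T2 *m H1 *m T2 in hH2 H2E dH2 H2out *.
have H1kk : H1 k k = 0 by apply: rowk1; rewrite eq_sym.
have r2k : r2 k = 0 by rewrite /r2 eqxx andbF.
have rowk m : m != l -> H2 k m = 0.
  by move=> ne; rewrite H2E rowk1 // H1kk r2k conjC0 !(mul0r, addr0, subr0).
have rowl m : m != k -> H2 l m = 0.
  move=> ne; have [Sm|Sm] := boolP (m \in S); last exact: Hout.
  rewrite H2E H1kk mulr0 mul0r addr0 /r2 Sm ne Sl nelk /=.
  have [->|neml] := eqVneq m l.
    rewrite eqxx.
    have -> : (H1 l l / 2 / H1 l k)^* = H1 l l / 2 / H1 k l.
      by rewrite !rmorphM !fmorphV rmorph_nat /= -!(hermE hH1).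
    have nz2 : H1 k l != 0 by rewrite H1kl.
    by field; rewrite nz1 nz2.
  by rewrite (rowk1 m neml) mulr0 subr0 mulrC divfK ?subrr.
have colk m : m != l -> H2 m k = 0 by move=> /rowk; rewrite (hermE hH2 m k) => ->; rewrite conjC0.
have coll m : m != k -> H2 m l = 0 by move=> /rowl; rewrite (hermE hH2 m l) => ->; rewrite conjC0.
have H2T : adj (T1 *m T2) *m H *m (T1 *m T2) = H2 by rewrite adjM /H2 /H1 !mulmxA.
exists k, l, (T1 *m T2); rewrite H2T; split=> //.
- exact: upperM.
- by rewrite unitmx_mul nT1.
- by move=> a b Sa; rewrite H2out // H1out.
by split; [exists l | exists k | exact: decoupledD2].
Qed.

Lemma hermitian_reduce S H : adj H = H -> H \in unitmx -> decoupled S H ->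
    (forall k, k \notin S -> monomial_row H k) ->
  exists T, [/\ upper T, T \in unitmx & forall k, monomial_row (adj T *m H *m T) k].
Proof.
have [m leSm] := ubnP #|S|; elim: m S H leSm => // m IHm S H leSm hH nH dH rH.
have [S0|S0] := eqVneq S finset.set0.
  exists 1%:M; split=> [||k]; [exact: upper1 | exact: unitmx1 |].
  rewrite mulmx1 /adj map_mx1 trmx1 mul1mx; apply: rH.
  by rewrite S0 inE.
have [k [l [T1 [Sk uT1 nT1 rH1 [sk sl dH1]]]]] := hermitian_step S0 hH nH dH.
set H1 := adj T1 *m H *m T1 in rH1 sk sl dH1.
have [||||T [uT nT rT]] := IHm (S :\ k :\ l)%SET H1 _ _ _ dH1.
- rewrite -ltnS; apply: leq_trans leSm; rewrite ltnS [X in (_ < X)%N](cardsD1 k) Sk.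
  by rewrite ltnS; apply: subset_leq_card (subD1set _ _).
- exact: adj_congr.
- exact: congr_unit.
- move=> a Sa; have [->//|al] := eqVneq a l; have [->//|ak] := eqVneq a k.
  have Sa' : a \notin S by move: Sa; rewrite !inE al ak.
  by case: (rH a Sa') => l' lE; exists l' => b ne; rewrite rH1 // lE.
exists (T1 *m T); split; first exact: upperM.
- by rewrite unitmx_mul nT1.
- by have -> : adj (T1 *m T) *m H *m (T1 *m T) = adj T *m H1 *m T by rewrite adjM /H1 !mulmxA.
Qed.

Lemma upper_diag (d : 'rV[C]_n) : upper (diag_mx d).
Proof. by move=> i j lt_ji; rewrite mxE -val_eqE gtn_eqF // mulr0n. Qed.

Lemma diag_unit (d : 'rV[C]_n) : (forall i, d 0 i != 0) -> diag_mx d \in unitmx.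
Proof.
move=> nzd; apply: unit_upper => [|i]; first exact: upper_diag.
by rewrite mxE eqxx mulr1n.
Qed.

Theorem hermitian_normal_form H : adj H = H -> H \in unitmx ->
  exists T we, [/\ upper T, T \in unitmx, is_signed_involution we &
    adj T *m H *m T = sign_mx C we].
Proof.
move=> hH nH; have [a b|k|T [uT nT rT]] := hermitian_reduce (S := [set: 'I_n]%SET) hH nH.
- by rewrite !inE.
- by rewrite inE.
have [d [we [d0 wI dE _ _]]] :=
  monomial_hermitian_scale (adj_congr T hH) (congr_unit nH nT) rT.
exists (T *m diag_mx d), we; split=> //.
- by apply: upperM => //; exact: upper_diag.
- by rewrite unitmx_mul nT diag_unit.
- by rewrite -dE adjM !mulmxA.
Qed.

End Hermitian.

(** * Invariants comparing conjugate and dual bases of a flag *)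

Section Invariants.
Variables (C : numClosedFieldType) (n : nat).
Implicit Types (A : {set 'I_n}) (T B : 'M[C]_n) (we : signed_perm n).

Definition rank_set we (i j : nat) : {set 'I_n} :=
  [set k : 'I_n | (k < i)%N && (we.1 k < j)%N]%SET.

Definition sign_set (s : int) we (i : nat) : {set 'I_n} :=
  [set k : 'I_n | (k < i)%N && ((we.1 k == k) && (we.2 k == s) || (we.1 k < k)%N)]%SET.

Lemma kernel_vector T A A' : (#|A'| < #|A|)%N ->
  exists x : 'cV[C]_n, [/\ x != 0, forall k, k \notin A -> x k 0 = 0 &
    forall k, k \in A' -> (T *m x) k 0 = 0].
Proof.
move=> ltA; pose M : 'M[C]_(#|A|, #|A'|) := \matrix_(i, j) T (enum_val j) (enum_val i).
have /rowV0Pn[u /sub_kermxP uM nzu] : kermx M != 0.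
  rewrite kermx_eq0 /row_free neq_ltn (leq_ltn_trans (rank_leq_col M) ltA) //.
pose x : 'cV[C]_n := \sum_i u 0 i *: delta_mx (enum_val i) 0.
have xE k : x k 0 = \sum_i u 0 i * (k == enum_val i)%:R.
  by rewrite summxE; apply: eq_bigr => i _; rewrite !mxE andbT.
exists x; clearbody x; split.
- apply: contraNneq nzu => x0; apply/eqP/rowP => i.
  have := xE (enum_val i); rewrite x0 mxE (bigD1 i) //= eqxx mulr1 big1 ?addr0 => [<-|j ne].
    by rewrite mxE.
  by rewrite (inj_eq enum_val_inj) eq_sym (negbTE ne) mulr0.
- move=> k Ak; rewrite xE big1 // => i _.
  by case: eqP Ak => [->|]; rewrite ?enum_valP // mulr0.
move=> k Ak; have : (u *m M) 0 (enum_rank_in Ak k) = 0 by rewrite uM mxE.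
apply: etrans; rewrite !mxE.
transitivity (\sum_j \sum_i u 0 i * (T k j * (j == enum_val i)%:R)).
  apply: eq_bigr => j _; rewrite xE mulr_sumr; apply: eq_bigr => i _; rewrite mulrCA //.
rewrite exchange_big; apply: eq_bigr => i _ /=.
rewrite (bigD1 (enum_val i)) //= eqxx mulr1 big1 ?addr0 => [|m ne].
  by rewrite mxE enum_rankK_in.
by rewrite (negbTE ne) !mulr0.
Qed.

Lemma upper_support T (x : 'cV[C]_n) i : upper T ->
  (forall m : 'I_n, (i <= m)%N -> x m 0 = 0) ->
  forall m : 'I_n, (i <= m)%N -> (T *m x) m 0 = 0.
Proof.
move=> uT x0 m le_im; rewrite mxE big1 // => k _.
have [lt_km|le_mk] := ltnP k m; first by rewrite uT ?mul0r.
by rewrite x0 ?mulr0 // (leq_trans le_im).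
Qed.

(** In the applications [we] is the type of a conjugate basis [B], [we'] that of
    a dual basis of the same flag, and [T] the change of basis. The relation
    [BTE] expresses the standard hermitian product through the dual basis. *)
Section Comparison.
Variables (we we' : signed_perm n) (T B : 'M[C]_n).
Hypotheses (wI : is_signed_involution we) (wI' : is_signed_involution we').
Hypotheses (uT : upper T) (nB : B \in unitmx).
Hypothesis BTE : adj B *m B = adj T *m sign_mx C we' *m T *m sign_mx C we.

Lemma comparison_gt0 (x : 'cV[C]_n) : x != 0 ->
  0 < \sum_k ((T *m x) k 0)^* * ((isign we' k)%:~R * (T *m (sign_mx C we *m x)) (we'.1 k) 0).
Proof.
move=> nzx; have nzBx : B *m x != 0.
  by apply: contraNneq nzx => /(congr1 (mulmx (invmx B))); rewrite mulKmx // mulmx0 => ->.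
have := sqnorm_gt0 nzBx.
have -> : adj (B *m x) *m (B *m x) = adj (T *m x) *m (sign_mx C we' *m (T *m (sign_mx C we *m x))).
  by rewrite !adjM -mulmxA (mulmxA (adj B)) BTE !mulmxA.
by rewrite mxE; under eq_bigr do rewrite adjE mul_sign_mx.
Qed.

(** Otherwise some nonzero combination [x] of the [v_k] with [k < i], [w k < j]
    has no component on the dual basis vectors that pair nontrivially with the
    [j]-th subspace. But that subspace contains [delta x], and
    [phi(x, delta x)] is the square norm of [x]. *)
Lemma rank_set_le i j : (#|rank_set we i j| <= #|rank_set we' i j|)%N.
Proof.
rewrite leqNgt; apply/negP => /(kernel_vector T)[x [nzx xA xA']].
have := comparison_gt0 nzx; rewrite big1 ?ltxx // => k _.
have [lt_ki|le_ik] := ltnP k i; last first.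
  rewrite (upper_support uT _ le_ik) ?conjC0 ?mul0r // => m le_im.
  by apply: xA; rewrite inE ltnNge le_im.
have [lt_wj|le_jw] := ltnP (we'.1 k) j; last first.
  rewrite (upper_support uT _ le_jw) ?mulr0 // => m le_jm.
  rewrite mul_sign_mx xA ?mulr0 // inE invol_inv // negb_and -!leqNgt.
  by rewrite le_jm orbT.
by rewrite xA' ?conjC0 ?mul0r // inE lt_ki.
Qed.

(** The column [k] is [e_k] at a fixed point and the vector [e_k + s e_(w k)],
    on which [sign_mx we] acts by [s], otherwise. *)
Definition pair_mx (s : int) we : 'M[C]_n :=
  \matrix_(m, k) ((m == k)%:R + s%:~R * ((m == we.1 k) && (we.1 k != k))%:R).

Lemma pair_mx_tr s (y : 'cV[C]_n) k : ((pair_mx s we')^T *m y) k 0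
   = y k 0 + (if we'.1 k == k then 0 else s%:~R * y (we'.1 k) 0).
Proof.
rewrite mxE; under eq_bigr do rewrite !mxE mulrDl.
rewrite big_split /=; congr (_ + _).
  rewrite (bigD1 k) //= eqxx mul1r big1 ?addr0 // => m /negbTE->.
  by rewrite mul0r.
rewrite (bigD1 (we'.1 k)) //= eqxx andTb big1 ?addr0 => [|m /negbTE->]; last first.
  by rewrite andFb mulr0 mul0r.
by case: eqP; rewrite ?mulr1 // mulr0 mul0r.
Qed.

Lemma pair_mxE s (x : 'cV[C]_n) k : (pair_mx s we *m x) k 0
   = x k 0 + (if we.1 k == k then 0 else s%:~R * x (we.1 k) 0).
Proof.
rewrite mxE; under eq_bigr do rewrite !mxE mulrDl.
rewrite big_split /=; congr (_ + _).
  rewrite (bigD1 k) //= eqxx mul1r big1 ?addr0 // => m.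
  by rewrite eq_sym => /negbTE->; rewrite mul0r.
rewrite (bigD1 (we.1 k)) //= invol_inv // eqxx andTb big1 ?addr0 => [|m ne]; last first.
  rewrite -{1}[k](invol_inv wI) (inj_eq perm_inj) eq_sym (negbTE ne) andFb.
  by rewrite mulr0 mul0r.
by rewrite eq_sym; case: eqP; rewrite ?mulr1 // mulr0 mul0r.
Qed.

(** The combinations of the columns of [pair_mx] with index in [sign_set s we i]
    form a subspace of the [i]-th subspace of the flag on which [s * phi] is
    positive definite. The dual basis cuts out, by as many equations as
    [sign_set s we' i] has elements, a subspace on which it is negative
    semidefinite. *)
Lemma sign_set_le (s : int) i : s = 1 \/ s = -1 ->
  (#|sign_set s we i| <= #|sign_set s we' i|)%N.
Proof.
move=> sP; have s2 : s%:~R * s%:~R = 1 :> C by rewrite -intrM; case: sP => ->.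
rewrite leqNgt; apply/negP.
move=> /(kernel_vector ((pair_mx s we')^T *m T *m pair_mx s we))[x [nzx xA xA']].
set X := pair_mx s we *m x.
have X0 (m : 'I_n) : (i <= m)%N -> X m 0 = 0.
  move=> le_im; rewrite pair_mxE xA ?add0r; last by rewrite inE ltnNge le_im.
  case: eqP => // /eqP ne; rewrite xA ?mulr0 // inE invol_inv // negb_and -leqNgt.
  rewrite [_ == we.1 m]eq_sym (negbTE ne) /= -leqNgt.
  by case: leqP => // lt; rewrite ltnW // (leq_trans lt).
have nzX : X != 0.
  apply: contraNneq nzx => X_0; apply/eqP/colP => k; rewrite [RHS]mxE.
  have [Ak|/xA//] := boolP (k \in sign_set s we i).
  have := pair_mxE s x k; rewrite -/X X_0 mxE.
  case: eqP => [_|/eqP ne]; first by rewrite addr0 => <-.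
  rewrite [x (we.1 k) 0]xA ?mulr0 ?addr0 => [<-//|].
  move: Ak; rewrite !inE invol_inv // (negbTE ne) /= => /andP[_ lt].
  by rewrite [_ == we.1 k]eq_sym (negbTE ne) /= [(k < _)%N]ltnNge (ltnW lt) andbF.
have PX : sign_mx C we *m X = s%:~R *: X.
  have XE k : X k 0 = x k 0 + (if we.1 k == k then 0 else s%:~R * x (we.1 k) 0).
    exact: pair_mxE.
  apply/colP => k; rewrite mul_sign_mx [RHS]mxE !XE invol_inv // /isign.
  have [wk|ne] := eqVneq (we.1 k) k; last first.
    by rewrite mul1r mulrDr mulrA s2 mul1r addrC.
  rewrite wk !addr0; have [|/xA->] := boolP (k \in sign_set s we i); last by rewrite !mulr0.
  by rewrite inE wk eqxx ltnn orbF => /and3P[_ _ /eqP->].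
have := comparison_gt0 nzX; rewrite PX -scalemxAr.
set y := T *m X.
have y0 (m : 'I_n) : (i <= m)%N -> y m 0 = 0 by exact: upper_support.
move=> gt0; suff /(lt_le_trans gt0) : \sum_k (y k 0)^* *
    ((isign we' k)%:~R * (s%:~R *: y) (we'.1 k) 0) <= 0 by rewrite ltxx.
apply: sumr_le0 => k _; rewrite [(s%:~R *: y) _ _]mxE.
have [lt_ki|/y0->] := ltnP k i; last by rewrite conjC0 mul0r.
have yA m : m \in sign_set s we' i ->
    y m 0 + (if we'.1 m == m then 0 else s%:~R * y (we'.1 m) 0) = 0.
  by move=> /xA'; rewrite -!mulmxA pair_mx_tr.
(* Each term vanishes or is [- |y_k|^2]. *)
have sqN : (y k 0)^* * - y k 0 <= 0 by rewrite mulrN oppr_le0 mulrC mul_conjC_ge0.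
rewrite /isign; have [wk|ne] := eqVneq (we'.1 k) k.
  rewrite wk; have [eq_s|ne_s] := eqVneq (we'.2 k) s.
    by have := yA k; rewrite inE lt_ki wk eqxx eq_s eqxx addr0 => ->; rewrite ?conjC0 ?mul0r.
  have -> : we'.2 k = - s.
    case: wI' => _ /(_ k); rewrite wk eqxx => -[] e; move: ne_s; rewrite e;
      by case: sP => ->.
  by rewrite rmorphN mulNr mulrA s2 mul1r.
have [lt_wi|/y0->] := ltnP (we'.1 k) i; last by rewrite !mulr0.
have -> : s%:~R * y (we'.1 k) 0 = - y k 0; last by rewrite mul1r.
case: (ltngtP (we'.1 k) k) => [lt|lt|/val_inj eqk]; last by rewrite eqk eqxx in ne.
  by have := yA k; rewrite inE lt_ki lt orbT (negbTE ne) => /(_ isT)/eqP; rewrite addrC addr_eq0 => /eqP.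
have := yA (we'.1 k); rewrite inE lt_wi invol_inv // lt orbT eq_sym (negbTE ne) => /(_ isT)/eqP.
by rewrite addr_eq0 => /eqP->; rewrite mulrN mulrA s2 mul1r.
Qed.

End Comparison.

Lemma card_rank_setS we (i : 'I_n) j :
  #|rank_set we i.+1 j| = ((we.1 i < j)%N + #|rank_set we i j|)%N.
Proof.
rewrite (cardsD1 i) inE ltnSn /=; congr (_ + _)%N; apply: eq_card => k.
by rewrite !inE -val_eqE /= ltnS [in RHS]ltn_neqAle andbA.
Qed.

Lemma card_sign_setS s we (i : 'I_n) : #|sign_set s we i.+1|
  = (((we.1 i == i) && (we.2 i == s) || (we.1 i < i)%N) + #|sign_set s we i|)%N.
Proof.
rewrite (cardsD1 i) inE ltnSn /=; congr (_ + _)%N; apply: eq_card => k.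
by rewrite !inE -val_eqE /= ltnS [in RHS]ltn_neqAle andbA.
Qed.

Definition dominated we we' : Prop :=
  (forall i j, #|rank_set we i j| <= #|rank_set we' i j|)%N /\
  (forall i, #|sign_set 1 we i| <= #|sign_set 1 we' i|)%N.

(** A single integer that grows strictly along [dominated]. *)
Definition total_rank we : nat := (\sum_(i < n.+1) \sum_(j < n.+1) #|rank_set we i j|
  + \sum_(i < n.+1) #|sign_set 1 we i|)%N.

Lemma leq_add_eq (a a' b b' : nat) : (a <= a')%N -> (b <= b')%N ->
  (a + b = a' + b')%N -> a = a' /\ b = b'.
Proof. by move=> *; split; lia. Qed.

(** Increasing [i] by one reveals whether [w i < j] in the first family, hence
    [w i]; in the second one it then reveals the sign of a fixed point. *)
Lemma total_rank_inj we we' : is_signed_involution we -> is_signed_involution we' ->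
  dominated we we' -> total_rank we = total_rank we' -> we = we'.
Proof.
move=> wI wI' [rk_le sg_le] tot_eq.
have leR : (\sum_(i < n.+1) \sum_(j < n.+1) #|rank_set we i j| <=
            \sum_(i < n.+1) \sum_(j < n.+1) #|rank_set we' i j|)%N.
  by apply: leq_sum => i _; apply: leq_sum => j _.
have leS : (\sum_(i < n.+1) #|sign_set 1 we i| <= \sum_(i < n.+1) #|sign_set 1 we' i|)%N.
  by apply: leq_sum => i _.
have [eqR eqS] : (\sum_(i < n.+1) \sum_(j < n.+1) #|rank_set we i j| =
      \sum_(i < n.+1) \sum_(j < n.+1) #|rank_set we' i j|)%N /\
    (\sum_(i < n.+1) #|sign_set 1 we i| = \sum_(i < n.+1) #|sign_set 1 we' i|)%N.
  exact: leq_add_eq leR leS tot_eq.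
have sum_eq (f g : 'I_n.+1 -> nat) : (forall i, (f i <= g i)%N) ->
    (\sum_i f i = \sum_i g i)%N -> forall i, f i = g i.
  move=> le_fg + i; rewrite (bigD1 i) // [RHS](bigD1 i) //= => eq_fg.
  have [|//] := leq_add_eq (le_fg i) _ eq_fg; exact: leq_sum.
have rkE (i j : 'I_n.+1) : #|rank_set we i j| = #|rank_set we' i j|.
  have rowE : (\sum_(j < n.+1) #|rank_set we i j| = \sum_(j < n.+1) #|rank_set we' i j|)%N.
    apply: (sum_eq (fun i : 'I_n.+1 => \sum_(j < n.+1) #|rank_set we i j|)%N
      (fun i : 'I_n.+1 => \sum_(j < n.+1) #|rank_set we' i j|)%N _ eqR i) => k.
    exact: leq_sum.
  exact: (sum_eq (fun j : 'I_n.+1 => #|rank_set we i j|) _ _ rowE j).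
have sgE (i : 'I_n.+1) : #|sign_set 1 we i| = #|sign_set 1 we' i|.
  exact: (sum_eq (fun i : 'I_n.+1 => #|sign_set 1 we i|) _ _ eqS i).
have wE k : we.1 k = we'.1 k.
  have ltE j : (j <= n)%N -> (we.1 k < j)%N = (we'.1 k < j)%N.
    move=> le_jn; have lt_k := ltn_ord k.
    have := rkE (Ordinal (lt_k : k.+1 < n.+1)%N) (Ordinal (le_jn : j < n.+1)%N).
    have := rkE (Ordinal (ltnW lt_k : k < n.+1)%N) (Ordinal (le_jn : j < n.+1)%N).
    rewrite /= !card_rank_setS => -> /eqP; rewrite eqn_add2r.
    by case: (we.1 k < j)%N; case: (we'.1 k < j)%N.
  have le1 : (we.1 k < (we'.1 k).+1)%N by rewrite ltE ?ltn_ord.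
  have le2 : (we'.1 k < (we.1 k).+1)%N by rewrite -ltE ?ltn_ord.
  by apply/val_inj/eqP; rewrite eqn_leq; apply/andP.
have epsE k : we.2 k = we'.2 k.
  case: wI wI' => _ /(_ k) ek [_ /(_ k)]; rewrite -wE.
  have := sgE (Ordinal (ltn_ord k : k.+1 < n.+1)%N).
  have := sgE (Ordinal (ltnW (ltn_ord k) : k < n.+1)%N).
  rewrite /= !card_sign_setS => -> /eqP; rewrite eqn_add2r -wE; move: ek.
  case: (we.1 k =P k) => [->|_ -> _ ->//]; rewrite ltnn !orbF.
  by move=> e1 H e2; case: e1 e2 H => -> [] ->.
case: we wE epsE {wI rk_le sg_le tot_eq leR leS eqR eqS rkE sgE} => w e /= wE eE.
case: we' wE eE {wI'} => w' e' /= /permP-> eE; congr (_, _).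
exact/ffunP.
Qed.

Lemma dominated_total we we' : dominated we we' -> (total_rank we <= total_rank we')%N.
Proof.
by case=> rk_le sg_le; apply: leq_add; apply: leq_sum => i _ //; apply: leq_sum.
Qed.

Lemma dominated_anti we we' : is_signed_involution we -> is_signed_involution we' ->
  dominated we we' -> dominated we' we -> we = we'.
Proof.
move=> wI wI' d d'; apply: total_rank_inj => //; apply/eqP.
by rewrite eqn_leq !dominated_total.
Qed.

Lemma total_rank_bound we : (total_rank we <= n.+1 * (n.+1 * n) + n.+1 * n)%N.
Proof.
have le_n (A : {set 'I_n}) : (#|A| <= n)%N by rewrite -[X in (_ <= X)%N]card_ord max_card.
have sum_le (f : 'I_n.+1 -> nat) m : (forall i, (f i <= m)%N) -> (\sum_i f i <= n.+1 * m)%N.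
  move=> le_f; have -> : (n.+1 * m = \sum_(i < n.+1) m)%N by rewrite sum_nat_const card_ord.
  by apply: leq_sum => i _; apply: le_f.
by apply: leq_add; apply: (sum_le) => i //; apply: (sum_le).
Qed.

End Invariants.

(** * Bases that are both conjugate and dual *)

Lemma perm_of_card n (A A' : {set 'I_n}) : #|A| = #|A'| ->
  exists s : 'S_n, forall k, (s k \in A') = (k \in A).
Proof.
move=> eqA; pose e1 := enum A ++ enum (~: A)%SET; pose e2 := enum A' ++ enum (~: A')%SET.
have full (X : {set 'I_n}) k : k \in enum X ++ enum (~: X)%SET.
  by rewrite mem_cat !mem_enum inE orbN.
have uniq_e (X : {set 'I_n}) : uniq (enum X ++ enum (~: X)%SET).
  rewrite cat_uniq !enum_uniq andbT /=; apply/hasPn => k.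
  by rewrite !mem_enum inE.
have size_e (X : {set 'I_n}) : size (enum X ++ enum (~: X)%SET) = n.
  by rewrite size_cat -!cardE cardsC card_ord.
pose f k := nth k e2 (index k e1).
have f_inj : injective f.
  move=> k l; have lt_i m : (index m e1 < size e2)%N.
    have -> : size e2 = size e1 by rewrite !size_e.
    by rewrite index_mem full.
  rewrite /f (set_nth_default l) // => /eqP; rewrite (nth_uniq _ (lt_i k) (lt_i l) (uniq_e A')) => /eqP eq_i.
  by rewrite -(nth_index k (full A k)) -/e1 eq_i nth_index // full.
exists (perm f_inj) => k; rewrite permE /f /e2 nth_cat /e1 index_cat mem_enum -!cardE -eqA.
have [Ak|Ak] := boolP (k \in A).
  have lt_k : (index k (enum A) < #|A|)%N by rewrite cardE index_mem mem_enum.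
  by rewrite lt_k -mem_enum mem_nth // -cardE -eqA.
rewrite ltnNge leq_addr /= addKn.
have : nth k (enum (~: A')%SET) (index k (enum (~: A)%SET)) \in enum (~: A')%SET.
  have cE : #|(~: A')%SET| = #|(~: A)%SET| by have := cardsC A; have := cardsC A'; rewrite eqA; lia.
  by apply: mem_nth; rewrite -cardE cE cardE index_mem mem_enum inE.
by rewrite mem_enum inE => /negbTE.
Qed.

Section UnitaryModel.
Variables (C : numClosedFieldType) (n : nat) (Np : {set 'I_n}).

Lemma PhiE i j : Phi C Np i j = (if i \in Np then 1 else -1) * (i == j)%:R.
Proof. by rewrite !mxE; case: eqP => [->|_]; rewrite ?mulr1n ?mulr0n ?mulr1 ?mulr0. Qed.

Lemma mul_Phi (A : 'M[C]_n) i j : (Phi C Np *m A) i j = (if i \in Np then 1 else -1) * A i j.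
Proof. by rewrite /Phi mul_diag_mx !mxE. Qed.

Lemma Phi_sqr : Phi C Np *m Phi C Np = 1%:M.
Proof.
apply/matrixP => i j; rewrite mul_Phi PhiE mxE mulrA.
by case: ifP => _; rewrite ?mulrNN !mul1r.
Qed.

Lemma Phi_tr : (Phi C Np)^T = Phi C Np.
Proof. exact: tr_diag_mx. Qed.

Lemma Phi_conj : map_mx Num.conj (Phi C Np) = Phi C Np.
Proof.
apply/matrixP => i j; rewrite mxE PhiE rmorphM rmorph_nat.
by case: ifP => _; rewrite ?rmorphN rmorph1.
Qed.

Lemma Phi_adj : adj (Phi C Np) = Phi C Np.
Proof. by rewrite /adj Phi_conj Phi_tr. Qed.

(** A permutation sends the positions in [sign_set 1 we n] to [N_+]. At a fixed
    point one takes the corresponding basis vector; for a pair [w k < k],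
    one takes the normalised difference and sum of the vector of [N_+] assigned
    to [k] and the vector of [N_-] assigned to [w k], which [delta] exchanges. *)
Lemma unitary_model we : is_signed_involution we -> #|sign_set 1 we n| = #|Np| ->
  exists B : 'M[C]_n, adj B *m B = 1%:M /\ Phi C Np *m B = B *m sign_mx C we.
Proof.
move=> wI /perm_of_card[s sE]; have lt_n (k : 'I_n) : (k < n)%N := ltn_ord k.
have {}sE k : (s k \in Np) = ((we.1 k == k) && (we.2 k == 1) || (we.1 k < k)%N).
  by rewrite sE inE lt_n.
pose r : C := (sqrtC 2)^-1.
have r2 : r * r = 2^-1 by rewrite -expr2 exprVn sqrtCK.
have rR : r^* = r by rewrite conj_Creal // realV ger0_real // sqrtC_ge0 ler0n.
pose sg k : C := if (we.1 k < k)%N then -1 else 1.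
pose a k : C := if we.1 k == k then 1 else r.
pose b k : C := if we.1 k == k then 0 else r * sg k.
have sgR k : (sg k)^* = sg k by rewrite /sg; case: ifP => _; rewrite ?rmorphN rmorph1.
have aR k : (a k)^* = a k by rewrite /a; case: eqP => _; rewrite ?conjC1.
have bR k : (b k)^* = b k by rewrite /b; case: eqP => _; rewrite ?conjC0 // rmorphM /= rR sgR.
pose Q j k : C := a k * (j == k)%:R + b k * (j == we.1 k)%:R.
pose B : 'M[C]_n := \matrix_(i, k) Q ((s^-1)%g i) k.
have sg_invol k : we.1 k != k -> sg (we.1 k) = - sg k.
  move=> ne; rewrite /sg invol_inv //.
  by case: (ltngtP (we.1 k) k) => [||/val_inj e]; rewrite ?opprK //; rewrite e eqxx in ne.
exists B; split; apply/matrixP => i k.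
  rewrite !mxE (reindex_inj (@perm_inj _ s)) /=.
  transitivity (\sum_j (Q j i)^* * Q j k).
    by apply: eq_bigr => j _; rewrite adjE !mxE permK.
  have QR j : (Q j i)^* = Q j i.
    by rewrite /Q rmorphD !rmorphM !rmorph_nat /= aR bR.
  transitivity (a i * Q i k + b i * Q (we.1 i) k).
    under eq_bigr do rewrite QR {1}/Q mulrDl.
    rewrite big_split /=; congr (_ + _).
      rewrite (bigD1 i) //= eqxx mulr1 big1 ?addr0 // => j /negbTE->.
      by rewrite mulr0 mul0r.
    rewrite (bigD1 (we.1 i)) //= eqxx mulr1 big1 ?addr0 // => j /negbTE->.
    by rewrite mulr0 mul0r.
  rewrite /Q (inj_eq perm_inj) [we.1 i == k]invol_eq // [i == we.1 k]eq_sym.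
  have [->|ne] := eqVneq i k.
    rewrite /a /b; case: eqP => [_|/eqP nk]; first by rewrite mulr1n !(mul0r, mulr0, addr0, mulr1).
    rewrite mulr0n mulr1n !mulr0 !mulr1 addr0 add0r mulrACA r2.
    have -> : sg k * sg k = 1 by rewrite /sg; case: ifP => _; rewrite ?mulrNN mulr1.
    by rewrite mulr1; field.
  rewrite !mulr0 addr0 add0r; case: eqP => [wk|_]; last by rewrite !mulr0 addr0.
  rewrite -wk in ne.
  rewrite -wk !mulr1 /a /b invol_inv // [k == _]eq_sym (negbTE ne) sg_invol //.
  by rewrite mulr0n; ring.
rewrite mul_Phi (mul_mx_sign wI) !mxE.
have -> : i = s ((s^-1)%g i) by rewrite permKV.
set j := (s^-1)%g i; rewrite sE permK /Q invol_inv //.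
rewrite /a /b invol_inv // /isign [k == we.1 k]eq_sym.
have [wk|ne] := eqVneq (we.1 k) k.
  rewrite !mul0r !addr0 !mul1r wk; case: (eqVneq j k) => [->|_]; last by rewrite mulr0 mul0r.
  case: wI => _ /(_ k); rewrite wk eqxx ltnn orbF => -[]->; rewrite ?eqxx ?mulr1 ?mul1r //.
rewrite mulr1 sg_invol //.
have [->|njk] := eqVneq j k.
  rewrite (negbTE ne) /= [k == _]eq_sym (negbTE ne) !mulr0 addr0 add0r !mulr1 /sg.
  by case: ifP => _; rewrite ?opprK ?mulr1 ?mul1r // mulN1r mulrN mulr1.
rewrite !mulr0 !add0r; have [->|nw] := eqVneq j (we.1 k); last by rewrite !mulr0 addr0.
rewrite invol_inv // [k == _]eq_sym (negbTE ne) /= !mulr1 addr0 /sg.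
by case: (ltngtP (we.1 k) k) => [||/val_inj e]; rewrite ?mulrN ?mulNr ?opprK ?mulr1 ?mul1r //;
  rewrite e eqxx in ne.
Qed.

End UnitaryModel.

(** * A flag with a conjugate and a dual basis of the same type *)

Section ConjugateDual.
Variables (C : numClosedFieldType) (n : nat).
Implicit Types (A B R Q T : 'M[C]_n).

(** The relation with [R] says that column [j] of [A] ends in row [w j], up to
    rows [w j'] with [j' < j]; the one with [Q] says that it starts there. The
    rows [w j'] themselves are excluded by orthogonality to earlier columns. *)
Lemma unitary_bruhat_monomial we A R Q : is_signed_involution we ->
    upper R -> R \in unitmx -> upper Q -> Q \in unitmx ->
    adj A = A -> A *m A = 1%:M ->
    R *m A = sign_mx C we *m R -> A = adj Q *m sign_mx C we *m Q ->
  forall i j, i != we.1 j -> A i j = 0.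
Proof.
move=> wI uR nR uQ nQ hA A2 RA AQ.
pose L := adj (invmx Q).
have LA : L *m A = sign_mx C we *m Q.
  by rewrite AQ /L adj_inv -mulmxA mulKmx ?adj_unit.
have uQi := upper_inv uQ nQ.
have L0 (i m : 'I_n) : (i < m)%N -> L i m = 0 by move=> lt; rewrite adjE uQi // conjC0.
have Lii i : L i i != 0.
  by rewrite adjE conjC_eq0 upper_diag_neq0 // unitmx_inv.
have Rii := upper_diag_neq0 uR nR.
have hAE := hermE hA.
suff H m (j : 'I_n) : (j < m)%N -> forall i, i != we.1 j -> A i j = 0.
  by move=> i j; apply: (H j.+1).
elim: m j => // m IHm j lt_jm.
have IH (j' : 'I_n) : (j' < j)%N -> forall i, i != we.1 j' -> A i j' = 0.
  by move=> lt; apply: IHm; apply: leq_trans lt _; rewrite -ltnS.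
have orth (j' : 'I_n) : (j' < j)%N -> A (we.1 j') j = 0.
  move=> lt; have nz : A j' (we.1 j') != 0.
    have [l] := unit_row_neq0 j' (involution_unit A2).
    have [->//|ne] := eqVneq l (we.1 j').
    by rewrite hAE IH // conjC0 eqxx.
  have /matrixP/(_ j' j) := A2; rewrite !mxE (bigD1 (we.1 j')) //= big1 => [|l ne].
    rewrite -val_eqE ltn_eqF // addr0 => /eqP.
    by rewrite mulf_eq0 (negbTE nz) => /eqP.
  by rewrite hAE IH // conjC0 mul0r.
have below d (i : 'I_n) : (n - i <= d)%N -> (we.1 j < i)%N -> A i j = 0.
  elim: d i => [|d IHd] i le_d lt_i; first by have := ltn_ord i; lia.
  have [lt_w|le_w] := ltnP (we.1 i) j; first by rewrite -(invol_inv wI i) orth.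
  have ne_w : we.1 i != j.
    by rewrite invol_eq // -val_eqE ltn_eqF.
  have /matrixP/(_ i j) := RA; rewrite mul_sign_mx (uR (we.1 i) j); last first.
    by rewrite ltn_neqAle eq_sym ne_w.
  rewrite mulr0 mxE (bigD1 i) //= big1 => [/eqP|l ne].
    by rewrite addr0 mulf_eq0 (negbTE (Rii i)) => /eqP.
  have [lt_li|lt_il|/val_inj eq_li] := ltngtP l i; last by rewrite eq_li eqxx in ne.
    by rewrite uR ?mul0r.
  rewrite IHd ?mulr0 //; last exact: ltn_trans lt_il.
  by have := ltn_ord l; lia.
have above d (i : 'I_n) : (i < d)%N -> (i < we.1 j)%N -> A i j = 0.
  elim: d i => // d IHd i lt_d lt_i.
  have [lt_w|le_w] := ltnP (we.1 i) j; first by rewrite -(invol_inv wI i) orth.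
  have ne_w : we.1 i != j.
    by rewrite invol_eq // -val_eqE gtn_eqF.
  have /matrixP/(_ i j) := LA; rewrite mul_sign_mx (uQ (we.1 i) j); last first.
    by rewrite ltn_neqAle eq_sym ne_w.
  rewrite mulr0 mxE (bigD1 i) //= big1 => [/eqP|l ne].
    by rewrite addr0 mulf_eq0 (negbTE (Lii i)) => /eqP.
  have [lt_li|lt_il|/val_inj eq_li] := ltngtP l i; last by rewrite eq_li eqxx in ne.
    by rewrite IHd ?mulr0 //; [lia | exact: ltn_trans lt_li lt_i].
  by rewrite L0 ?mul0r.
move=> i; rewrite neq_ltn => /orP[lt|lt]; last exact: (below (n - i)%N).
exact: (above i.+1).
Qed.

(** For a positive definite hermitian matrix the normal form has positive diagonal,
    so it is the identity: the reduction is Gram-Schmidt orthogonalisation. *)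
Lemma positive_normal_form B T we : B \in unitmx -> is_signed_involution we ->
  T \in unitmx -> adj T *m (adj B *m B) *m T = sign_mx C we -> adj (B *m T) *m (B *m T) = 1%:M.
Proof.
move=> nB wI nT; have -> : adj T *m (adj B *m B) *m T = adj (B *m T) *m (B *m T).
  by rewrite adjM !mulmxA.
move: (B *m T) (unitmx_mul B T) => U; rewrite nB nT => nU UE.
have pos k : 0 < sign_mx C we k k.
  have -> : sign_mx C we k k = (adj (col k U) *m col k U) 0 0.
    by rewrite -UE !mxE; apply: eq_bigr => i _; rewrite !mxE.
  apply: sqnorm_gt0; rewrite colE; apply/negP => /eqP.
  move=> /(congr1 (mulmx (invmx U))); rewrite mulKmx // mulmx0 => /colP/(_ k)/eqP.
  by rewrite !mxE eqxx oner_eq0.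
rewrite UE; apply/matrixP => k l; have := pos k; rewrite !mxE.
case: (we.1 k =P k) => [->|_]; last by rewrite ltxx.
case: (isignP wI k) => ->; last by rewrite rmorphN oppr_gt0 ltr10.
by case: eqP.
Qed.

Lemma hermitian_involution_norm A i l : adj A = A -> A *m A = 1%:M ->
  (forall m, m != l -> A i m = 0) -> `|A i l| = 1.
Proof.
move=> hA A2 A0; have /matrixP/(_ i i) := A2; rewrite !mxE (bigD1 l) //= big1.
  by rewrite addr0 eqxx [A l i](hermE hA) -normCK => /eqP; rewrite sqrp_eq1 // => /eqP.
by move=> m ne; rewrite A0 // mul0r.
Qed.

(** In the orthonormal basis [U] of the flag, [Phi] becomes a hermitian unitary
    matrix that is conjugate to [P] and congruent to [P] by upper triangular
    matrices, hence monomial. A unitary diagonal scaling turns it into a signed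
    permutation matrix, whose signs are those of [we] because upper triangular
    conjugation keeps the diagonal entries at the fixed points. *)
Lemma conj_dual_basis Np we (B1 B2 T : 'M[C]_n) (Ph := Phi C Np) : is_signed_involution we ->
    B1 \in unitmx -> B2 \in unitmx -> upper T -> B1 = B2 *m T ->
    Ph *m B1 = B1 *m sign_mx C we -> adj B2 *m Ph *m B2 = sign_mx C we ->
  exists R, [/\ upper R, R \in unitmx, Ph *m (B1 *m R) = B1 *m R *m sign_mx C we &
    adj (B1 *m R) *m Ph *m (B1 *m R) = sign_mx C we].
Proof.
move=> wI nB1 nB2 uT B12 cB1 dB2.
have nT : T \in unitmx by move: nB1; rewrite B12 unitmx_mul => /andP[].
have hB1 : adj (adj B1 *m B1) = adj B1 *m B1 by rewrite adjM adjK.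
have nB1' : adj B1 *m B1 \in unitmx by rewrite unitmx_mul adj_unit nB1.
have [R1 [we1 [uR1 nR1 w1I /(positive_normal_form nB1 w1I nR1)]]] := hermitian_normal_form hB1 nB1'.
set U := B1 *m R1 => UU.
have nU : U \in unitmx by rewrite unitmx_mul nB1.
have UU' : U *m adj U = 1%:M by exact: mulmx1C.
pose A := adj U *m Ph *m U.
have hA : adj A = A by apply: adj_congr; exact: Phi_adj.
have A2 : A *m A = 1%:M.
  have -> : A *m A = adj U *m (Ph *m (U *m adj U) *m Ph) *m U by rewrite /A !mulmxA.
  by rewrite UU' mulmx1 Phi_sqr mulmx1.
have UA : U *m A = Ph *m U by rewrite /A !mulmxA UU' mul1mx.
have RA : R1 *m A = sign_mx C we *m R1.
  apply: (can_inj (mulKmx nB1)); rewrite mulmxA -/U UA /U mulmxA cB1.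
  by rewrite mulmxA.
have AQ : A = adj (T *m R1) *m sign_mx C we *m (T *m R1).
  by rewrite -dB2 /A /U B12 !adjM !mulmxA.
have nQ : T *m R1 \in unitmx by rewrite unitmx_mul nT.
have Amono := unitary_bruhat_monomial wI uR1 nR1 (upperM uT uR1) nQ hA A2 RA AQ.
have nA := involution_unit A2.
have hAE := hermE hA.
have Arow k m : m != we.1 k -> A k m = 0.
  by move=> ne; rewrite hAE Amono ?conjC0 // -(inj_eq (@perm_inj _ we.1)) invol_inv // eq_sym.
have Anorm i j : A i j != 0 -> `|A i j| = 1.
  have [->|/Arow->] := eqVneq j (we.1 i); last by rewrite eqxx.
  by move=> _; apply: hermitian_involution_norm => // m; exact: Arow.
have [k|d [we2 [d0 w2I DAD w2A dN]]] := monomial_hermitian_scale hA nA.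
  by exists (we.1 k); exact: Arow.
have {}dN := dN Anorm.
set D := diag_mx d in DAD.
have nD : D \in unitmx by exact: diag_unit.
have DD : adj D *m D = 1%:M.
  apply/matrixP => i j; rewrite mul_mx_diag !mxE [j == i]eq_sym.
  case: (i =P j) => [_|_]; last by rewrite !mulr0n conjC0 mul0r.
  by rewrite !mulr1n mulrC -normCK dN expr1n.
have AD : A *m D = D *m sign_mx C we2.
  by rewrite -DAD -[adj D *m _ *m D]mulmxA mulmxA (mulmx1C DD) mul1mx.
have RD : R1 *m D *m sign_mx C we2 = sign_mx C we *m (R1 *m D).
  by rewrite -mulmxA -AD mulmxA RA mulmxA.
have uRD : upper (R1 *m D) by apply: upperM => //; exact: upper_diag.
have nRD : R1 *m D \in unitmx by rewrite unitmx_mul nR1.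
have we2E : we2 = we.
  have wE k : we2.1 k = we.1 k.
    by apply/eqP; apply: contraNT (w2A k) => /Arow->.
  case: (we) (we2) wI w2I RD wE => w e [w2 e2] wI' w2I' RD' /permP /= wE; subst w2.
  congr (_, _); apply/ffunP => k.
  case: (wI') (w2I') => _ /(_ k) /= ek [_ /(_ k) /= e2k].
  have [wk|ne] := eqVneq (w k) k; last by rewrite (negbTE ne) in ek e2k; rewrite ek e2k.
  have /matrixP/(_ k k) := RD'; rewrite mul_sign_mx (mul_mx_sign w2I').
  rewrite /isign /= wk eqxx mulrC => /eqP; rewrite -subr_eq0 -mulrBl mulf_eq0 => /orP[].
    by rewrite -rmorphB intr_eq0 subr_eq0 => /eqP.
  by rewrite (negbTE (upper_diag_neq0 uRD nRD k)).
exists (R1 *m D); split=> //.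
  rewrite mulmxA cB1 -!mulmxA; congr (_ *m _).
  by rewrite [RHS]mulmxA -RD we2E.
rewrite -we2E -DAD /A /U !adjM.
by rewrite !mulmxA.
Qed.

End ConjugateDual.

(** * Flags and upper triangular matrices *)

Section Flags.
Variables (C : numClosedFieldType) (n : nat).
Local Notation V := 'cV[C]_n.
Implicit Types (v : n.-tuple V) (B T : 'M[C]_n) (x : V).

Definition basis_mx v : 'M[C]_n := \matrix_(i, j) tnth v j i 0.
Definition mx_basis B : n.-tuple V := [tuple col j B | j < n].

Lemma basis_mxK : cancel basis_mx mx_basis.
Proof.
move=> v; apply: eq_from_tnth => j; rewrite tnth_mktuple.
by apply/colP => i; rewrite !mxE.
Qed.

Lemma mx_basis_nth B (i : nat) (lt_i : (i < n)%N) : (mx_basis B)`_i = col (Ordinal lt_i) B.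
Proof. by rewrite -(tnth_nth 0 (mx_basis B) (Ordinal lt_i)) tnth_mktuple. Qed.

Lemma mulmx_sum_col B x : B *m x = \sum_i x i 0 *: col i B.
Proof.
apply/colP => k; rewrite mxE summxE; apply: eq_bigr => i _.
by rewrite !mxE mulrC.
Qed.

Lemma dim_cV : \dim {:V} = n.
Proof. by rewrite dimvf /dim /= muln1. Qed.

Lemma mx_basis_is_basis B : is_basis (mx_basis B) <-> B \in unitmx.
Proof.
have nthE (i : 'I_n) : (mx_basis B)`_i = col i B by rewrite -tnth_nth tnth_mktuple.
split=> [/basis_free/freeP frB|nB].
  rewrite -unitmx_tr -row_free_unit -kermx_eq0; apply/rowV0P => u /sub_kermxP uB.
  have Bu : B *m u^T = 0 by rewrite -[B]trmxK -trmx_mul uB trmx0.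
  apply/rowP => i; rewrite [RHS]mxE.
  have := frB (fun i => u 0 i) _ i; apply; apply: etrans Bu; rewrite mulmx_sum_col.
  by apply: eq_bigr => j _; rewrite mxE nthE.
rewrite /is_basis basisEfree subvf size_tuple dim_cV leqnn !andbT.
apply/freeP => c; rewrite (eq_bigr (fun i => (\col_i c i) i 0 *: col i B)); last first.
  by move=> i _; rewrite mxE nthE.
rewrite -mulmx_sum_col => /(congr1 (mulmx (invmx B))); rewrite mulKmx // mulmx0.
by move=> /colP c0 i; have := c0 i; rewrite !mxE.
Qed.

Definition flag_mx B : flag C n := flag_of (mx_basis B).

Lemma invmx_col B i : B \in unitmx -> invmx B *m col i B = delta_mx i 0.
Proof. by move=> nB; rewrite colE mulKmx. Qed.

Lemma mem_flag_mx B (k : 'I_n.+1) x : B \in unitmx ->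
  x \in flag_mx B k <-> forall i : 'I_n, (k <= i)%N -> (invmx B *m x) i 0 = 0.
Proof.
move=> nB; rewrite ffunE; split=> [xk i le_ki|x0].
  rewrite (coord_span (X := in_tuple (take k (mx_basis B))) xk) mulmx_sumr summxE.
  apply: big1 => j _; have := ltn_ord j; rewrite {2}size_take size_tuple => lt_j.
  have {}lt_j : (j < k)%N by move: lt_j; case: ifP => // /negbT; rewrite -leqNgt => le lt; apply: leq_trans lt le.
  have lt_jn : (j < n)%N by apply: leq_trans lt_j _; rewrite -ltnS.
  rewrite /= nth_take // mx_basis_nth -scalemxAr invmx_col // !mxE andbT.
  by rewrite -val_eqE gtn_eqF ?mulr0 //; apply: leq_trans lt_j le_ki.
rewrite -(mulKVmx nB x) mulmx_sum_col; apply: memv_suml => i _.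
have [le_ki|lt_ik] := leqP k i; first by rewrite x0 // scale0r mem0v.
apply/memvZ/memv_span; have -> : col i B = nth 0 (take k (mx_basis B)) i.
  by rewrite nth_take // -tnth_nth tnth_mktuple.
by rewrite mem_nth // size_takel // size_tuple -ltnS.
Qed.

Lemma flag_mx_col B (k : 'I_n.+1) (i : 'I_n) : B \in unitmx -> (i < k)%N ->
  col i B \in flag_mx B k.
Proof.
move=> nB lt_ik; apply/mem_flag_mx => // j le_kj.
by rewrite invmx_col // mxE -val_eqE gtn_eqF // (leq_trans lt_ik).
Qed.

Lemma flag_mx_upper B T : B \in unitmx -> T \in unitmx -> upper T ->
  flag_mx (B *m T) = flag_mx B.
Proof.
move=> nB nT uT; have nBT : B *m T \in unitmx by rewrite unitmx_mul nB.
apply/ffunP => k; apply/vspaceP => x.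
have iBT : invmx B *m x = T *m (invmx (B *m T) *m x).
  apply: (can_inj (mulKmx nB)).
  by rewrite mulKVmx // mulmxA mulKVmx.
apply/idP/idP => /mem_flag_mx xk; apply/mem_flag_mx => // i.
  by rewrite iBT; apply: upper_support => // m; exact: xk.
have -> : invmx (B *m T) *m x = invmx T *m (invmx B *m x) by rewrite iBT mulKmx.
by apply: upper_support; [exact: upper_inv | exact: xk].
Qed.

Lemma flag_mx_eq B B' : B \in unitmx -> B' \in unitmx -> flag_mx B = flag_mx B' ->
  exists T, [/\ upper T, T \in unitmx & B = B' *m T].
Proof.
move=> nB nB' eqF; exists (invmx B' *m B); split.
- move=> i j lt_ji; have lt_j := ltn_ord j.
  pose k := Ordinal (lt_j : (j.+1 < n.+1)%N).
  have : col j B \in flag_mx B' k by rewrite -eqF flag_mx_col.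
  by move/(mem_flag_mx k _ nB')/(_ i lt_ji); rewrite colE mulmxA -colE mxE.
- by rewrite unitmx_mul unitmx_inv nB'.
- by rewrite mulKVmx.
Qed.

Lemma act_flag_mx (g B : 'M[C]_n) : act_flag g (flag_mx B) = flag_mx (g *m B).
Proof.
apply/ffunP => k; rewrite !ffunE limg_span map_take; congr (<< take k _ >>)%VS.
apply: (@eq_from_nth _ 0); rewrite size_map !size_tuple // => i lt_i.
rewrite (nth_map 0) ?size_tuple // !mx_basis_nth lfunE /=.
by rewrite !colE mulmxA.
Qed.

Lemma flag_mx_flags B : B \in unitmx -> flags (flag_mx B).
Proof.
move=> nB; split=> [k|k l le_kl].
  rewrite ffunE; have frB : free (mx_basis B) by apply/basis_free/mx_basis_is_basis.
  have : free (take k (mx_basis B)).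
    by move: frB; rewrite -{1}(cat_take_drop k (mx_basis B)) => /catl_free.
  by rewrite /free => /eqP->; rewrite size_takel // size_tuple -ltnS.
apply/subvP => x /mem_flag_mx xk; apply/mem_flag_mx => // i le_li.
by apply: xk => //; apply: leq_trans le_kl le_li.
Qed.

Lemma flags_flag_mx (F : flag C n) : flags F -> exists2 B, B \in unitmx & flag_mx B = F.
Proof.
move=> [dimF monoF].
have step (j : 'I_n) : exists x : V, x \in F (lift ord0 j) /\ x \notin F (widen_ord (leqnSn n) j).
  have : ~~ (F (lift ord0 j) <= F (widen_ord (leqnSn n) j))%VS.
    by apply/negP => /dimvS; rewrite !dimF /= /bump leq0n add1n ltnn.
  by case/subvPn => x xF xnF; exists x.
have [b bF] := choice step.
pose B : 'M[C]_n := \matrix_(i, j) b j i 0.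
have colB j : col j B = b j by apply/colP => i; rewrite !mxE.
have spanF (k : 'I_n.+1) : <<take k (mx_basis B)>>%VS = F k.
  case: k => k; elim: k => [|k IHk] lt_k.
    rewrite take0 span_nil; apply/esym/eqP; rewrite -dimv_eq0 dimF.
    by [].
  have lt_kn : (k < n)%N by [].
  rewrite (take_nth 0) ?size_tuple // mx_basis_nth colB.
  have IH := IHk (ltnW lt_k : (k < n.+1)%N); rewrite /= in IH.
  rewrite -cats1 span_cat /= IH span_seq1.
  have [bk nbk] := bF (Ordinal lt_kn).
  have E1 : lift ord0 (Ordinal lt_kn) = Ordinal lt_k by apply: val_inj.
  have E2 : widen_ord (leqnSn n) (Ordinal lt_kn) = Ordinal (ltnW lt_k : (k < n.+1)%N) by apply: val_inj.
  rewrite E1 in bk; rewrite E2 in nbk.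
  apply/eqP; rewrite eqEdim; apply/andP; split.
    by rewrite subv_add monoF ?leqnSn //= -memvE.
  rewrite dimF /= ltnNge; apply: contra nbk => le_dim.
  have eqF : F (Ordinal (ltnW lt_k : (k < n.+1)%N)) =
      (F (Ordinal (ltnW lt_k : (k < n.+1)%N)) + <[b (Ordinal lt_kn)]>)%VS.
    by apply/eqP; rewrite eqEdim addvSl dimF.
  by rewrite eqF memvE addvSr.
exists B; last by apply/ffunP => k; rewrite ffunE spanF.
apply/mx_basis_is_basis; rewrite /is_basis basisEdim size_tuple dim_cV leqnn andbT.
have := spanF ord_max; rewrite take_oversize ?size_tuple // => ->.
have /eqP -> : F ord_max == fullv by rewrite eqEdim subvf dimF dim_cV /=.
exact: subvv.
Qed.

End Flags.

(** * The signed involution attached to a flag *)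

Section Uniqueness.
Variables (C : numClosedFieldType) (n : nat) (Np : {set 'I_n}).
Implicit Types (we : signed_perm n) (B T : 'M[C]_n).
Notation Ph := (Phi C Np).

Definition conj_mx we B : Prop := Ph *m B = B *m sign_mx C we.
Definition dual_mx we B : Prop := adj B *m Ph *m B = sign_mx C we.

Lemma conj_dual_comparison we we' B B' T :
    conj_mx we B -> dual_mx we' B' -> B = B' *m T ->
  adj B *m B = adj T *m sign_mx C we' *m T *m sign_mx C we.
Proof.
move=> cB dB BT; have -> : adj B *m B = adj B *m Ph *m (Ph *m B).
  by rewrite mulmxA -[adj B *m Ph *m Ph]mulmxA Phi_sqr mulmx1.
by rewrite cB -dB BT adjM !mulmxA.
Qed.

Lemma conj_dual_dominated we we' B B' :
    is_signed_involution we -> is_signed_involution we' ->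
    B \in unitmx -> B' \in unitmx -> conj_mx we B -> dual_mx we' B' ->
    flag_mx B = flag_mx B' ->
  dominated we we' /\ (forall s i, s = 1 \/ s = -1 ->
    (#|sign_set s we i| <= #|sign_set s we' i|)%N).
Proof.
move=> wI wI' nB nB' cB dB /(flag_mx_eq nB nB')[T [uT nT BT]].
have cmp := conj_dual_comparison cB dB BT.
have le_s s i : s = 1 \/ s = -1 -> (#|sign_set s we i| <= #|sign_set s we' i|)%N.
  by apply: (sign_set_le _ _ _ _ cmp).
split=> //; split=> [i j|i]; first exact: (rank_set_le wI uT nB cmp).
by apply: le_s; left.
Qed.

Lemma invol_balanced we : is_signed_involution we ->
  (\sum_(k < n) (k < we.1 k) = \sum_(k < n) (we.1 k < k))%N.
Proof.
move=> wI; rewrite (reindex_inj (@perm_inj _ we.1)) /=.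
by apply: eq_bigr => k _; rewrite invol_inv.
Qed.

Lemma sign_set_card s we :
  #|sign_set s we n| = (\sum_(k < n) ((we.1 k == k) && (we.2 k == s) || (we.1 k < k)))%N.
Proof.
rewrite -sum1_card big_mkcond /=; apply: eq_bigr => k _.
by rewrite inE ltn_ord /=; case: (_ || _).
Qed.

Lemma sign_set_total we : is_signed_involution we ->
  (#|sign_set 1 we n| + #|sign_set (-1) we n|)%N = n.
Proof.
move=> wI; rewrite !sign_set_card -big_split /=.
apply/eqP; rewrite -(eqn_add2r (\sum_(k < n) (k < we.1 k))%N) {2}invol_balanced //.
rewrite -[X in (_ == X + _)%N](card_ord n) -sum1_card -!big_split /=; apply/eqP.
apply: eq_bigr => k _; case: wI => _ /(_ k).
have [wk|ne _] := eqVneq (we.1 k) k; first by case=> ->; rewrite wk ltnn.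
by case: (ltngtP (we.1 k) k) => // /val_inj eqk; rewrite eqk eqxx in ne.
Qed.

(** The traces of [Phi] and of the conjugate matrix [sign_mx we] agree, and the
    pairs do not contribute to the latter. *)
Lemma conj_card we B : is_signed_involution we -> B \in unitmx -> conj_mx we B ->
  #|sign_set 1 we n| = #|Np|.
Proof.
move=> wI nB cB; have trE : \tr Ph = \tr (sign_mx C we).
  by rewrite -[Ph](mulmxK nB) cB mxtrace_mulC mulmxA mulVmx // mul1mx.
have nE : n%:R = \sum_(k < n) 1 :> C by rewrite sumr_const card_ord.
have PhE : \tr Ph + n%:R = (2 * #|Np|)%:R.
  have -> : #|Np| = (\sum_(k < n) (k \in Np))%N.
    by rewrite -sum1_card big_mkcond; apply: eq_bigr => k _; case: (k \in Np).
  rewrite nE -big_split natrM natr_sum mulr_sumr; apply: eq_bigr => k _ /=.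
  by rewrite PhiE eqxx mulr1; case: ifP => _; rewrite ?mulr1 // addNr mulr0.
have sgE : \tr (sign_mx C we) + n%:R = (2 * #|sign_set 1 we n|)%:R.
  apply: (addIr (\sum_(k < n) (we.1 k < k))%:R); rewrite -[in RHS]invol_balanced // sign_set_card.
  rewrite nE natrM !natr_sum mulr_sumr -!big_split /=; apply: eq_bigr => k _.
  rewrite mxE /isign; case: wI => _ /(_ k).
  have [wk|ne _] := eqVneq (we.1 k) k.
    by rewrite wk ltnn orbF => -[->|->]; rewrite /= ?mulr1 ?mulr0 ?addr0 ?addNr.
  case: (ltngtP (we.1 k) k) => [lt|lt|/val_inj eqk]; last by rewrite eqk eqxx in ne.
    by rewrite /= mulr1 add0r addr0; ring.
  by rewrite /= mulr0 add0r addr0.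
by apply/eqP; rewrite -(eqn_pmul2l (isT : 0 < 2)%N) -(eqr_nat C) -PhE -sgE trE.
Qed.

Lemma conj_exists B : B \in unitmx ->
  exists T we, [/\ upper T, T \in unitmx, is_signed_involution we & conj_mx we (B *m T)].
Proof.
move=> nB; have A2 : (invmx B *m Ph *m B) *m (invmx B *m Ph *m B) = 1%:M.
  have -> : invmx B *m Ph *m B *m (invmx B *m Ph *m B)
     = invmx B *m (Ph *m (B *m invmx B) *m Ph) *m B by rewrite !mulmxA.
  by rewrite mulmxV // mulmx1 Phi_sqr mulmx1 mulVmx.
have [T [we [uT nT wI AT]]] := involution_normal_form A2.
exists T, we; split=> //; rewrite /conj_mx -[in RHS]mulmxA -AT.
by rewrite !mulmxA mulmxV // mul1mx.
Qed.

Lemma dual_exists B : B \in unitmx ->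
  exists T we, [/\ upper T, T \in unitmx, is_signed_involution we & dual_mx we (B *m T)].
Proof.
move=> nB; have nPh : Ph \in unitmx by exact: involution_unit (Phi_sqr C Np).
have [T [we [uT nT wI HT]]] :=
  hermitian_normal_form (adj_congr B (Phi_adj C Np)) (congr_unit nPh nB).
exists T, we; split=> //; rewrite /dual_mx -HT adjM.
by rewrite !mulmxA.
Qed.

(** A conjugate basis of the same flag bounds both the positive and the negative
    counts from below, and the two counts always add up to [n]. *)
Lemma dual_card we B : is_signed_involution we -> B \in unitmx -> dual_mx we B ->
  #|sign_set 1 we n| = #|Np|.
Proof.
move=> wI nB dB; have [T [we0 [uT nT w0I cBT]]] := conj_exists nB.
have nBT : B *m T \in unitmx by rewrite unitmx_mul nB.
have [_ le_s] := conj_dual_dominated w0I wI nBT nB cBT dB (flag_mx_upper nB nT uT).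
have tot : (#|sign_set 1 we0 n| + #|sign_set (-1) we0 n|
    = #|sign_set 1 we n| + #|sign_set (-1) we n|)%N by rewrite !sign_set_total.
have [<- _] := leq_add_eq (le_s 1 n (or_introl erefl)) (le_s (-1) n (or_intror erefl)) tot.
exact: conj_card cBT.
Qed.

Lemma unitary_conj_dual we B : adj B *m B = 1%:M -> conj_mx we B -> dual_mx we B.
Proof. by move=> BB cB; rewrite /dual_mx -mulmxA cB mulmxA BB mul1mx. Qed.

(** Linear maps commuting with [Phi] move the flag to one that also has a dual
    basis of type [we2]; so [we1] is dominated by [we2], and conversely. *)
Lemma conj_unique we1 we2 B1 B2 :
    is_signed_involution we1 -> is_signed_involution we2 -> B1 \in unitmx -> B2 \in unitmx ->
    conj_mx we1 B1 -> conj_mx we2 B2 -> flag_mx B1 = flag_mx B2 ->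
  we1 = we2.
Proof.
suff H we we' B B' : is_signed_involution we -> is_signed_involution we' ->
    B \in unitmx -> B' \in unitmx -> conj_mx we B -> conj_mx we' B' ->
    flag_mx B = flag_mx B' -> dominated we we'.
  move=> wI1 wI2 nB1 nB2 cB1 cB2 eqF; apply: dominated_anti => //.
    exact: H wI1 wI2 nB1 nB2 cB1 cB2 eqF.
  exact: H wI2 wI1 nB2 nB1 cB2 cB1 (esym eqF).
move=> wI wI' nB nB' cB cB' eqF.
have [U [UU cU]] := unitary_model C wI' (conj_card wI' nB' cB').
have nU : U \in unitmx by case/mulmx1_unit: UU.
have cg : conj_mx we (U *m invmx B' *m B).
  rewrite /conj_mx !mulmxA cU -(mulmxA U) -[in RHS]mulmxA -[in RHS]cB.
  have -> : sign_mx C we' *m invmx B' = invmx B' *m Ph.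
    by apply: (can_inj (mulmxK nB')); rewrite mulmxKV // -mulmxA cB' mulKmx.
  by rewrite !mulmxA.
have nUB : U *m invmx B' *m B \in unitmx by rewrite !unitmx_mul nU unitmx_inv nB'.
have [] // := conj_dual_dominated wI wI' nUB nU cg (unitary_conj_dual UU cU).
by rewrite -act_flag_mx eqF act_flag_mx mulmxKV.
Qed.

(** Here isometries of [phi] move the flag to one with a conjugate basis of
    type [we1]. *)
Lemma dual_unique we1 we2 B1 B2 :
    is_signed_involution we1 -> is_signed_involution we2 -> B1 \in unitmx -> B2 \in unitmx ->
    dual_mx we1 B1 -> dual_mx we2 B2 -> flag_mx B1 = flag_mx B2 ->
  we1 = we2.
Proof.
suff H we we' B B' : is_signed_involution we -> is_signed_involution we' ->
    B \in unitmx -> B' \in unitmx -> dual_mx we B -> dual_mx we' B' ->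
    flag_mx B = flag_mx B' -> dominated we we'.
  move=> wI1 wI2 nB1 nB2 cB1 cB2 eqF; apply: dominated_anti => //.
    exact: H wI1 wI2 nB1 nB2 cB1 cB2 eqF.
  exact: H wI2 wI1 nB2 nB1 cB2 cB1 (esym eqF).
move=> wI wI' nB nB' dB dB' eqF.
have [U [UU cU]] := unitary_model C wI (dual_card wI nB dB).
have nU : U \in unitmx by case/mulmx1_unit: UU.
have dU := unitary_conj_dual UU cU.
have dg : dual_mx we' (U *m invmx B *m B').
  have gPg : adj (U *m invmx B) *m Ph *m (U *m invmx B) = Ph.
    have -> : adj (U *m invmx B) *m Ph *m (U *m invmx B)
      = adj (invmx B) *m (adj U *m Ph *m U) *m invmx B by rewrite adjM !mulmxA.
    by rewrite dU -dB adj_inv !mulmxA mulVmx ?adj_unit // mul1mx mulmxK.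
  rewrite /dual_mx -dB' -[in RHS]gPg adjM.
  by rewrite !mulmxA.
have nUB : U *m invmx B *m B' \in unitmx by rewrite !unitmx_mul nU unitmx_inv nB.
have [] // := conj_dual_dominated wI wI' nU nUB cU dg.
by rewrite -act_flag_mx -eqF act_flag_mx mulmxKV.
Qed.

End Uniqueness.

(** * The bilinear form and the symmetry of the signed involution *)

Lemma epsilon_sqr t : epsilon t * epsilon t = 1.
Proof. by case: t. Qed.

Lemma eta_sqr t : eta t * eta t = 1.
Proof. by case: t. Qed.

Section FormMatrix.
Variable C : numClosedFieldType.

Record form_facts (t : form_type) n (Om : 'M[C]_n) : Prop := FormFacts {
  ff_tr : Om^T = (epsilon t)%:~R *: Om;
  ff_sqr : Om *m Om = ((epsilon t)%:~R)%:M;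
  ff_conj : map_mx Num.conj Om = Om;
  ff_entries : forall i j, Om i j = 0 \/ Om i j * Om i j = 1 }.

Lemma form_block_facts t (b : bool) : (epsilon t = -1 -> b) ->
  form_facts t (form_block C t b).
Proof.
move=> tb; case: b tb => tb.
  split; [apply/matrixP => i j|apply/matrixP => i j|apply/matrixP => i j|move=> i j].
  - rewrite !mxE; case: i => -[|[|//]] ?; case: j => -[|[|//]] ?; rewrite /= ?mulr0 ?mulr1 //.
    by rewrite -intrM epsilon_sqr.
  - rewrite !mxE 2!big_ord_recl big_ord0 !mxE.
    by case: i => -[|[|//]] ?; case: j => -[|[|//]] ? /=;
      rewrite ?(mulr0, mul0r, mulr1, mul1r, addr0, add0r).
  - rewrite !mxE; case: (i < j)%N; first by rewrite conjC1.
    by case: (j < i)%N; rewrite ?rmorph_int ?conjC0.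
  - rewrite mxE; case: (i < j)%N; first by right; rewrite mulr1.
    by case: (j < i)%N; [right; rewrite -intrM epsilon_sqr | left].
have e1 : epsilon t = 1 by case: t tb => //= /(_ erefl).
split; [apply/matrixP => i j|apply/matrixP => i j|apply/matrixP => i j|move=> i j].
- by rewrite !mxE e1 mulr1.
- by rewrite !mxE big_ord1 !mxE mulr1 !ord1 e1.
- by rewrite !mxE conjC1.
- by rewrite mxE mulr1; right.
Qed.

Lemma mxdiag_mul m (p : 'I_m -> nat) (D E : forall i, 'M[C]_(p i)) :
  \mxdiag_i D i *m \mxdiag_i E i = \mxdiag_i (D i *m E i).
Proof.
rewrite [in X in _ *m X]/mxdiag mul_mxdiag_mxblock; apply/eq_mxblock => i j.
by case: eqVneq => [->|]; rewrite ?conform_mx_id ?mulmx0.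
Qed.

Lemma is_form_matrix_facts t n (Om : 'M[C]_n) : is_form_matrix t Om -> form_facts t Om.
Proof.
case=> m [b [en [tb ->]]]; case: _ / en; rewrite castmx_id.
have bF i := form_block_facts (tb^~ i).
split.
- have [e1|eN] : epsilon t = 1 \/ epsilon t = -1 by case: (t); auto.
    rewrite tr_mxdiag e1 scale1r; apply/eq_mxdiag => i.
    by rewrite (ff_tr (bF i)) e1 scale1r.
  rewrite tr_mxdiag eN rmorphN scaleN1r -mxdiagN; apply/eq_mxdiag => i.
  by rewrite (ff_tr (bF i)) eN rmorphN scaleN1r.
- rewrite mxdiag_mul -mxdiagZ; apply/eq_mxdiag => i; exact: ff_sqr (bF i).
- apply/matrixP => i j; rewrite !mxE.
  case: eqVneq => [e|_]; last by rewrite mxE conjC0.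
  case: _ / e (tagnat.sig2 j) => k; rewrite conform_mx_id.
  by have /matrixP/(_ (tagnat.sig2 i) k) := ff_conj (bF (tagnat.sig1 i)); rewrite mxE.
- move=> i j; rewrite !mxE; case: eqVneq => [e|_]; last by left; rewrite mxE.
  case: _ / e (tagnat.sig2 j) => k; rewrite conform_mx_id.
  exact: ff_entries (bF _) _ _.
Qed.

(** An alternating form in odd dimension is degenerate. *)
Lemma mid_epsilon t n (Om : 'M[C]_n) (k : 'I_n) : form_facts t Om -> rev_ord k = k -> epsilon t = 1.
Proof.
move=> fO krev; have [//|eN] : epsilon t = 1 \/ epsilon t = -1 by case: (t); auto.
have odd_n : odd n by have := congr1 val krev; rewrite /=; have := ltn_ord k; lia.
have nO : Om \in unitmx.
  have : ((epsilon t)%:~R *: Om) *m Om = 1%:M.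
    by rewrite -scalemxAl (ff_sqr fO) scale_scalar_mx -intrM epsilon_sqr.
  by case/mulmx1_unit.
move: nO; rewrite unitmxE unitfE; case/eqP.
have := congr1 determinant (ff_tr fO); rewrite det_tr eN detZ rmorphN /= -signr_odd odd_n.
rewrite expr1 mulN1r => /eqP; rewrite -addr_eq0 -mulr2n -mulr_natr mulf_eq0 pnatr_eq0 orbF.
by move/eqP.
Qed.

(** The rows of [Om] have length [1] and entries of modulus [0] or [1], so each
    has a single nonzero entry, at the dual index. *)
Lemma compatible_comm t n (Om : 'M[C]_n) (Np : {set 'I_n}) :
  form_facts t Om -> is_compatible t Om Np ->
  Phi C Np *m Om *m Phi C Np = (eta t)%:~R *: Om.
Proof.
move=> fO cN.
have omE l l' : omega Om (basis_vec C l) (basis_vec C l') = Om l l'.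
  by rewrite /omega /basis_vec trmx_delta -rowE -colE !mxE.
have one_nz l l' l'' : Om l l' != 0 -> Om l l'' != 0 -> l' = l''.
  move=> nz' nz''; apply/eqP/negPn/negP => ne.
  have sq m : Om l m * Om l m >= 0.
    by case: (ff_entries fO l m) => [->|->]; rewrite ?mulr0 ?ler01.
  have sq1 m : Om l m != 0 -> Om l m * Om l m = 1.
    by case: (ff_entries fO l m) => [->|->//]; rewrite eqxx.
  have : (Om *m Om^T) l l = 1.
    by rewrite (ff_tr fO) -scalemxAr (ff_sqr fO) scale_scalar_mx -intrM epsilon_sqr mxE eqxx.
  rewrite mxE (bigD1 l') //= (bigD1 l'') /=; last by rewrite eq_sym.
  rewrite !mxE !sq1 // => sum1.
  have : 0 < 1 + \sum_(i < n | (i != l') && (i != l'')) Om l i * (Om^T) i l.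
    by rewrite ltr_pwDl // sumr_ge0 // => m _; rewrite mxE.
  have -> : 1 + \sum_(i < n | (i != l') && (i != l'')) Om l i * (Om^T) i l = 0.
    by apply: (addrI 1); rewrite addr0.
  by rewrite ltxx.
have dualE l l' : Om l l' != 0 -> dual_index Om l = l'.
  move=> nz; rewrite /dual_index; case: pickP => [m|/(_ l')] /=; rewrite omE.
    by move=> nzm; apply: one_nz nz.
  by rewrite nz.
apply/matrixP => i j; rewrite /Phi mul_mx_diag mul_diag_mx !mxE.
have [->|nz] := eqVneq (Om i j) 0; first by rewrite !(mulr0, mul0r).
move: cN; have := dualE _ _ nz; rewrite /is_compatible.
case: (t) => ej cN; have {cN} := cN i; rewrite ej ?inE.
all: case: (i \in Np); case: (j \in Np) => -[c1 c2] /=;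
   rewrite ?rmorphN ?rmorph1 ?mulN1r ?mulrN1 ?mul1r ?mulr1 ?opprK //.
all: by [have := c1 isT | have := c2 isT].
Qed.

Lemma form_pair_Phi t n (Om : 'M[C]_n) Np : form_facts t Om -> is_compatible t Om Np ->
  form_pair ((epsilon t)%:~R) ((eta t)%:~R) (Phi C Np) Om.
Proof.
move=> fO cN; split; [exact: ff_tr fO | exact: ff_sqr fO | exact: ff_conj fO | | | |].
- exact: compatible_comm.
- exact: Phi_tr.
- exact: Phi_sqr.
- exact: Phi_conj.
Qed.

Lemma form_pair_sign t n (we : signed_perm n) : is_symmetric t we ->
    (forall k : 'I_n, rev_ord k = k -> epsilon t = 1) ->
  form_pair ((epsilon t)%:~R) ((eta t)%:~R) (sign_mx C we) (omega_mx C t we).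
Proof.
move=> wS mid; have [wI _ _ _] := wS; split.
- exact: omega_mx_tr.
- exact: omega_mx_sqr.
- exact: omega_mx_conj.
- exact: omega_mx_sign.
- exact: sign_mx_tr.
- exact: sign_mx_sqr.
- exact: sign_mx_conj.
Qed.

End FormMatrix.

Section Reversal.
Variables (C : numClosedFieldType) (n : nat) (t : form_type) (Np : {set 'I_n}).
Implicit Types (we : signed_perm n) (B S : 'M[C]_n).

(** The type of the bases dual with respect to [omega] to bases of type [we]. *)
Definition rev_signed we : signed_perm n :=
  ((w0 n * we.1 * w0 n)%g,
   [ffun k => if we.1 (rev_ord k) == rev_ord k then eta t * we.2 (rev_ord k) else 0]).

Lemma rev_signedE we k : (rev_signed we).1 k = rev_ord (we.1 (rev_ord k)).
Proof. by rewrite /= !permM !permE. Qed.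

Lemma rev_signed_fix we k : ((rev_signed we).1 k == k) = (we.1 (rev_ord k) == rev_ord k).
Proof. by rewrite rev_signedE -{2}(rev_ordK k) (inj_eq rev_ord_inj). Qed.

Lemma rev_signed_invol we : is_signed_involution we -> is_signed_involution (rev_signed we).
Proof.
move=> wI; split=> k; first by rewrite !rev_signedE rev_ordK invol_inv // rev_ordK.
rewrite rev_signed_fix ffunE; case: wI => _ /(_ (rev_ord k)).
by case: ifP => // _; case: (t) => -[] ->; auto.
Qed.

Definition rev_mx : 'M[C]_n := \matrix_(i, j) (j == rev_ord i)%:R.

Lemma mul_rev_mx (A : 'M[C]_n) i j : (rev_mx *m A) i j = A (rev_ord i) j.
Proof.
rewrite mxE (bigD1 (rev_ord i)) //= mxE eqxx mul1r big1 ?addr0 // => m ne.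
by rewrite mxE (negbTE ne) mul0r.
Qed.

Lemma rev_mx_tr : rev_mx^T = rev_mx.
Proof. by apply/matrixP => i j; rewrite !mxE -(inj_eq rev_ord_inj) rev_ordK eq_sym. Qed.

Lemma mul_mx_rev (A : 'M[C]_n) i j : (A *m rev_mx) i j = A i (rev_ord j).
Proof.
have -> : (A *m rev_mx) i j = (A *m rev_mx)^T j i by rewrite [RHS]mxE.
by rewrite trmx_mul rev_mx_tr mul_rev_mx mxE.
Qed.

Lemma rev_mx_sqr : rev_mx *m rev_mx = 1%:M.
Proof. by apply/matrixP => i j; rewrite mul_rev_mx !mxE rev_ordK eq_sym. Qed.

Lemma rev_mx_adj : adj rev_mx = rev_mx.
Proof. by rewrite -[RHS]rev_mx_tr; apply/matrixP => i j; rewrite adjE !mxE rmorph_nat. Qed.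

(** The signs [eta] of the pairs are absorbed by one vector of each pair. *)
Lemma rev_signed_mx we : is_signed_involution we -> exists D : 'M[C]_n,
  [/\ upper D, D *m D = 1%:M, adj D = D &
  D *m sign_mx C (rev_signed we) *m D = (eta t)%:~R *: (rev_mx *m sign_mx C we *m rev_mx)].
Proof.
move=> wI; have rI := rev_signed_invol wI.
pose d k : C := if ((rev_signed we).1 k < k)%N then (eta t)%:~R else 1.
exists (diag_mx (\row_k d k)); split.
- exact: upper_diag.
- apply/matrixP => i j; rewrite mul_mx_diag !mxE.
  case: eqP => [->|_]; last by rewrite !mulr0n mul0r.
  by rewrite !mulr1n /d; case: ifP => _; rewrite ?mulr1 // -intrM eta_sqr.
- apply/matrixP => i j; rewrite adjE !mxE eq_sym; case: eqP => [->|_]; rewrite ?mulr0n ?conjC0 //.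
  by rewrite !mulr1n /d; case: ifP => _; rewrite ?rmorph_int ?conjC1.
apply/matrixP => i j; rewrite [RHS]mxE mul_mx_rev mul_rev_mx mul_mx_diag mul_diag_mx !mxE.
rewrite rev_signedE; have -> : (rev_ord (we.1 (rev_ord i)) == j) = (we.1 (rev_ord i) == rev_ord j).
  by rewrite -{1}(rev_ordK j) (inj_eq rev_ord_inj).
case: eqP => [eij|_]; last by rewrite !(mulr0, mul0r).
have ej : (rev_signed we).1 i = j by rewrite rev_signedE eij rev_ordK.
rewrite /d ej -{2}ej invol_inv // /isign rev_signed_fix ffunE.
have [wi|ne] := eqVneq (we.1 (rev_ord i)) (rev_ord i).
  have -> : j = i by apply: rev_ord_inj; rewrite -eij wi.
  by rewrite ltnn mul1r mulr1 intrM.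
rewrite !mulr1; have : i != j.
  by apply: contraNneq ne => eq_ij; rewrite eij eq_ij.
by case: (ltngtP j i) => [||/val_inj->]; rewrite ?mulr1 ?mul1r // eqxx.
Qed.

End Reversal.

(** * Isotropic flags have symmetric signed involutions *)

Section SymmetricFlags.
Variables (C : numClosedFieldType) (n : nat) (t : form_type).
Variables (Om : 'M[C]_n) (Np : {set 'I_n}).
Hypotheses (fO : form_facts t Om) (cN : is_compatible t Om Np).
Notation Ph := (Phi C Np).
Notation e := ((epsilon t)%:~R : C).
Notation h := ((eta t)%:~R : C).

Lemma e_sqr : e * e = 1. Proof. by rewrite -intrM epsilon_sqr. Qed.
Lemma h_sqr : h * h = 1. Proof. by rewrite -intrM eta_sqr. Qed.

Lemma Om_unit : Om \in unitmx.
Proof.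
have : (e *: Om) *m Om = 1%:M by rewrite -scalemxAl (ff_sqr fO) scale_scalar_mx e_sqr.
by case/mulmx1_unit.
Qed.

Variables (we : signed_perm n) (B : 'M[C]_n).
Hypotheses (wI : is_signed_involution we) (nB : B \in unitmx).
Let S := B^T *m Om *m B.
Hypothesis S0 : forall k l : 'I_n, (l < rev_ord k)%N -> S k l = 0.
Let Y := rev_mx C n *m S.
Let fP := form_pair_Phi fO cN.

Lemma gram_unit : S \in unitmx.
Proof. by rewrite !unitmx_mul unitmx_tr nB Om_unit. Qed.

Lemma rev_gram_upper : upper Y.
Proof. by move=> i j lt_ji; rewrite mul_rev_mx S0 // rev_ordK. Qed.

Lemma rev_gram_unit : Y \in unitmx.
Proof. by rewrite unitmx_mul gram_unit andbT; case/mulmx1_unit: (rev_mx_sqr C n). Qed.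

(** An isotropic flag has a Gram matrix that is the reversal of an upper triangular
    one. *)
Lemma rev_gram_exists : exists Y', [/\ Y' = rev_mx C n *m S, Y' \in unitmx & upper Y'].
Proof. by exists Y; split=> //; [exact: rev_gram_unit | exact: rev_gram_upper]. Qed.

Lemma gram_anti_neq0 k : S k (rev_ord k) != 0.
Proof.
have := upper_diag_neq0 rev_gram_upper rev_gram_unit (rev_ord k).
by rewrite mul_rev_mx rev_ordK.
Qed.

Lemma gram_rev k l : S l k = e * S k l.
Proof.
have ST : S^T = e *: S.
  by rewrite /S !trmx_mul trmxK (ff_tr fO) mulmxA -scalemxAr -scalemxAl.
by have /matrixP/(_ k l) := ST; rewrite !mxE.
Qed.

Lemma symmetric_of_rev_signed :
  rev_signed t we = we -> (eta t <> epsilon t -> forall k, we.1 k <> rev_ord k) -> is_symmetric t we.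
Proof.
move=> revE nrev.
have wr k : we.1 (rev_ord k) = rev_ord (we.1 k).
  by have := rev_signedE t we k; rewrite revE => ->; rewrite rev_ordK.
split=> // k wk; have := congr1 (fun u : signed_perm n => u.2 (rev_ord k)) revE.
by rewrite /= ffunE rev_ordK wk eqxx => ->.
Qed.

Lemma eh_neq : eta t <> epsilon t -> e = - h.
Proof. by case: (t) => //= _; rewrite rmorphN ?opprK. Qed.

(** The columns of [B Y'^-1] form the reversed dual basis of [B] for [omega]; they
    span the same flag, and after a change of signs they are conjugate of type
    [rev_signed t we], so uniqueness applies. If [eta] and [epsilon] differ, then
    [omega(x, delta x) = 0] for all [x], so [delta] cannot map a basis vector to a
    multiple of its mirror image, on which [omega] does not vanish. *)
Lemma conj_symmetric : conj_mx Np we B -> is_symmetric t we.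
Proof.
move=> cB; have PSP := conj_gram fP (sign_mx_tr C wI) cB.
have [D [uD D2 aD DPD]] := rev_signed_mx C t wI.
have nD : D \in unitmx by case/mulmx1_unit: D2.
have [Y' [YE nY uY]] := rev_gram_exists; have uYi := upper_inv uY nY.
have YP : Y' *m sign_mx C we = h *: (rev_mx C n *m sign_mx C we *m rev_mx C n) *m Y'.
  have SP : S *m sign_mx C we = h *: (sign_mx C we *m S).
    apply: (can_inj (mulKmx (sign_mx_unit C wI))).
    by rewrite mulmxA PSP -scalemxAr mulmxA sign_mx_sqr // mul1mx.
  rewrite YE -mulmxA SP -scalemxAr -scalemxAl; congr (_ *: _).
  by rewrite -!mulmxA (mulmxA (rev_mx C n) (rev_mx C n)) rev_mx_sqr mul1mx.
have cB' : conj_mx Np (rev_signed t we) (B *m invmx Y' *m D).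
  rewrite /conj_mx !mulmxA cB -!mulmxA; congr (B *m _).
  apply: (can_inj (mulKmx nY)). rewrite (mulmxA Y') YP -DPD mulKVmx //.
  by rewrite !mulmxA mulmxK // -!mulmxA D2 mulmx1.
have nYD : invmx Y' *m D \in unitmx by rewrite unitmx_mul unitmx_inv nY.
have rI := rev_signed_invol t wI.
apply: symmetric_of_rev_signed => [|neq k wk].
  apply: conj_unique rI wI _ nB cB' cB _; first by rewrite -mulmxA unitmx_mul nB.
  by rewrite -mulmxA flag_mx_upper //; apply: upperM.
have /matrixP/(_ k (rev_ord k)) := PSP.
rewrite [RHS]mxE mul_mx_sign // mul_sign_mx -wk invol_inv // isign_invol // wk.
rewrite mulrAC -intrM isign_sqr // mul1r gram_rev eh_neq // mulNr => /eqP.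
rewrite -subr_eq0 -opprD oppr_eq0 -mulr2n -mulr_natr !mulf_eq0 (negbTE (gram_anti_neq0 k)).
by rewrite pnatr_eq0 /= !orbF; case: (t); rewrite ?intr_eq0.
Qed.

(** The reversed dual basis again spans the same flag and is dual of type
    [rev_signed t we]. *)
Lemma dual_symmetric : dual_mx Np we B -> is_symmetric t we.
Proof.
move=> dB; have SPS := dual_gram h_sqr fP (sign_mx_sqr C wI) (sign_mx_conj C we) dB.
have [D [uD D2 aD DPD]] := rev_signed_mx C t wI.
have nD : D \in unitmx by case/mulmx1_unit: D2.
have [Y' [YE nY uY]] := rev_gram_exists; have uYi := upper_inv uY nY.
set N := h *: (rev_mx C n *m sign_mx C we *m rev_mx C n) in DPD.
have YNY : adj Y' *m N *m Y' = sign_mx C we.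
  have adjS : adj S = e *: map_mx Num.conj S.
    by apply/matrixP => i j; rewrite adjE gram_rev rmorphM rmorph_int !mxE.
  have conjS : map_mx Num.conj S *m sign_mx C we *m S = (e * h) *: sign_mx C we.
    have conjK (X : 'M[C]_n) : map_mx Num.conj (map_mx Num.conj X) = X.
      by apply/matrixP => i j; rewrite !mxE conjCK.
    have := congr1 (map_mx Num.conj) SPS.
    by rewrite map_mxZ 2!map_mxM sign_mx_conj rmorphM !rmorph_int conjK.
  have -> : adj Y' *m N *m Y' = h *: (adj S *m sign_mx C we *m S).
    rewrite YE adjM rev_mx_adj /N -scalemxAr -scalemxAl; congr (_ *: _).
    have -> : adj S *m rev_mx C n *m (rev_mx C n *m sign_mx C we *m rev_mx C n) *m (rev_mx C n *m S)
      = adj S *m (rev_mx C n *m rev_mx C n) *m sign_mx C we *m (rev_mx C n *m rev_mx C n) *m S.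
      by rewrite !mulmxA.
    by rewrite rev_mx_sqr !mulmx1.
  rewrite adjS -!scalemxAl conjS !scalerA.
  have -> : h * e * (e * h) = (h * h) * (e * e) by ring.
  by rewrite h_sqr e_sqr mulr1 scale1r.
have dB' : dual_mx Np (rev_signed t we) (B *m invmx Y' *m D).
  rewrite /dual_mx; have -> : adj (B *m invmx Y' *m D) *m Ph *m (B *m invmx Y' *m D)
      = D *m (adj (invmx Y') *m (adj B *m Ph *m B) *m invmx Y') *m D.
    by rewrite !adjM aD !mulmxA.
  have -> : adj (invmx Y') *m (adj B *m Ph *m B) *m invmx Y' = N.
    by rewrite dB -YNY adj_inv -(mulmxA (adj Y')) mulKmx ?adj_unit // mulmxK.
  by rewrite -DPD !mulmxA D2 mul1mx -mulmxA D2 mulmx1.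
have nYD : invmx Y' *m D \in unitmx by rewrite unitmx_mul unitmx_inv nY.
have rI := rev_signed_invol t wI.
apply: symmetric_of_rev_signed => [|neq k wk].
  apply: dual_unique rI wI _ nB dB' dB _; first by rewrite -mulmxA unitmx_mul nB.
  by rewrite -mulmxA flag_mx_upper //; apply: upperM.
(* The anti-diagonal entry of the Gram matrix would have squared modulus -1. *)
pose L := adj (invmx Y').
have NY : N *m Y' = L *m sign_mx C we.
  by rewrite -YNY /L adj_inv -(mulmxA (adj Y')) mulKmx ?adj_unit.
have L0 (i m : 'I_n) : (i < m)%N -> L i m = 0 by move=> lt; rewrite adjE uYi // conjC0.
have YLk : (Y' k k)^* * L k k = 1.
  have /matrixP/(_ k k) : adj Y' *m L = 1%:M by rewrite /L adj_inv mulmxV ?adj_unit.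
  rewrite mxE (bigD1 k) //= adjE [1%:M k k]mxE eqxx big1 ?addr0 // => m ne.
  have [lt|lt|/val_inj eqm] := ltngtP m k; last by rewrite eqm eqxx in ne.
    by rewrite L0 ?mulr0.
  by rewrite adjE uY ?conjC0 ?mul0r.
have wrk : we.1 (rev_ord k) = k by rewrite -wk invol_inv.
have /matrixP/(_ k (rev_ord k)) := NY.
rewrite /N -scalemxAl [LHS]mxE -mulmxA mul_mx_sign // wrk.
have -> : (rev_mx C n *m sign_mx C we *m (rev_mx C n *m Y')) k (rev_ord k)
    = (isign we (rev_ord k))%:~R * Y' (rev_ord k) (rev_ord k).
  by rewrite -mulmxA mul_rev_mx mul_sign_mx wrk mul_rev_mx.
have YE' i j : Y' i j = S (rev_ord i) j by rewrite YE mul_rev_mx.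
have sgn0 : (isign we (rev_ord k))%:~R != 0 :> C by case: (isignP wI (rev_ord k)) => ->; rewrite intr_eq0.
rewrite mulrCA [RHS]mulrC => /(mulfI sgn0).
have -> : Y' (rev_ord k) (rev_ord k) = e * Y' k k by rewrite !YE' rev_ordK gram_rev.
have he : h * e = -1 by rewrite (eh_neq neq) mulrN h_sqr.
rewrite mulrA he mulN1r => LY; move: YLk; rewrite -LY mulrN.
have := mul_conjC_ge0 (Y' k k); rewrite mulrC => + /eqP; rewrite eq_sym => ge0 /eqP n1.
have : 0 <= - 1 :> C by rewrite n1 opprK.
by rewrite oppr_ge0 ler10.
Qed.

End SymmetricFlags.

(** * Translation to matrices *)

Section Translation.
Variables (C : numClosedFieldType) (n : nat) (t : form_type).
Variables (Om : 'M[C]_n) (Np : {set 'I_n}).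
Hypotheses (fO : form_facts t Om) (cN : is_compatible t Om Np).
Implicit Types (we : signed_perm n) (B g : 'M[C]_n) (F : flag C n).

Definition gram B : 'M[C]_n := B^T *m Om *m B.

Lemma tnth_mx_basis B k : tnth (mx_basis B) k = col k B.
Proof. exact: tnth_mktuple. Qed.

Lemma gramE B k l : omega Om (col k B) (col l B) = gram B k l.
Proof. by rewrite /omega /gram tr_col -row_mul colE mulmxA -row_mul -colE 2!mxE. Qed.

Lemma conjugate_basisP we B : is_signed_involution we ->
  conjugate_basis Np we (mx_basis B) <-> conj_mx Np we B.
Proof.
move=> wI; have PhB k : Phi C Np *m col k B = col k (Phi C Np *m B) by rewrite !colE mulmxA.
have colS k i : (B *m sign_mx C we) i k =
    (if we.1 k == k then (we.2 k)%:~R *: tnth (mx_basis B) k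
     else tnth (mx_basis B) (we.1 k)) i 0.
  rewrite mul_mx_sign // /isign !tnth_mx_basis; case: eqP => [->|_].
    by rewrite !mxE mulrC.
  by rewrite mxE mulr1.
split=> [cB|cB k].
  apply/matrixP => i k; have := cB k; rewrite /delta tnth_mx_basis PhB => /colP/(_ i).
  by rewrite mxE colS !tnth_mx_basis.
apply/colP => i; rewrite -colS -cB /delta tnth_mx_basis PhB mxE.
by [].
Qed.

Lemma dual_basisP we B : is_signed_involution we ->
  dual_basis Np we (mx_basis B) <-> dual_mx Np we B.
Proof.
move=> wI; have entE k l : phi Np (tnth (mx_basis B) k) (tnth (mx_basis B) l)
    = (adj B *m Phi C Np *m B) k l.
  rewrite /phi !tnth_mx_basis; have -> : (map_mx Num.conj (col k B))^T = row k (adj B).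
    by apply/rowP => i; rewrite !mxE.
  by rewrite -row_mul colE mulmxA -row_mul -colE 2!mxE.
have sgnE k l : (if we.1 k == l then if l == k then (we.2 k)%:~R else 1 else 0) = sign_mx C we k l.
  by rewrite mxE /isign; case: eqP => // ->; case: eqP.
split=> [dB|dB k l]; first by apply/matrixP => k l; rewrite -entE dB sgnE.
by rewrite entE dB sgnE.
Qed.

Lemma omega_adaptedP we B : is_symmetric t we ->
  omega_adapted t Om we (mx_basis B) <-> gram B = omega_mx C t we.
Proof.
move=> [wI wr _ _]; rewrite /omega_adapted; split=> [aB|gB k l].
  apply/matrixP => k l; rewrite -gramE -!tnth_mx_basis mxE.
  have [a0 a1 a2 a3 a4] := aB k l.
  case: eqP => [lE|/a0//]; have wl : we.1 l = rev_ord (we.1 k) by rewrite lE wr.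
  move: (a1 lE) (a2 lE) (a3 lE) (a4 lE); rewrite wl /osign => {}a1 {}a2 {}a3 {}a4.
  have := ltn_ord k; have := ltn_ord (we.1 k); have := congr1 val lE; rewrite /= => vl ltw ltk.
  case: ifP => c1; first by apply: a1 => /=; lia.
  case: ifP => c2; first by rewrite a2 //=; lia.
  case: ifP => c3; first by rewrite a3 //=; lia.
  by rewrite a4 //=; lia.
rewrite !tnth_mx_basis gramE gB mxE.
split=> [/eqP/negbTE->//|lE|lE|lE|lE]; rewrite -lE eqxx /osign -lE.
all: have wl : we.1 l = rev_ord (we.1 k) by rewrite lE wr.
all: rewrite wl /=; have := ltn_ord k; have := ltn_ord (we.1 k); have := congr1 val lE.
all: rewrite /= => vl ltw ltk h1 h2.
- by rewrite h1.
- case: ifP => c1; last by rewrite h1.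
  by rewrite (@mid_epsilon _ t _ Om k) // -lE; apply: val_inj => /=; lia.
- by case: ifP => c1; [exfalso; lia|]; case: ifP => c2; [exfalso; lia|]; case: ifP => c3 //; exfalso; lia.
- by case: ifP => c1; [exfalso; lia|]; case: ifP => c2; [exfalso; lia|]; case: ifP => c3 //; exfalso; lia.
Qed.

Lemma isotropic_gram B : B \in unitmx -> isotropic_flags Om (flag_mx B) ->
  forall k l : 'I_n, (l < rev_ord k)%N -> gram B k l = 0.
Proof.
move=> nB [_ iso] k l lt_l; rewrite -gramE.
have lt_k1 : (k.+1 < n.+1)%N := ltn_ord k; have lt_l1 : (l.+1 < n.+1)%N := ltn_ord l.
have : perp Om (flag_mx B (Ordinal lt_l1)) (col k B).
  rewrite iso /=; apply: flag_mx_col => //=; have := ltn_ord k; have := ltn_ord l.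
  by move: lt_l; rewrite /=; lia.
by apply; apply: flag_mx_col.
Qed.

(** With a Gram matrix supported on the antidiagonal, orthogonality to the first
    [k] basis vectors kills exactly the last [k] coordinates. *)
Lemma gram_isotropic we B : is_symmetric t we -> B \in unitmx -> gram B = omega_mx C t we ->
  isotropic_flags Om (flag_mx B).
Proof.
move=> wS nB gB; split; first exact: flag_mx_flags.
have omE x y : omega Om x y =
    \sum_i (invmx B *m x) i 0 * ((osign t we i)%:~R * (invmx B *m y) (rev_ord i) 0).
  have -> : omega Om x y = ((invmx B *m x)^T *m gram B *m (invmx B *m y)) 0 0.
    by rewrite /gram /omega -{1}(mulKVmx nB x) -{1}(mulKVmx nB y) trmx_mul !mulmxA.
  rewrite gB -mulmxA mxE; apply: eq_bigr => i _.
  by rewrite mul_omega_mx [(_ ^T)%R 0 i]mxE.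
move=> k; apply/seteqP; split=> x.
  move=> px; apply/mem_flag_mx => // i le_i.
  have lt_r : (rev_ord i < k)%N by move: le_i; rewrite /=; have := ltn_ord i; have := ltn_ord k; lia.
  have := px _ (flag_mx_col nB lt_r); rewrite omE (bigD1 i) //= invmx_col // [delta_mx _ _ _ _]mxE !eqxx mulr1.
  rewrite big1 ?addr0 => [/eqP|m ne].
    rewrite mulf_eq0 => /orP[/eqP//|]; have := osign_sqr t we i.
    by case: (osign t we i =P 0) => [->|/eqP nz _]; rewrite ?mulr0 // intr_eq0 (negbTE nz).
  by rewrite [delta_mx _ _ _ _]mxE (inj_eq rev_ord_inj) (negbTE ne) !mulr0.
move=> /mem_flag_mx-/(_ nB) x0 y /mem_flag_mx-/(_ nB) y0; rewrite omE big1 // => i _.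
have [le_i|lt_i] := leqP (rev_ord k) i; first by rewrite x0 ?mul0r.
rewrite y0 ?mulr0 //; move: lt_i; rewrite /=; have := ltn_ord i; have := ltn_ord k; lia.
Qed.

Lemma adapt_isotropic we B : is_symmetric t we -> B \in unitmx ->
  exists T, [/\ T \in unitmx, gram (B *m T) = omega_mx C t we,
    conj_mx Np we B -> conj_mx Np we (B *m T), dual_mx Np we B -> dual_mx Np we (B *m T) &
    isotropic_flags Om (flag_mx B) -> upper T].
Proof.
move=> wS nB; have fS := form_pair_sign C wS (fun k => mid_epsilon fO).
have [T [nT gT cT dT uT]] := form_pair_normalise (e_sqr C t) (h_sqr C t) (form_pair_Phi fO cN) fS nB.
exists T; split=> // /(isotropic_gram nB) g0; apply: uT => i j lt_ji.
by rewrite mul_omega_mx -/(gram B) g0 ?mulr0 // rev_ordK.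
Qed.

Lemma dim_coord_space (N : {set 'I_n}) : \dim (coord_space C N) = #|N|.
Proof.
have frE : free [seq basis_vec C l | l <- enum 'I_n].
  have /basis_free : is_basis (mx_basis (1%:M : 'M[C]_n)) by apply/mx_basis_is_basis/unitmx1.
  congr (free _ = true); apply: eq_map => l.
  by rewrite colE mul1mx.
suff : free [seq basis_vec C l | l <- enum N].
  by rewrite /free /coord_space => /eqP ->; rewrite size_map -cardE.
suff : free [seq basis_vec C l | l <- enum N ++ enum (~: N)%SET] by rewrite map_cat => /catl_free.
rewrite (perm_free (perm_map (@basis_vec C n) (_ : perm_eq _ (enum 'I_n)))) //.
apply: uniq_perm; rewrite ?enum_uniq //.
  rewrite cat_uniq !enum_uniq andbT /=; apply/hasPn => k.
  by rewrite !mem_enum inE.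
by move=> k; rewrite mem_cat !mem_enum inE orbN.
Qed.

Lemma fixed_card s we :
  (#|[set k | (we.1 k == k) && (we.2 k == s)%R]%SET| + #|[set k | (we.1 k < k)%N]%SET|)%N
  = #|sign_set s we n|.
Proof.
rewrite sign_set_card -!sum1_card [X in (X + _)%N]big_mkcond [X in (_ + X)%N]big_mkcond -big_split.
apply: eq_bigr => k _ /=; rewrite !inE.
by case: eqP => [->|_] /=; rewrite ?ltnn ?orbF ?addn0 ?add0n; case: ifP.
Qed.

Let p := \dim (coord_space C Np).
Let q := \dim (coord_space C (~: Np)%SET).

Lemma symP we : signed_involutions_sym t p q we <->
  is_symmetric t we /\ #|sign_set 1 we n| = #|Np|.
Proof.
rewrite /signed_involutions_sym /signed_involutions /=.
split=> [[[wI pE qE] wr we2 wN]|[[wI wr we2 wN] c1]].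
  split; last by rewrite -fixed_card -pE /p dim_coord_space.
  split=> // [k|k|ne k].
  - by have := congr1 (fun s : 'S_n => s k) wr; rewrite !permM !permE => ->.
  - by move/we2; rewrite permE.
  - by have := wN ne k; rewrite permE.
split.
- split=> //; rewrite fixed_card /p /q dim_coord_space //.
  have := sign_set_total wI; rewrite c1 => tot.
  by apply/eqP; rewrite -(eqn_add2l #|Np|) tot cardsC card_ord.
- by apply/permP => k; rewrite !permM !permE wr.
- by move=> k /we2; rewrite permE.
- by move=> ne k; rewrite permE; apply: wN.
Qed.

End Translation.

(** * Orbits and duality *)

Section Orbits.
Variables (C : numClosedFieldType) (n : nat) (t : form_type).
Variables (Om : 'M[C]_n) (Np : {set 'I_n}).
Hypotheses (fO : form_facts t Om) (cN : is_compatible t Om Np).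
Implicit Types (we : signed_perm n) (B g : 'M[C]_n) (F : flag C n).
Notation Ph := (Phi C Np).
Notation conj_iso := (conj_flags_iso Om Np).
Notation dual_iso := (dual_flags_iso Om Np).
Notation X := (isotropic_flags Om).
Notation K := (K_group Om Np).
Notation G0 := (G0_group Om Np).

Definition adapted_flags (Q : 'M[C]_n -> Prop) we : set (flag C n) :=
  [set F | exists B, [/\ B \in unitmx, Q B, gram Om B = omega_mx C t we & flag_mx B = F]].

Lemma basis_imageE (R : n.-tuple 'cV[C]_n -> Prop) (F : flag C n) :
  [set flag_of v | v in [set v | R v]] F <-> exists B, R (mx_basis B) /\ flag_mx B = F.
Proof.
split=> [[v Rv <-]|[B [RB <-]]]; last by exists (mx_basis B).
by exists (basis_mx v); rewrite /flag_mx basis_mxK.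
Qed.

Lemma conj_flagsE we F : is_signed_involution we ->
  conj_flags Np we F <-> exists B, [/\ B \in unitmx, conj_mx Np we B & flag_mx B = F].
Proof.
move=> wI; apply: (iff_trans (basis_imageE _ _)).
split=> -[B]; first by case=> -[/mx_basis_is_basis nB /(conjugate_basisP Np B wI) cB] <-; exists B.
by case=> /mx_basis_is_basis nB /(conjugate_basisP Np B wI) cB <-; exists B.
Qed.

Lemma dual_flagsE we F : is_signed_involution we ->
  dual_flags Np we F <-> exists B, [/\ B \in unitmx, dual_mx Np we B & flag_mx B = F].
Proof.
move=> wI; apply: (iff_trans (basis_imageE _ _)).
split=> -[B]; first by case=> -[/mx_basis_is_basis nB /(dual_basisP Np B wI) cB] <-; exists B.
by case=> /mx_basis_is_basis nB /(dual_basisP Np B wI) cB <-; exists B.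
Qed.

Section Symmetric.
Variable we : signed_perm n.
Hypothesis wS : is_symmetric t we.
Let wI : is_signed_involution we. Proof. by case: wS. Qed.

Lemma conj_isoE : conj_iso we = adapted_flags (conj_mx Np we) we.
Proof.
apply/seteqP; split=> F /=.
  case=> /(conj_flagsE _ wI)[B [nB cB <-]] iF.
  have [T [nT gT cT _ uT]] := adapt_isotropic fO cN wS nB.
  exists (B *m T); split=> //; [by rewrite unitmx_mul nB | exact: cT |].
  by rewrite flag_mx_upper //; apply: uT.
case=> B [nB cB gB <-]; split; last exact: gram_isotropic gB.
by apply/(conj_flagsE _ wI); exists B.
Qed.

Lemma dual_isoE : dual_iso we = adapted_flags (dual_mx Np we) we.
Proof.
apply/seteqP; split=> F /=.
  case=> /(dual_flagsE _ wI)[B [nB dB <-]] iF.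
  have [T [nT gT _ dT uT]] := adapt_isotropic fO cN wS nB.
  exists (B *m T); split=> //; [by rewrite unitmx_mul nB | exact: dT |].
  by rewrite flag_mx_upper //; apply: uT.
case=> B [nB dB gB <-]; split; last exact: gram_isotropic gB.
by apply/(dual_flagsE _ wI); exists B.
Qed.

(** A common conjugate and dual basis is found first, then a single square root
    normalises [omega] for both. *)
Lemma conj_dual_isoE : conj_iso we `&` dual_iso we
  = adapted_flags (fun B => conj_mx Np we B /\ dual_mx Np we B) we.
Proof.
apply/seteqP; split=> F /=.
  case=> -[/(conj_flagsE _ wI)[B1 [nB1 cB1 FB1]] iF] [/(dual_flagsE _ wI)[B2 [nB2 dB2 FB2]] _].
  have [R [uR nR B12]] := flag_mx_eq nB1 nB2 (etrans FB1 (esym FB2)).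
  have [V [uV nV cV dV]] := conj_dual_basis wI nB1 nB2 uR B12 cB1 dB2.
  have nB : B1 *m V \in unitmx by rewrite unitmx_mul nB1.
  have FB : flag_mx (B1 *m V) = F by rewrite flag_mx_upper.
  have [T [nT gT cT dT uT]] := adapt_isotropic fO cN wS nB.
  exists (B1 *m V *m T); split=> //; first by rewrite unitmx_mul nB.
    by split; [exact: cT | exact: dT].
  by rewrite flag_mx_upper ?FB //; apply: uT; rewrite FB.
case=> B [nB [cB dB] gB <-]; have iF : X (flag_mx B) by exact: gram_isotropic gB.
by split; split=> //; [apply/(conj_flagsE _ wI) | apply/(dual_flagsE _ wI)]; exists B.
Qed.

Lemma adapted_flagsE (Q : 'M[C]_n -> Prop) (R : n.-tuple 'cV[C]_n -> Prop) :
    (forall B, R (mx_basis B) <-> Q B) ->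
  adapted_flags Q we = [set flag_of v | v in [set v |
    [/\ is_basis v, R v & omega_adapted t Om we v]]].
Proof.
move=> RQ; apply/seteqP; split=> F.
  case=> B [nB QB gB FB]; apply/basis_imageE; exists B; split=> //.
  by split; [apply/mx_basis_is_basis | apply/RQ | apply/omega_adaptedP].
move=> /basis_imageE[B [[/mx_basis_is_basis nB /RQ QB /(omega_adaptedP fO B wS) gB] FB]].
by exists B.
Qed.

(** The unitary model is chosen without regard to [omega]; the normalisation then
    adjusts its Gram matrix. *)
Lemma adapted_nonempty : #|sign_set 1 we n| = #|Np| ->
  adapted_flags (fun B => conj_mx Np we B /\ dual_mx Np we B) we !=set0.
Proof.
move=> card_we; have [B [BB cB]] := unitary_model C wI card_we.
have nB : B \in unitmx by case/mulmx1_unit: BB.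
have [T [nT gT cT dT _]] := adapt_isotropic fO cN wS nB.
exists (flag_mx (B *m T)), (B *m T); split=> //; first by rewrite unitmx_mul nB.
by split; [exact: cT | apply: dT; exact: unitary_conj_dual].
Qed.

(** The Gram matrix and the type determine all the structure, so the linear map
    between two adapted bases belongs to the group. *)
Lemma orbit_adapted (H : set 'M[C]_n) (Q : 'M[C]_n -> Prop) F :
    (forall g B, H g -> B \in unitmx -> Q B -> [/\ g \in unitmx, Q (g *m B) & gram Om (g *m B) = gram Om B]) ->
    (forall B B', B \in unitmx -> B' \in unitmx -> Q B -> Q B' -> gram Om B = gram Om B' ->
       H (B' *m invmx B)) ->
  adapted_flags Q we F -> orbit_flag H F = adapted_flags Q we.
Proof.
move=> HQ QH [B [nB QB gB <-]]; apply/seteqP; split=> [_ [g Hg <-]|_ [B' [nB' QB' gB' <-]]].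
  have [ng Qg gg] := HQ g B Hg nB QB; rewrite act_flag_mx; exists (g *m B); split=> //.
    by rewrite unitmx_mul ng.
  by rewrite gg.
exists (B' *m invmx B); first by apply: QH => //; rewrite gB.
by rewrite act_flag_mx mulmxKV.
Qed.

End Symmetric.

(** Stated for sesquilinear values; the bilinear case follows by conjugating the
    first argument. *)
Lemma form_mx_inj (A A' : 'M[C]_n) :
  (forall x y : 'cV[C]_n, (adj x *m A *m y) 0 0 = (adj x *m A' *m y) 0 0) -> A = A'.
Proof.
move=> AA'; apply/matrixP => i j; have := AA' (delta_mx i 0) (delta_mx j 0).
by rewrite /adj map_delta_mx trmx_delta -!rowE -!colE !mxE.
Qed.

Lemma isom_groupP g : isom_group Om g <-> g \in unitmx /\ gram Om g = Om.
Proof.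
have omE x y : omega Om (g *m x) (g *m y) = (x^T *m gram Om g *m y) 0 0.
  by rewrite /omega /gram trmx_mul !mulmxA.
split=> [[ng gE]|[ng gE]]; split=> //; last by move=> x y; rewrite omE gE.
apply: form_mx_inj => x y; have := gE (map_mx Num.conj x) y.
by rewrite omE /omega.
Qed.

Lemma K_groupP g : K g <-> [/\ g \in unitmx, gram Om g = Om & g *m Ph = Ph *m g].
Proof.
rewrite /K_group /=; split=> [[/isom_groupP[ng gE] gP]|[ng gE gP]]; split=> //.
- apply/matrixP => i j; have /colP/(_ i) := gP (delta_mx j 0).
  by rewrite /delta !mulmxA -!colE !mxE.
- exact/isom_groupP.
- by move=> x; rewrite /delta !mulmxA gP.
Qed.

Lemma G0_groupP g : G0 g <-> [/\ g \in unitmx, gram Om g = Om & adj g *m Ph *m g = Ph].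
Proof.
have phE x y : phi Np (g *m x) (g *m y) = (adj x *m (adj g *m Ph *m g) *m y) 0 0.
  by rewrite /phi -/(adj _) adjM !mulmxA.
rewrite /G0_group /=; split=> [[/isom_groupP[ng gE] gP]|[ng gE gP]]; split=> //.
- by apply: form_mx_inj => x y; rewrite -phE gP.
- exact/isom_groupP.
- by move=> x y; rewrite phE gP.
Qed.

Lemma gram_mul g B : gram Om (g *m B) = B^T *m gram Om g *m B.
Proof. by rewrite /gram trmx_mul !mulmxA. Qed.

Lemma gram_quotient B B' : B \in unitmx -> gram Om B = gram Om B' -> gram Om (B' *m invmx B) = Om.
Proof.
move=> nB eqg; rewrite gram_mul -eqg /gram trmx_inv !mulmxA mulVmx ?unitmx_tr // mul1mx.
by rewrite mulmxK.
Qed.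

Lemma conj_quotient we B B' : B \in unitmx -> conj_mx Np we B -> conj_mx Np we B' ->
  B' *m invmx B *m Ph = Ph *m (B' *m invmx B).
Proof.
move=> nB cB cB'; apply: (can_inj (mulmxK nB)).
by rewrite -[LHS]mulmxA cB !mulmxA !mulmxKV.
Qed.

Lemma dual_quotient we B B' : B \in unitmx -> dual_mx Np we B -> dual_mx Np we B' ->
  adj (B' *m invmx B) *m Ph *m (B' *m invmx B) = Ph.
Proof.
move=> nB dB dB'.
have -> : adj (B' *m invmx B) *m Ph *m (B' *m invmx B)
  = adj (invmx B) *m (adj B' *m Ph *m B') *m invmx B by rewrite adjM !mulmxA.
by rewrite dB' -dB adj_inv !mulmxA mulVmx ?adj_unit // mul1mx mulmxK.
Qed.

Lemma quotient_unit B B' : B \in unitmx -> B' \in unitmx -> B' *m invmx B \in unitmx.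
Proof. by move=> nB nB'; rewrite unitmx_mul nB' unitmx_inv. Qed.

Lemma gram_isom g B : gram Om g = Om -> gram Om (g *m B) = gram Om B.
Proof. by move=> gE; rewrite gram_mul gE. Qed.

Lemma conj_isom we g B : g *m Ph = Ph *m g -> conj_mx Np we B -> conj_mx Np we (g *m B).
Proof. by move=> gP cB; rewrite /conj_mx mulmxA -gP -mulmxA cB mulmxA. Qed.

Lemma dual_isom we g B : adj g *m Ph *m g = Ph -> dual_mx Np we B -> dual_mx Np we (g *m B).
Proof.
rewrite /dual_mx => gP <-.
by rewrite -[in RHS]gP adjM !mulmxA.
Qed.

Lemma K_orbit we F : is_symmetric t we -> conj_iso we F -> orbit_flag K F = conj_iso we.
Proof.
move=> wS; rewrite conj_isoE // => aF; apply: orbit_adapted aF => [g B /K_groupP[ng gE gP] nB cB|B B' nB nB' cB cB' gB].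
  by split=> //; [exact: conj_isom | exact: gram_isom].
apply/K_groupP; split; [exact: quotient_unit | exact: gram_quotient | exact: conj_quotient cB cB'].
Qed.

Lemma G0_orbit we F : is_symmetric t we -> dual_iso we F -> orbit_flag G0 F = dual_iso we.
Proof.
move=> wS; rewrite dual_isoE // => aF; apply: orbit_adapted aF => [g B /G0_groupP[ng gE gP] nB cB|B B' nB nB' cB cB' gB].
  by split=> //; [exact: dual_isom | exact: gram_isom].
apply/G0_groupP; split; [exact: quotient_unit | exact: gram_quotient | exact: dual_quotient cB cB'].
Qed.

Lemma KG0_orbit we F : is_symmetric t we -> (conj_iso we `&` dual_iso we) F ->
  orbit_flag (K `&` G0) F = conj_iso we `&` dual_iso we.
Proof.
move=> wS; rewrite conj_dual_isoE // => aF; apply: orbit_adapted aF.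
  move=> g B [/K_groupP[ng gE gP] /G0_groupP[_ _ gQ]] nB [cB dB].
  split=> //; last exact: gram_isom.
  by split; [exact: conj_isom | exact: dual_isom].
move=> B B' nB nB' [cB dB] [cB' dB'] gB; split.
  by apply/K_groupP; split; [exact: quotient_unit | exact: gram_quotient | exact: conj_quotient cB cB'].
by apply/G0_groupP; split; [exact: quotient_unit | exact: gram_quotient | exact: dual_quotient dB dB'].
Qed.

Definition admissible we : Prop := is_symmetric t we /\ #|sign_set 1 we n| = #|Np|.

Lemma iso_nonempty we : admissible we -> conj_iso we `&` dual_iso we !=set0.
Proof. by case=> wS card_we; rewrite conj_dual_isoE //; exact: adapted_nonempty. Qed.

Lemma conj_orbits : [set conj_iso we | we in [set we | admissible we]] = orbits K X.
Proof.
apply/seteqP; split=> [_ [we awe <-]|_ [F iF <-]].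
  have [F [cF _]] := iso_nonempty awe; case: awe => wS _.
  by exists F; [case: cF | exact: K_orbit].
have [B nB FB] := flags_flag_mx (proj1 iF).
have [T [we [uT nT wI cBT]]] := conj_exists Np nB.
have nBT : B *m T \in unitmx by rewrite unitmx_mul nB.
have FBT : flag_mx (B *m T) = F by rewrite flag_mx_upper.
have wS : is_symmetric t we.
  apply: (conj_symmetric fO cN wI nBT _ cBT); apply: isotropic_gram nBT _.
  by rewrite FBT.
exists we; first by split=> //; exact: conj_card wI nBT cBT.
by rewrite (K_orbit wS) //; split=> //; apply/(conj_flagsE _ wI); exists (B *m T).
Qed.

Lemma dual_orbits : [set dual_iso we | we in [set we | admissible we]] = orbits G0 X.
Proof.
apply/seteqP; split=> [_ [we awe <-]|_ [F iF <-]].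
  have [F [_ dF]] := iso_nonempty awe; case: awe => wS _.
  by exists F; [case: dF | exact: G0_orbit].
have [B nB FB] := flags_flag_mx (proj1 iF).
have [T [we [uT nT wI dBT]]] := dual_exists Np nB.
have nBT : B *m T \in unitmx by rewrite unitmx_mul nB.
have FBT : flag_mx (B *m T) = F by rewrite flag_mx_upper.
have wS : is_symmetric t we.
  apply: (dual_symmetric fO cN wI nBT _ dBT); apply: isotropic_gram nBT _.
  by rewrite FBT.
exists we; first by split=> //; exact: dual_card wI nBT dBT.
by rewrite (G0_orbit wS) //; split=> //; apply/(dual_flagsE _ wI); exists (B *m T).
Qed.

Lemma iso_dominated we we' F : admissible we -> admissible we' ->
  conj_iso we F -> dual_iso we' F -> dominated we we'.
Proof.
move=> [[wI _ _ _] _] [[wI' _ _ _] _] [/(conj_flagsE _ wI)[B [nB cB FB]] _].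
move=> [/(dual_flagsE _ wI')[B' [nB' dB' FB']] _].
by have [] := conj_dual_dominated wI wI' nB nB' cB dB' (etrans FB (esym FB')).
Qed.

Lemma conj_iso_inj we we' : admissible we -> admissible we' -> conj_iso we = conj_iso we' -> we = we'.
Proof.
move=> awe awe' eqO; have [F [cF _]] := iso_nonempty awe.
have cF' : conj_iso we' F by rewrite -eqO.
case: awe awe' => [[wI _ _ _] _] [[wI' _ _ _] _].
case: cF cF' => /(conj_flagsE _ wI)[B [nB cB FB]] _ [/(conj_flagsE _ wI')[B' [nB' cB' FB']] _].
exact: conj_unique wI wI' nB nB' cB cB' (etrans FB (esym FB')).
Qed.

Lemma dual_iso_inj we we' : admissible we -> admissible we' -> dual_iso we = dual_iso we' -> we = we'.
Proof.
move=> awe awe' eqO; have [F [_ cF]] := iso_nonempty awe.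
have cF' : dual_iso we' F by rewrite -eqO.
case: awe awe' => [[wI _ _ _] _] [[wI' _ _ _] _].
case: cF cF' => /(dual_flagsE _ wI)[B [nB cB FB]] _ [/(dual_flagsE _ wI')[B' [nB' cB' FB']] _].
exact: dual_unique wI wI' nB nB' cB cB' (etrans FB (esym FB')).
Qed.

(** Labels of K-orbits are unique, so this union has a single term on an orbit. *)
Definition duality (O : set (flag C n)) : set (flag C n) :=
  [set F | exists we, [/\ admissible we, O = conj_iso we & dual_iso we F]].

Lemma dualityE we : admissible we -> duality (conj_iso we) = dual_iso we.
Proof.
move=> awe; apply/seteqP; split=> [F [we' [awe' eqO dF]]|F dF].
  by rewrite (conj_iso_inj awe awe' eqO).
by exists we.
Qed.

(** A K-orbit meets its image, so the label of the image dominates its label. By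
    descending induction on [total_rank], if the label [u] of the image of the
    orbit of [we] were not [we], then the orbit of [u] would be mapped to the same
    orbit, against injectivity. *)
Lemma matsuki_unique (Xi' : set (flag C n) -> set (flag C n)) we :
  matsuki_property Om Np Xi' -> admissible we -> Xi' (conj_iso we) = dual_iso we.
Proof.
move=> [[Xfun Xinj _] Xorb].
have orbK u : admissible u -> orbits K X (conj_iso u) by move=> au; rewrite -conj_orbits; exists u.
have image u : admissible u -> exists u', [/\ admissible u', Xi' (conj_iso u) = dual_iso u' & dominated u u'].
  move=> au; have : orbits G0 X (Xi' (conj_iso u)) by apply: Xfun; exact: orbK.
  rewrite -dual_orbits => -[u' au' eqX]; exists u'; split=> //.
  have [F iF FE] := Xorb _ (orbK u au).
  have : (conj_iso u `&` Xi' (conj_iso u)) F.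
    rewrite -FE; exists 1%:M.
      split; [apply/K_groupP | apply/G0_groupP]; split; rewrite ?unitmx1 //.
      - by rewrite /gram trmx1 mul1mx mulmx1.
      - by rewrite mul1mx mulmx1.
      - by rewrite /gram trmx1 mul1mx mulmx1.
      - by rewrite mulmx1 /adj map_mx1 trmx1 mul1mx.
    have [B nB <-] := flags_flag_mx (proj1 iF).
    by rewrite act_flag_mx mul1mx.
  by rewrite -eqX => -[cF dF]; exact: iso_dominated cF dF.
pose bound := (n.+1 * (n.+1 * n) + n.+1 * n)%N.
have [m lem] := ubnP (bound - total_rank we)%N; elim: m we lem => // m IHm we lem awe.
have [u [au eqX dom]] := image we awe.
have [eq_wu|ne_wu] := EM (we = u); first by rewrite eqX -eq_wu.
case: (ne_wu).
have [[wI _ _ _] _] := awe; have [[uI _ _ _] _] := au.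
have lt_tot : (total_rank we < total_rank u)%N.
  rewrite ltn_neqAle dominated_total // andbT.
  by apply/eqP => /(total_rank_inj wI uI dom).
have Xu : Xi' (conj_iso u) = dual_iso u.
  apply: IHm => //; have := total_rank_bound u; rewrite -/bound; move: lem lt_tot; lia.
apply: conj_iso_inj => //; apply: Xinj; rewrite ?inE; try exact: orbK.
by rewrite eqX Xu.
Qed.

Lemma duality_matsuki : is_matsuki_duality Om Np duality.
Proof.
have orbKP O : orbits K X O -> exists2 we, admissible we & conj_iso we = O.
  by rewrite -conj_orbits => -[we awe <-]; exists we.
split; last first.
  by move=> Xi' mXi' O /orbKP[we awe <-]; rewrite dualityE //; exact: matsuki_unique.
split; first split.
- by move=> O /orbKP[we awe <-]; rewrite dualityE // -dual_orbits; exists we.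
- move=> O O'; rewrite !inE => /orbKP[we awe <-] /orbKP[we' awe' <-].
  by rewrite !dualityE // => /(dual_iso_inj awe awe') ->.
- move=> O; rewrite -dual_orbits => -[we awe <-]; exists (conj_iso we); last exact: dualityE.
  by rewrite -conj_orbits; exists we.
move=> O /orbKP[we awe <-]; rewrite dualityE //.
have [F cdF] := iso_nonempty awe; exists F; first by case: cdF => -[].
by case: awe => wS _; exact: KG0_orbit.
Qed.

End Orbits.

Theorem proposition6 (R : realType) (t : form_type) (n : nat)
    (Om : 'M[R[i]]_n) (Np : {set 'I_n}) (hOm : is_form_matrix t Om)
    (hNp : is_compatible t Om Np) :
  let p := \dim (coord_space R[i] Np) in
  let q := \dim (coord_space R[i] (~: Np)%SET) in
  let J := @signed_involutions_sym t n p q in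
  let X := isotropic_flags Om in
  let K := K_group Om Np in
  let G0 := G0_group Om Np in
  [/\ (* (a) *)
      forall we, J we ->
        [/\ conj_flags_iso Om Np we =
              [set flag_of v | v in [set v |
                [/\ is_basis v, conjugate_basis Np we v &
                    omega_adapted t Om we v]]] /\
            conj_flags_iso Om Np we !=set0,
            dual_flags_iso Om Np we =
              [set flag_of v | v in [set v |
                [/\ is_basis v, dual_basis Np we v &
                    omega_adapted t Om we v]]] /\
            dual_flags_iso Om Np we !=set0 &
            conj_flags_iso Om Np we `&` dual_flags_iso Om Np we =
              [set flag_of v | v in [set v |
                [/\ is_basis v, conjugate_basis Np we v, dual_basis Np we v &
                    omega_adapted t Om we v]]] /\
            conj_flags_iso Om Np we `&` dual_flags_iso Om Np we !=set0],
      (* (b) *)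
      [set conj_flags_iso Om Np we | we in J] = orbits K X /\
      [set dual_flags_iso Om Np we | we in J] = orbits G0 X &
      (* (c) *)
      exists Xi, is_matsuki_duality Om Np Xi /\
        forall we, J we -> Xi (conj_flags_iso Om Np we) = dual_flags_iso Om Np we].
Proof.
move=> p q J X K G0; have fO := is_form_matrix_facts hOm.
have JE : J = [set we | admissible t Np we].
  by apply/seteqP; split=> we /(symP R[i] t Np we).
split; last 1 first.
- exists (duality t Om Np); split; first exact: duality_matsuki.
  by rewrite JE => we; exact: dualityE.
- rewrite JE => we awe; have [wS card_we] := awe; have [wI _ _ _] := wS.
  have [F [cF dF]] := iso_nonempty fO hNp awe.
  split; (split; last by exists F).
  + rewrite (conj_isoE fO hNp wS); apply: adapted_flagsE => // B; exact: conjugate_basisP.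
  + rewrite (dual_isoE fO hNp wS); apply: adapted_flagsE => // B; exact: dual_basisP.
  rewrite (conj_dual_isoE fO hNp wS) (adapted_flagsE fO wS
    (R := fun v => conjugate_basis Np we v /\ dual_basis Np we v)); last first.
    by move=> B; rewrite conjugate_basisP // dual_basisP.
  by congr (image _ _); apply/seteqP; split=> v /=; [case=> ? [? ?] ? | case=> ? ? ? ?].
- by rewrite JE conj_orbits // dual_orbits.
Qed.
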